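(* Let $\rho$ be a smooth real-valued function on a neighbourhood of the origin $0$ in $\mathbb C^n$. Suppose $\rho$ has a nondegenerate hermitian critical point at $0$, which is not a minimum. Then the open set $\{\rho<\rho(0)\}$ is locally schlicht at $0$.
   Context: Hermitian critical point: if $\rho$ has a nondegenerate critical point at $0$, its Taylor series at $0$ is $\rho(0)+\sigma+$ higher-order terms, where $\sigma$ is a nondegenerate real quadratic form on $\mathbb C^n\cong\mathbb R^{2n}$. Write $\sigma(z)=\bar z^t H z+\mathrm{Re}(z^t S z)$ with $H$ a hermitian and $S$ a complex symmetric $n\times n$ matrix. The critical point is called hermitian if $S=0$, i.e. $\sigma(z)=\bar z^tHz$; equivalently, the linear part of the Taylor expansion of the gradient of $\rho$ at $0$ is complex-linear. Locally schlicht: an open subset $\Omega$ of a complex manifold $X$ is locally schlicht at a boundary point $p$ of $\Omega$ in $X$ if $p$ has a basis of open neighbourhoods $U$ such that (1) $U$ is connected and Stein, (2) there is a Stein open set $V$ with $\Omega\cap U\subset V\subset U$, and (3) every holomorphic function on $\Omega\cap U$ extends to a holomorphic function on $V$. (Then $V$ is the envelope of holomorphy of $\Omega\cap U$; $\Omega\cap U$ and $V$ may be disconnected.) *)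

(* Defs.v *)
(* C^n is 'rV[R[i]]_n for R : realType. *)
From HB Require Import structures.
From mathcomp Require Import all_boot all_order all_algebra.
From mathcomp Require Import complex.
From mathcomp Require Import all_classical all_reals.
From mathcomp Require Import topology normedtype derive.

Set Warnings "-redundant-canonical-projection".
Set Implicit Arguments.
Unset Strict Implicit.
Unset Printing Implicit Defensive.

Import Order.TTheory GRing.Theory Num.Theory numFieldNormedType.Exports.

Local Open Scope classical_set_scope.
Local Open Scope ring_scope.
Local Open Scope complex_scope.

(* The library provides the norm topology of a numFieldType K only for K^o and
   for abstract K; these instances make it available on the concrete R[i], in
   the same way as numFieldNormedType does for abstract number fields. *)
#[non_forgetful_inheritance]
HB.instance Definition _ (R : realType) := GRing.ComAlgebra.copy R[i] R[i]^o.
#[non_forgetful_inheritance]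
HB.instance Definition _ (R : realType) := Vector.copy R[i] R[i]^o.
#[non_forgetful_inheritance]
HB.instance Definition _ (R : realType) := NormedModule.copy R[i] R[i]^o.

Section RealCalculus.
Variables (R : realType) (m : nat).
Implicit Types (D : set 'rV[R]_m) (f : 'rV[R]_m -> R) (p : 'rV[R]_m).

Definition partial (i : 'I_m) f : 'rV[R]_m -> R :=
  fun x => 'D_(delta_mx 0 i) f x.

(* Meant for open D: iterated partial derivatives at points of D then depend
   only on the restriction of f to D. *)
Fixpoint Ck_on (k : nat) D f : Prop :=
  (forall x, D x -> {for x, continuous f}) /\
  (if k is k'.+1 then
     forall i : 'I_m, (forall x, D x -> derivable f x (delta_mx 0 i)) /\
                      Ck_on k' D (partial i f)
   else True).

Definition smooth_on D f : Prop := forall k : nat, Ck_on k D f.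

Definition hessian f p : 'M[R]_m :=
  \matrix_(i, j) partial i (partial j f) p.

Definition critical_point f p : Prop := forall i : 'I_m, partial i f p = 0.

Definition nondegenerate_critical_point f p : Prop :=
  critical_point f p /\ hessian f p \in unitmx.

(* The degree 2 homogeneous part of the Taylor expansion of f at p. *)
Definition taylor2 f p (x : 'rV[R]_m) : R :=
  2^-1 * (x *m hessian f p *m x^T) 0 0.

End RealCalculus.

Section ComplexSpace.
Variables (R : realType) (n : nat).
Local Notation Cn := 'rV[R[i]]_n.
Implicit Types (rho : Cn -> R) (f g : Cn -> R[i]).
Implicit Types (z w p : Cn) (K U V W Omega : set Cn).

(* The identification of C^n with R^2n, with real coordinates
   (x_1, ..., x_n, y_1, ..., y_n) for z_j = x_j + i y_j. *)
Definition of_real (x : 'rV[R]_(n + n)) : Cn :=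
  \row_j (x 0 (lshift n j) +i* x 0 (rshift n j)).

Definition to_real z : 'rV[R]_(n + n) :=
  row_mx (map_mx (@complex.Re R) z) (map_mx (@complex.Im R) z).

Lemma to_realK : cancel to_real of_real.
Proof.
move=> z; apply/rowP => j; rewrite mxE /to_real row_mxEl row_mxEr !mxE.
by case: (z 0 j).
Qed.

Lemma of_realK : cancel of_real to_real.
Proof.
move=> x; apply/rowP => j; rewrite -[j]fintype.splitK; case: (fintype.split j) => k /=.
  by rewrite /to_real row_mxEl !mxE.
by rewrite /to_real row_mxEr !mxE.
Qed.

Definition smooth_onC U rho : Prop :=
  smooth_on (of_real @^-1` U) (rho \o of_real).

(* sigma *)
Definition quadratic_part rho p z : R :=
  taylor2 (rho \o of_real) (to_real p) (to_real z).

(* The quadratic part of rho at p is \bar z^t H z for a hermitian matrix H;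
   points of C^n being row vectors, the column vector z is z^T below. *)
Definition nondegenerate_hermitian_critical_point rho p : Prop :=
  nondegenerate_critical_point (rho \o of_real) (to_real p) /\
  exists H : 'M[R[i]]_n, H \is hermsymmx /\
    forall z, (quadratic_part rho p z)%:C = (map_mx Num.conj z *m H *m z^T) 0 0.

Definition local_minimum rho p : Prop := \forall z \near p, rho p <= rho z.

(* Differentiability is over R[i], i.e. complex differentiability. *)
Definition holomorphic_on U f : Prop := forall z, U z -> differentiable f z.

(* For nonempty K the bound is |f z| <= sup_K |f|; the hull of the empty set is
   empty. *)
Definition holomorphic_hull U K : set Cn :=
  [set z | U z /\
    forall f, holomorphic_on U f ->
    forall M : R, (forall w, K w -> `|f w| <= M%:C) -> `|f z| <= M%:C].

Definition holomorphically_convex U : Prop :=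
  forall K, K `<=` U -> compact K -> compact (holomorphic_hull U K).

Definition holomorphically_separable U : Prop :=
  forall z w, U z -> U w -> z <> w ->
  exists f, holomorphic_on U f /\ f z <> f w.

Definition has_global_local_coordinates U : Prop :=
  forall z, U z -> exists F : 'I_n -> Cn -> R[i],
    (forall i, holomorphic_on U (F i)) /\
    \matrix_(i, j) 'D_(delta_mx 0 j) (F i) z \in unitmx.

(* The definition of a Stein manifold, for the manifold U; the last two clauses
   always hold for open subsets of C^n. *)
Definition Stein U : Prop :=
  [/\ open U, holomorphically_convex U, holomorphically_separable U &
      has_global_local_coordinates U].

Definition boundary Omega : set Cn := closure Omega `\` interior Omega.

Definition locally_schlicht Omega p : Prop :=
  [/\ open Omega, boundary Omega p &
    forall W, nbhs p W -> exists U,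
      [/\ open U, U p, U `<=` W, connected U /\ Stein U &
        exists V,
          [/\ Stein V, Omega `&` U `<=` V, V `<=` U &
            forall f, holomorphic_on (Omega `&` U) f ->
            exists g, holomorphic_on V g /\
                      (forall z, (Omega `&` U) z -> g z = f z)]]].

End ComplexSpace.

(* Main.v *)
Require Import Defs.
From HB Require Import structures.
From mathcomp Require Import all_boot all_order all_algebra.
From mathcomp Require Import complex.
From mathcomp Require Import all_classical all_reals.
From mathcomp Require Import topology normedtype landau sequences derive.
From mathcomp Require Import interval_inference zify ring lra.
Import Order.TTheory GRing.Theory Num.Theory numFieldNormedType.Exports.
Local Open Scope classical_set_scope.
Local Open Scope ring_scope.

(** The spectral theorem diagonalises the hermitian quadratic part of rho at 0 by a
    complex linear change of coordinates, so that it becomes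
      S w = kap * sum_(j not in N) |w_j|^2 - sum_(j in N) |w_j|^2
    with a small constant kap > 0; N is not empty, as 0 is not a minimum
    (adapted_coordinates, negative_direction). In these coordinates let O be the
    sublevel set {rho < rho 0} in a small polydisc P. The expansions of order two
    of rho and of its derivatives along lines give three properties of O:
    - O contains the points of P at which some w_i <> 0 with i in N is larger than
      one tenth of every coordinate outside N (sublevel_cone);
    - at every point of O some w_i with i in N is nonzero (sublevel_nonzero);
    - O is stable under multiplication of all coordinates outside N by the same
      real number in [0, 1] (sublevel_star).
    From these properties core_extension produces a Stein set V between O and P to
    which all holomorphic functions on O extend; P and V, transported back by the
    change of coordinates, are the required neighbourhood and envelope.

    If N has at least two elements, then V = P, by a Hartogs argument
    (hartogs_extension): where w_i0 is small, with i0 in N, Cauchy's formula over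
    squares in the direction i0, whose boundaries lie in O by the first property,
    defines the extension. It agrees with f where another coordinate of N
    dominates, hence on all of O by the identity theorem along the contracting
    segments.

    If N = {i0}, the function 1 / w_i0 is holomorphic on O, and V is the set of the
    points p such that all functions on O extend along the segment which contracts
    p into the cone (envelope). These extensions are unique (good_unique), so they
    define a function on V, and V is Stein by the argument of Cartan and Thullen
    (envelope_Stein): bounds of the Taylor coefficients along the contractions of a
    compact set K pass to the holomorphically convex hull of K, and the resulting
    Taylor series extend all functions to tubes of a fixed radius about the points
    of the hull.

    The function theory needed is developed from complex differentiability, without
    path integrals. The boundary integral over a square is replaced by midpoint sums
    over 3^m points on each edge (bsum). They are exactly additive when the square is
    cut into nine cells and vanish on affine functions, which is all that Goursat's
    argument uses (goursat); for 1 / (u - c) their modulus is bounded below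
    (bsum_pole, kappa_ge). This yields a residue theorem in the limit (residue), the bound of a
    function by its values on the boundary (mean_value_bound) and Cauchy's estimates
    (cauchy_estimate). In several variables these give second order bounds on
    polydiscs (holo_second_order), hence Weierstrass's theorem (holo_ulim), the
    holomorphy of partial derivatives (holo_partial), the identity theorem along
    segments (identity_segment) and Taylor series (tay_extension). *)

Set Implicit Arguments.
Unset Strict Implicit.
Unset Printing Implicit Defensive.
Local Open Scope complex_scope.

(** * The modulus of a complex number *)

Section Modulus.
Variable R : realType.
Local Notation C := R[i].

(** The norm of R[i] takes its values in R[i]; cn is the same modulus as an
    element of R, so that all estimates are inequalities between reals. *)
Definition cn (x : C) : R := Normc.normc x.

Lemma normE (x : C) : `|x| = (cn x)%:C.
Proof. by case: x => a b; rewrite normc_def. Qed.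

Lemma cn_ge0 x : 0 <= cn x.
Proof. by case: x => a b; rewrite /cn /= sqrtr_ge0. Qed.
Lemma cn0 : cn 0 = 0. Proof. exact: Normc.normc0. Qed.
Lemma cn1 : cn 1 = 1. Proof. exact: Normc.normc1. Qed.
Lemma cnM x y : cn (x * y) = cn x * cn y. Proof. exact: Normc.normcM. Qed.
Lemma cnV x : cn x^-1 = (cn x)^-1. Proof. exact: Normc.normcV. Qed.
Lemma cnX x k : cn (x ^+ k) = cn x ^+ k.
Proof. by elim: k => [|k IH]; rewrite ?expr0 ?cn1// !exprS cnM IH. Qed.
Lemma cnN x : cn (- x) = cn x. Proof. exact: normcN. Qed.
Lemma cnD x y : cn (x + y) <= cn x + cn y. Proof. exact: le_normcD. Qed.
Lemma cnB x y : cn (x - y) <= cn x + cn y.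
Proof. by rewrite -(cnN y) cnD. Qed.
Lemma cnC x y : cn (x - y) = cn (y - x).
Proof. by rewrite -cnN opprB. Qed.
Lemma cn_tri y x z : cn (x - z) <= cn (x - y) + cn (y - z).
Proof. by rewrite (_ : x - z = (x - y) + (y - z)) ?cnD//; ring. Qed.
Lemma cn_addr_ge x u : cn u - cn x <= cn (x + u).
Proof.
have := cnD (x + u) (- x); rewrite cnN (_ : x + u - x = u); first by lra.
by ring.
Qed.
Lemma cn_eq0 x : (cn x == 0) = (x == 0).
Proof.
by apply/eqP/eqP => [/Normc.eq0_normc|->]//; rewrite cn0.
Qed.
Lemma cn_gt0 x : (0 < cn x) = (x != 0).
Proof. by rewrite lt_neqAle cn_ge0 andbT eq_sym cn_eq0. Qed.
Lemma cn_real (x : R) : cn x%:C = `|x|.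
Proof. by rewrite /cn /= expr0n /= addr0 sqrtr_sqr. Qed.
Lemma cn_Re x : `|complex.Re x| <= cn x.
Proof.
case: x => a b; rewrite /cn /= -sqrtr_sqr ler_wsqrtr// lerDl; exact: sqr_ge0.
Qed.
Lemma cn_Im x : `|complex.Im x| <= cn x.
Proof.
case: x => a b; rewrite /cn /= -sqrtr_sqr ler_wsqrtr// lerDr; exact: sqr_ge0.
Qed.
Lemma cn_i : cn 'i = 1 :> R.
Proof. by rewrite /cn /= expr0n expr1n add0r sqrtr1. Qed.
Lemma cn_le_ReIm x : cn x <= `|complex.Re x| + `|complex.Im x|.
Proof.
rewrite [x in cn x]complexE (le_trans (cnD _ _))// cnM cn_i mul1r.
by rewrite !cn_real.
Qed.
Lemma cnMn x k : cn (x *+ k) = cn x *+ k. Proof. exact: normcMn. Qed.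
Lemma cn_nat k : cn k%:R = k%:R :> R.
Proof. by rewrite cnMn cn1. Qed.
Lemma cnD_le x y a b : cn x <= a -> cn y <= b -> cn (x + y) <= a + b.
Proof. by move=> xa yb; rewrite (le_trans (cnD _ _))// lerD. Qed.
Lemma cn_sum (I : Type) (r : seq I) (P : pred I) (F : I -> C) :
  cn (\sum_(k <- r | P k) F k) <= \sum_(k <- r | P k) cn (F k).
Proof.
elim/big_ind2 : _ => [|x a y b xa yb|//]; first by rewrite cn0.
by rewrite (le_trans (cnD _ _))// lerD.
Qed.

End Modulus.

(** * Boundary sums over squares *)

Section Average.
Variable R : realType.
Local Notation C := R[i].
Implicit Types (phi psi : R -> C) (G : C -> C).

(** The midpoint rule on the 3^m equal parts of [-1, 1]. Splitting into an odd
    number of parts keeps the centre of an interval, and later of a square, at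
    the centre of one of its parts; a pole at the centre is therefore never on
    an edge of a subdivision. *)
Fixpoint avg (m : nat) phi : C :=
  if m is m'.+1 then
    (avg m' (fun t => phi ((t - 2) / 3)) + avg m' (fun t => phi (t / 3)) +
     avg m' (fun t => phi ((t + 2) / 3))) / 3
  else phi 0.

Lemma avg_ext m phi psi :
  (forall t, `|t| <= 1 -> phi t = psi t) -> avg m phi = avg m psi.
Proof.
elim: m phi psi => [|m IH] phi psi e /=; first by rewrite e// normr0.
by congr (( _ + _ + _) / _); apply: IH => t; rewrite ler_norml => tb;
  apply: e; rewrite ler_norml; lra.
Qed.

Lemma avgD m phi psi : avg m (fun t => phi t + psi t) = avg m phi + avg m psi.
Proof. by elim: m phi psi => [//|m IH] phi psi /=; rewrite !IH; ring. Qed.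

Lemma avgZ m a phi : avg m (fun t => a * phi t) = a * avg m phi.
Proof. by elim: m phi => [//|m IH] phi /=; rewrite !IH; ring. Qed.

(** Midpoint rules are exact on affine functions. *)
Lemma avg_aff m (a b : C) : avg m (fun t => a + t%:C * b) = a.
Proof.
elim: m a b => [|m IH] a b /=; first by rewrite mul0r addr0.
pose f d := fun t : R => (a + d%:C / 3 * b) + t%:C * (b / 3).
rewrite (@avg_ext m _ (f (-2))); last first.
  by move=> t _; rewrite /f !rmorphM/= fmorphV rmorphD/= !rmorphN !rmorph_nat; by field.
rewrite (@avg_ext m (fun t => _ + (t / 3)%:C * _) (f 0)); last first.
  by move=> t _; rewrite /f !rmorphM/= fmorphV  !rmorph_nat rmorph0; by field.
rewrite (@avg_ext m (fun t => _ + ((t + 2) / 3)%:C * _) (f 2)); last first.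
  by move=> t _; rewrite /f !rmorphM/= fmorphV rmorphD/= !rmorph_nat; by field.
rewrite !IH rmorphN rmorph0 !rmorph_nat; by field.
Qed.

Lemma avg_bound m phi (M : R) :
  (forall t, `|t| <= 1 -> cn (phi t) <= M) -> cn (avg m phi) <= M.
Proof.
elim: m phi => [|m IH] phi e /=; first by rewrite e// normr0.
rewrite cnM cnV cn_nat ler_pdivrMr//.
set a := avg _ _; set b := avg _ _; set c := avg _ _.
have Ha : cn a <= M.
  by apply: IH => t; rewrite ler_norml => tb; apply: e; rewrite ler_norml; lra.
have Hb : cn b <= M.
  by apply: IH => t; rewrite ler_norml => tb; apply: e; rewrite ler_norml; lra.
have Hc : cn c <= M.
  by apply: IH => t; rewrite ler_norml => tb; apply: e; rewrite ler_norml; lra.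
have := cnD (a + b) c; have := cnD a b; lra.
Qed.

Lemma Re_avg m phi (a : R) :
  (forall t, `|t| <= 1 -> a <= complex.Re (phi t)) -> a <= complex.Re (avg m phi).
Proof.
elim: m phi => [|m IH] phi e /=; first by rewrite e// normr0.
set x := avg _ _; set y := avg _ _; set z := avg _ _.
have Hx : a <= complex.Re x.
  by apply: IH => t; rewrite ler_norml => tb; apply: e; rewrite ler_norml; lra.
have Hy : a <= complex.Re y.
  by apply: IH => t; rewrite ler_norml => tb; apply: e; rewrite ler_norml; lra.
have Hz : a <= complex.Re z.
  by apply: IH => t; rewrite ler_norml => tb; apply: e; rewrite ler_norml; lra.
have -> : (x + y + z) / 3 = (3^-1)%:C * (x + y + z).
  by rewrite mulrC fmorphV rmorph_nat.
case: x y z Hx Hy Hz => [x x'] [y y'] [z z'] /= Hx Hy Hz.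
by rewrite mul0r subr0; lra.
Qed.

Definition edge m G (p v : C) : C := avg m (fun t => G (p + t%:C * v)).

(** The midpoint discretisation of 1/(2i) times the integral of G over the
    boundary of the square with centre c and half side r. *)
Definition bsum m G (c r : C) : C :=
  r * (edge m G (c + r) ('i * r) - edge m G (c - r) ('i * r) +
       'i * (edge m G (c + 'i * r) r - edge m G (c - 'i * r) r)).

Lemma edgeS m G p v : edge m.+1 G p v =
  (edge m G (p - 2 / 3 * v) (v / 3) + edge m G p (v / 3) +
   edge m G (p + 2 / 3 * v) (v / 3)) / 3.
Proof.
rewrite /edge /=; congr ((_ + _ + _) / _); apply: avg_ext => t _; congr G;
 rewrite ?rmorphM/= ?fmorphV ?rmorphD/= ?rmorphN ?rmorph_nat; by field.
Qed.

(** Cutting the square into nine cells gives an exact identity: each edge inside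
    the square belongs to two cells and is counted with opposite signs, and the
    outer edges are cut into three as in the definition of the averages. *)
Lemma bsumS m G c r : bsum m.+1 G c r =
  let B p q := bsum m G (c + 2 / 3 * r * (p + 'i * q)) (r / 3) in
  (B (-1) (-1) + B 0 (-1) + B 1 (-1)) + (B (-1) 0 + B 0 0 + B 1 0) +
  (B (-1) 1 + B 0 1 + B 1 1).
Proof.
(* In units of r / 3, V a b and H a b are the vertical and the horizontal edge
   with midpoint (a, b). *)
pose V (a b : C) := edge m G (c + r / 3 * (a + 'i * b)) ('i * (r / 3)).
pose H (a b : C) := edge m G (c + r / 3 * (a + 'i * b)) (r / 3).
have BE (p q : C) : bsum m G (c + 2 / 3 * r * (p + 'i * q)) (r / 3) =
   r / 3 * (V (2 * p + 1) (2 * q) - V (2 * p - 1) (2 * q) +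
       'i * (H (2 * p) (2 * q + 1) - H (2 * p) (2 * q - 1))).
  rewrite /bsum /V /H; congr (_ * (edge _ _ _ _ - edge _ _ _ _ + _ * (edge _ _ _ _ - edge _ _ _ _)));
  by field.
cbv beta zeta; rewrite !BE /bsum !edgeS.
have N0 : 2 * 0 = 0 :> C by rewrite mulr0.
have N1 : 2 * 1 = 2 :> C by rewrite mulr1.
have N2 : 2 * -1 = -2 :> C by rewrite mulrN1.
have N3 : 2 + 1 = 3 :> C by ring.
have N4 : 2 - 1 = 1 :> C by ring.
have N5 : -2 + 1 = -1 :> C by ring.
have N6 : -2 - 1 = -3 :> C by ring.
rewrite !N0 !N1 !N2 !add0r !N3 !N4 !N5 !N6.
have EV (a b x v : C) : x = c + r / 3 * (a + 'i * b) -> v = 'i * (r / 3) ->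
    edge m G x v = V a b by move=> -> ->.
have EH (a b x v : C) : x = c + r / 3 * (a + 'i * b) -> v = r / 3 ->
    edge m G x v = H a b by move=> -> ->.
rewrite (EV 3 (-2) (c + r - _)); [|by field|by field].
rewrite (EV 3 0 (c + r)); [|by field|by field].
rewrite (EV 3 2 (c + r + _)); [|by field|by field].
rewrite (EV (-3) (-2) (c - r - _)); [|by field|by field].
rewrite (EV (-3) 0 (c - r)); [|by field|by field].
rewrite (EV (-3) 2 (c - r + _)); [|by field|by field].
rewrite (EH (-2) 3 (c + 'i * r - _)); [|by field|by field].
rewrite (EH 0 3 (c + 'i * r)); [|by field|by field].
rewrite (EH 2 3 (c + 'i * r + _)); [|by field|by field].
rewrite (EH (-2) (-3) (c - 'i * r - _)); [|by field|by field].
rewrite (EH 0 (-3) (c - 'i * r)); [|by field|by field].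
rewrite (EH 2 (-3) (c - 'i * r + _)); [|by field|by field].
by field.
Qed.

End Average.

(** * Goursat's theorem *)

Section Goursat.
Variable R : realType.
Local Notation C := R[i].
Implicit Types (G H : C -> C) (c u s a : C) (r : R).

Definition cdiff G u a := forall eta : R, 0 < eta -> exists delta : R, 0 < delta /\
  forall s, cn s <= delta -> cn (G (u + s) - G u - a * s) <= eta * cn s.

(** Closed squares. The boundary enters only through points of the square at
    distance at least r from its centre. *)
Definition square c r u := `|complex.Re (u - c)| <= r /\ `|complex.Im (u - c)| <= r.
Definition sqbound c r u := square c r u /\ r <= cn (u - c).

Lemma square_cn c r u : square c r u -> cn (u - c) <= 2 * r.
Proof. by case=> h1 h2; have := cn_le_ReIm (u - c); lra. Qed.

Lemma ReD (x y : C) : complex.Re (x + y) = complex.Re x + complex.Re y.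
Proof. by case: x y => [? ?] [? ?]. Qed.
Lemma ImD (x y : C) : complex.Im (x + y) = complex.Im x + complex.Im y.
Proof. by case: x y => [? ?] [? ?]. Qed.
Lemma ReN (x : C) : complex.Re (- x) = - complex.Re x.
Proof. by case: x => [? ?]. Qed.
Lemma ImN (x : C) : complex.Im (- x) = - complex.Im x.
Proof. by case: x => [? ?]. Qed.
Lemma ReZ (x : R) (y : C) : complex.Re (x%:C * y) = x * complex.Re y.
Proof. by case: y => [? ?] /=; rewrite mul0r subr0. Qed.
Lemma ImZ (x : R) (y : C) : complex.Im (x%:C * y) = x * complex.Im y.
Proof. by case: y => [? ?] /=; rewrite mul0r addr0. Qed.
Lemma ReI (y : C) : complex.Re ('i * y) = - complex.Im y.
Proof. by case: y => [? ?] /=; rewrite mul0r add0r mul1r. Qed.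
Lemma ImI (y : C) : complex.Im ('i * y) = complex.Re y.
Proof. by case: y => [? ?] /=; rewrite mul0r add0r mul1r. Qed.
Lemma ReR (x : R) : complex.Re x%:C = x. Proof. by []. Qed.
Lemma ImR (x : R) : complex.Im x%:C = 0. Proof. by []. Qed.
Definition RI := (ReD, ImD, ReN, ImN, ReZ, ImZ, ReI, ImI, ReR, ImR).

Lemma edge_ext m G H p v : (forall t : R, `|t| <= 1 -> G (p + t%:C * v) = H (p + t%:C * v)) ->
  edge m G p v = edge m H p v.
Proof. by move=> e; apply: avg_ext. Qed.

Lemma sqbound_edges c r (t : R) : 0 <= r -> `|t| <= 1 ->
  [/\ sqbound c r (c + r%:C + t%:C * ('i * r%:C)),
      sqbound c r (c - r%:C + t%:C * ('i * r%:C)),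
      sqbound c r (c + 'i * r%:C + t%:C * r%:C) &
      sqbound c r (c - 'i * r%:C + t%:C * r%:C)].
Proof.
move=> r0; rewrite ler_norml => /andP[t1 t2].
have tr : `|t * r| <= r by rewrite ler_norml; nra.
have H (x : C) : `|complex.Re x| <= r -> `|complex.Im x| <= r ->
    `|complex.Re x| = r \/ `|complex.Im x| = r -> sqbound c r (c + x).
  move=> h1 h2 h3; rewrite /sqbound /square (_ : c + x - c = x); last by ring.
  split=> //; case: h3 => <-; [exact: cn_Re|exact: cn_Im].
split; rewrite -addrA; apply: H; rewrite !RI ?(oppr0, addr0, add0r, mulr0) ?normrN ?(ger0_norm r0)//; by [left|right].
Qed.

Lemma bsum_ext m G H c r : 0 <= r -> (forall u, sqbound c r u -> G u = H u) ->
  bsum m G c r%:C = bsum m H c r%:C.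
Proof.
move=> r0 e; rewrite /bsum; congr (_ * (_ - _ + _ * (_ - _)));
  by apply: edge_ext => t t1; apply: e; have [] := sqbound_edges c r0 t1.
Qed.

Lemma bsumD m G H c (r : C) : bsum m (fun u => G u + H u) c r = bsum m G c r + bsum m H c r.
Proof. by rewrite /bsum /edge !avgD; ring. Qed.

Lemma bsumZ m a G c (r : C) : bsum m (fun u => a * G u) c r = a * bsum m G c r.
Proof. by rewrite /bsum /edge !avgZ; ring. Qed.

Lemma sqrCi : 'i * 'i = -1 :> C.
Proof. by rewrite -expr2 sqr_i. Qed.

Lemma bsum_aff m a (b : C) c (r : C) : bsum m (fun u => a + b * u) c r = 0.
Proof.
have E p v : edge m (fun u => a + b * u) p v = a + b * p.
  rewrite /edge -[RHS](@avg_aff R m (a + b * p) (b * v)).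
  by apply: avg_ext => t _; ring.
rewrite /bsum !E.
rewrite (_ : _ + _ = 2 * b * r * (1 + 'i * 'i)); last by ring.
by rewrite sqrCi addrN !mulr0.
Qed.

Lemma bsum_bound m G c r M : 0 <= r -> (forall u, sqbound c r u -> cn (G u) <= M) ->
  cn (bsum m G c r%:C) <= 4 * r * M.
Proof.
move=> r0 h; rewrite /bsum cnM cn_real ger0_norm//.
set a := edge _ _ _ _; set b := edge _ _ _ _.
set x := edge _ _ _ _; set y := edge _ _ _ _.
have Ha : cn a <= M by apply: avg_bound => t t1; apply: h; have [] := sqbound_edges c r0 t1.
have Hb : cn b <= M by apply: avg_bound => t t1; apply: h; have [] := sqbound_edges c r0 t1.
have Hx : cn x <= M by apply: avg_bound => t t1; apply: h; have [] := sqbound_edges c r0 t1.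
have Hy : cn y <= M by apply: avg_bound => t t1; apply: h; have [] := sqbound_edges c r0 t1.
rewrite (mulrC 4) -mulrA ler_wpM2l// (le_trans (cnD _ _))// cnM cn_i mul1r.
have := cnB a b; have := cnB x y; lra.
Qed.

Lemma nested_intervals (a b : nat -> R) :
  (forall k, a k <= a k.+1) -> (forall k, b k.+1 <= b k) -> (forall k, a k <= b k) ->
  exists w, forall k, a k <= w <= b k.
Proof.
move=> ha hb hab.
have ha' k l : (k <= l)%N -> a k <= a l.
  by move=> /subnK <-; elim: (l - k)%N => [//|d IH]; rewrite addSn (le_trans IH).
have hb' k l : (k <= l)%N -> b l <= b k.
  by move=> /subnK <-; elim: (l - k)%N => [//|d IH]; rewrite addSn (le_trans _ IH).
have hkl k l : a k <= b l.
  by case: (leqP k l) => [kl|/ltnW lk]; [exact: le_trans (ha' _ _ kl) _|exact: le_trans (hab _) (hb' _ _ lk)].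
have hs : has_sup (range a).
  by split; [exists (a 0%N), 0%N|exists (b 0%N) => _ [k _ <-]].
exists (sup (range a)) => k; apply/andP; split.
  by apply: (sup_upper_bound hs); exists k.
by apply: sup_le_ub; [exists (a 0%N), 0%N|move=> _ [l _ <-]].
Qed.

Lemma small_third r (d : R) : 0 < d -> exists k : nat, r / 3 ^+ k <= d.
Proof.
move=> d0; pose k := (Num.truncn (`|r| / d)).+1; exists k.
have h : `|r| / d < k%:R by exact: truncnS_gt.
rewrite ler_pdivrMr ?exprn_gt0//.
have hk : k%:R <= 3 ^+ k :> R.
  by rewrite -natrX ler_nat; exact: ltnW (ltn_expl _ _).
rewrite (le_trans (ler_norm r))// -ler_pdivrMl// mulrC.
exact: le_trans (ltW h) hk.
Qed.

Let cell c (r : C) (p q : C) := c + 2 / 3 * r * (p + 'i * q).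

Lemma cell_square (p q : R) c r u : `|p| <= 1 -> `|q| <= 1 ->
  square (cell c r%:C p%:C q%:C) (r / 3) u -> square c r u.
Proof.
move=> hp hq; rewrite /square /cell.
rewrite (_ : u - _ = (u - c) + (- (2 / 3 * r))%:C * (p%:C + 'i * q%:C)); last first.
  by rewrite rmorphN !rmorphM/= fmorphV !rmorph_nat; ring.
move: (u - c) => v; rewrite !RI.
rewrite !ler_norml in hp hq *.
have p1 : - r <= r -> p * r <= r /\ - r <= p * r by move=> ?; split; nra.
have q1 : - r <= r -> q * r <= r /\ - r <= q * r by move=> ?; split; nra.
move=> [/andP[h1 h2] /andP[h3 h4]].
have rr : - r <= r by lra.
have [p2 p3] := p1 rr; have [q2 q3] := q1 rr.
by split; apply/andP; split; lra.
Qed.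

Lemma le_sum9 (m1 m2 m3 m4 m5 m6 m7 m8 m9 m : nat) :
  (m1 + m2 + m3 + m4 + m5 + m6 + m7 + m8 + m9 < m.+1)%N ->
  [/\ [/\ m1 <= m, m2 <= m & m3 <= m], [/\ m4 <= m, m5 <= m & m6 <= m] &
     [/\ m7 <= m, m8 <= m & m9 <= m]]%N.
Proof. by move=> h; split; split; lia. Qed.

(** Goursat's argument: if the boundary sums of a square are not eventually
    small compared with its area, the same holds for one of its nine cells, and
    the nested cells obtained in this way contradict differentiability at their
    common point, as boundary sums of affine functions vanish. *)
Lemma goursat G c0 r0 : 0 < r0 ->
  (forall u, square c0 r0 u -> exists a, cdiff G u a) ->
  forall e : R, 0 < e -> exists m0, forall m, (m0 <= m)%N -> cn (bsum m G c0 r0%:C) <= e.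
Proof.
move=> r0_gt0 Gd e e0.
pose d := e / r0 ^+ 2.
have d0 : 0 < d by rewrite divr_gt0// exprn_gt0.
(* This bound is additive over the nine cells of a subdivision. *)
pose P c r := exists m0, forall m, (m0 <= m)%N -> cn (bsum m G c r%:C) <= d * r ^+ 2.
suff [m0 h] : P c0 r0.
  by exists m0 => m /h; rewrite /d divfK// expf_neq0// gt_eqF.
apply: contrapT => nP0.
have step (x : C * R) : exists c' : C, ~ P x.1 x.2 ->
    ~ P c' (x.2 / 3) /\ forall u, square c' (x.2 / 3) u -> square x.1 x.2 u.
  case: x => c r /=.
  have [Pc|nPc] := pselect (P c r); first by exists 0.
  apply: contrapT => nex; apply: nPc.
  have cellP (p q : R) : `|p| <= 1 -> `|q| <= 1 -> P (cell c r%:C p%:C q%:C) (r / 3).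
    move=> hp hq; apply: contrapT => nPpq; apply: nex.
    by exists (cell c r%:C p%:C q%:C) => _; split=> // u; apply: cell_square.
  have n1 : `|-1 : R| <= 1 by rewrite normrN normr1.
  have n2 : `|0 : R| <= 1 by rewrite normr0.
  have n3 : `|1 : R| <= 1 by rewrite normr1.
  have [m1 h1] := cellP _ _ n1 n1; have [m2 h2] := cellP _ _ n2 n1; have [m3 h3] := cellP _ _ n3 n1.
  have [m4 h4] := cellP _ _ n1 n2; have [m5 h5] := cellP _ _ n2 n2; have [m6 h6] := cellP _ _ n3 n2.
  have [m7 h7] := cellP _ _ n1 n3; have [m8 h8] := cellP _ _ n2 n3; have [m9 h9] := cellP _ _ n3 n3.
  exists (m1 + m2 + m3 + m4 + m5 + m6 + m7 + m8 + m9).+1 => -[//|m] hm.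
  rewrite bsumS /=.
  have r3 : r%:C / 3 = (r / 3)%:C by rewrite rmorphM/= fmorphV rmorph_nat.
  rewrite !r3.
  have [[l1 l2 l3] [l4 l5 l6] [l7 l8 l9]] := le_sum9 hm.
  move: (h1 m l1) (h2 m l2) (h3 m l3) (h4 m l4) (h5 m l5) (h6 m l6) (h7 m l7) (h8 m l8) (h9 m l9).
  rewrite /cell !rmorphN !rmorph0 !rmorph1.
  have -> : d * (r / 3) ^+ 2 = d * r ^+ 2 / 9 by field.
  move=> {}h1 {}h2 {}h3 {}h4 {}h5 {}h6 {}h7 {}h8 {}h9.
  apply: le_trans (cnD_le (cnD_le (cnD_le (cnD_le h1 h2) h3)
    (cnD_le (cnD_le h4 h5) h6)) (cnD_le (cnD_le h7 h8) h9)) _.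
  by rewrite le_eqVlt; apply/orP; left; apply/eqP; field.
have [next Hn] := choice step.
pose rr k := r0 / 3 ^+ k.
pose cc := fix F k := if k is k'.+1 then next (F k', rr k') else c0.
have rrS k : rr k.+1 = rr k / 3.
  by rewrite /rr exprSr invfM mulrA.
have rr0 k : 0 < rr k by rewrite divr_gt0// exprn_gt0.
have nP k : ~ P (cc k) (rr k).
  elim: k => [|k IH]; first by rewrite /rr expr0 divr1.
  by rewrite rrS; have [] := Hn (cc k, rr k) IH.
have sub k u : square (cc k.+1) (rr k.+1) u -> square (cc k) (rr k) u.
  by rewrite rrS; have [_] := Hn (cc k, rr k) (nP k); apply.
have corner c r (x y : R) : 0 <= r -> `|x| <= 1 -> `|y| <= 1 ->
    square c r (c + ((x * r)%:C + 'i * (y * r)%:C)).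
  move=> r0' hx hy; rewrite /square (_ : c + _ - c = (x * r)%:C + 'i * (y * r)%:C); last by ring.
  rewrite !RI oppr0 addr0 add0r !normrM (ger0_norm r0').
  by rewrite -[X in _ <= X]mul1r -[in X in _ /\ _ <= X](mul1r r) !ler_wpM2r.
have n1 : `|-1 : R| <= 1 by rewrite normrN normr1.
have n3 : `|1 : R| <= 1 by rewrite normr1.
have mono k : [/\ complex.Re (cc k) - rr k <= complex.Re (cc k.+1) - rr k.+1,
    complex.Re (cc k.+1) + rr k.+1 <= complex.Re (cc k) + rr k,
    complex.Im (cc k) - rr k <= complex.Im (cc k.+1) - rr k.+1 &
    complex.Im (cc k.+1) + rr k.+1 <= complex.Im (cc k) + rr k].
  have := sub k _ (corner (cc k.+1) (rr k.+1) _ _ (ltW (rr0 _)) n1 n1).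
  have := sub k _ (corner (cc k.+1) (rr k.+1) _ _ (ltW (rr0 _)) n3 n3).
  rewrite /square !RI !ler_norml => -[/andP[h1 h2] /andP[h3 h4]] [/andP[h5 h6] /andP[h7 h8]].
  by split; lra.
have [wx hwx] := @nested_intervals (fun k => complex.Re (cc k) - rr k) (fun k => complex.Re (cc k) + rr k)
  (fun k => let: And4 h _ _ _ := mono k in h) (fun k => let: And4 _ h _ _ := mono k in h)
  ltac:(by move=> k; have := rr0 k; lra).
have [wy hwy] := @nested_intervals (fun k => complex.Im (cc k) - rr k) (fun k => complex.Im (cc k) + rr k)
  (fun k => let: And4 _ _ h _ := mono k in h) (fun k => let: And4 _ _ _ h := mono k in h)
  ltac:(by move=> k; have := rr0 k; lra).
pose w : C := wx +i* wy.
have wsq k : square (cc k) (rr k) w.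
  have := hwx k; have := hwy k; rewrite /square !RI /= !ler_norml; lra.
have [a ha] : exists a, cdiff G w a.
  by apply: Gd; have := wsq 0%N; rewrite /rr expr0 divr1.
have [de [de0 hde]] := ha (d / 16) ltac:(lra).
have [k hk] := @small_third r0 (de / 4) ltac:(lra).
apply: (nP k); exists 0%N => m _.
(* G is affine up to rem, and rem is small on the whole k-th square. *)
pose rem u := G u - (G w - a * w + a * u).
rewrite (@bsum_ext _ _ (fun u => (G w - a * w + a * u) + rem u)); last first.
- by move=> u _; rewrite /rem; ring.
- exact: ltW.
rewrite bsumD bsum_aff add0r.
have -> : d * rr k ^+ 2 = 4 * rr k * (d / 16 * (4 * rr k)) by field.
apply: bsum_bound => [|u [hu _]]; first exact: ltW.
have uw : cn (u - w) <= 4 * rr k.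
  have := square_cn hu; have := square_cn (wsq k); have := cn_tri (cc k) u w.
  rewrite (cnC (cc k)); lra.
have : cn (G (w + (u - w)) - G w - a * (u - w)) <= d / 16 * cn (u - w).
  by apply: hde; rewrite (le_trans uw)//; move: hk; rewrite -/(rr k); lra.
rewrite (_ : w + (u - w) = u); last by ring.
rewrite (_ : G u - G w - a * (u - w) = rem u); last by rewrite /rem; ring.
move=> h; rewrite (le_trans h)// ler_wpM2l//; lra.
Qed.

End Goursat.

(** * Complex derivatives *)

Section ComplexDerivative.
Variable R : realType.
Local Notation C := R[i].

Lemma posC (e : C) : 0 < e -> exists r : R, 0 < r /\ e = r%:C.
Proof.
rewrite ltcE /= => /andP[/eqP e0 er]; exists (complex.Re e); split=> //.
by case: e e0 er => a b /= -> _.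
Qed.

Lemma nbhs_cn (c : C) (A : set C) :
  nbhs c A <-> exists r : R, 0 < r /\ forall w, cn (w - c) < r -> A w.
Proof.
split=> [/nbhs_ballP[e /= e0 eA]|[r [r0 rA]]].
  have [r [r0 er]] := posC e0; exists r; split=> // w wc; apply: eA.
  by rewrite -ball_normE /= normE er ltcR cnC.
apply/nbhs_ballP; exists r%:C => /=; first by rewrite ltcR.
by move=> w; rewrite -ball_normE /= normE ltcR cnC => /rA.
Qed.

Lemma cvg_cn (T : Type) (F : set_system T) {FF : Filter F} (f : T -> C) (l : C) :
  f @ F --> l <-> forall e : R, 0 < e -> \forall x \near F, cn (f x - l) <= e.
Proof.
split=> [/cvgrPdist_le h e e0|h].
  have := h e%:C; rewrite ltcR => /(_ e0); apply: filterS => x.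
  by rewrite normE lecR cnC.
apply/cvgrPdist_le => e /posC[r [r0 ->]].
by have := h r r0; apply: filterS => x; rewrite normE lecR cnC.
Qed.

Lemma cdiffP (G : C -> C) (u a : C) : cdiff G u a <-> is_derive u (1 : C) G a.
Proof.
have slope (w : C) : w != 0 -> w^-1 *: ((G \o shift u) (w *: (1 : C)) - G u) - a =
    (G (u + w) - G u - a * w) * w^-1.
  move=> w0; rewrite /= (_ : w *: (1 : C) = w); last exact: mulr1.
  rewrite (addrC w) (_ : w^-1 *: (G (u + w) - G u) = w^-1 * (G (u + w) - G u))//.
  by field.
have key : cdiff G u a <->
    (fun h : C => h^-1 *: ((G \o shift u) (h *: (1 : C)) - G u)) @ 0^' --> a.
  rewrite cvg_cn; split=> [h e e0|h e e0].
    have [d [d0 hd]] := h e e0.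
    apply/nbhs_cn; exists d; split=> // w; rewrite subr0 => wd w0.
    have := hd w (ltW wd); have nw0 : 0 < cn w by rewrite cn_gt0.
    rewrite -ler_pdivrMr// -cnV -cnM.
    by have -> := slope w w0.
  have /nbhs_cn[r [r0 hr]] := h e e0.
  exists (r / 2); split=> [|s sr]; first by lra.
  have [->|s0] := eqVneq s 0; first by rewrite addr0 subrr mulr0 subrr cn0 mulr0.
  have := hr s; rewrite subr0 => /(_ ltac:(lra) s0).
  by rewrite -ler_pdivrMr ?cn_gt0// -cnV -cnM slope.
split=> [/key h|[hd hv]].
  have h' : derivable G u 1 by apply/cvg_ex; exists a.
  by split=> //; apply: cvg_lim h => //; exact: norm_hausdorff.
by apply/key; rewrite -hv; exact: hd.
Qed.

Lemma cdiff_cst (k u : C) : cdiff (fun _ => k) u 0.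
Proof. by apply/cdiffP; exact: is_derive_cst. Qed.

Lemma cdiff_id (u : C) : cdiff id u 1.
Proof. by apply/cdiffP; exact: is_derive_id. Qed.

Lemma cdiffD (G H : C -> C) u a b : cdiff G u a -> cdiff H u b ->
  cdiff (fun w => G w + H w) u (a + b).
Proof. by move=> /cdiffP ha /cdiffP hb; apply/cdiffP; exact: is_deriveD. Qed.

Lemma cdiffM (G H : C -> C) u a b : cdiff G u a -> cdiff H u b ->
  cdiff (fun w => G w * H w) u (G u * b + H u * a).
Proof. by move=> /cdiffP ha /cdiffP hb; apply/cdiffP; exact: is_deriveM. Qed.

Lemma cdiffV (G : C -> C) u a : G u != 0 -> cdiff G u a ->
  cdiff (fun w => (G w)^-1) u (- (G u) ^- 2 * a).
Proof.
move=> h /cdiffP[h1 h2]; apply/cdiffP; split; first exact: derivableV.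
by rewrite deriveV// h2.
Qed.

Lemma cdiffX (G : C -> C) u a k : cdiff G u a -> exists b, cdiff (fun w => G w ^+ k) u b.
Proof.
move=> h; elim: k => [|k [b hb]]; first by exists 0; exact: cdiff_cst.
exists (G u * b + G u ^+ k * a).
have -> : (fun w => G w ^+ k.+1) = fun w => G w * G w ^+ k.
  by apply/funext => w; rewrite exprS.
exact: cdiffM.
Qed.

Lemma cdiff_pole (c u : C) k : u != c -> exists a, cdiff (fun w => ((w - c) ^+ k)^-1) u a.
Proof.
move=> uc; have nuc : (u - c) ^+ k != 0 by rewrite expf_neq0// subr_eq0.
have [a h] := cdiffX k (cdiffD (cdiff_id u) (cdiff_cst (- c) u)).
by exists (- ((u - c) ^+ k) ^- 2 * a); exact: (@cdiffV (fun w => (w - c) ^+ k)).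
Qed.

Lemma cdiff_near (G H : C -> C) u a (r : R) : 0 < r ->
  (forall w, cn (w - u) < r -> G w = H w) -> cdiff H u a -> cdiff G u a.
Proof.
move=> r0 e h eta eta0; have [d [d0 hd]] := h eta eta0.
exists (Num.min d (r / 2)); split=> [|s]; first by rewrite lt_min d0/=; lra.
rewrite le_min => /andP[sd sr]; rewrite !e ?subrr ?cn0//; first exact: hd.
by rewrite addrAC subrr add0r; lra.
Qed.

Lemma cdiff_continuous (G : C -> C) u a : cdiff G u a ->
  forall e : R, 0 < e -> exists d : R, 0 < d /\ forall w, cn (w - u) <= d -> cn (G w - G u) <= e.
Proof.
move=> h e e0; have [d [d0 hd]] := h 1 ltr01.
have ca0 := cn_ge0 a.
pose d' := Num.min d (e / (1 + cn a)).
exists d'; split=> [|w]; first by rewrite lt_min d0 divr_gt0//; lra.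
rewrite le_min => /andP[h1 h2].
have := hd _ h1; rewrite (_ : u + (w - u) = w); last by ring.
move=> h3; rewrite (_ : G w - G u = (G w - G u - a * (w - u)) + a * (w - u)); last by ring.
apply: le_trans (cnD _ _) _; rewrite cnM.
have : (1 + cn a) * cn (w - u) <= e by rewrite mulrC -ler_pdivlMr//; lra.
lra.
Qed.

End ComplexDerivative.

(** * Residues and the Cauchy estimate *)

Section Residue.
Variable R : realType.
Local Notation C := R[i].
Implicit Types (G H : C -> C) (c u s a L : C) (r : R).

(** The eight outer cells avoid the centre c, so Goursat's theorem applies to
    them; the boundary sum of the central cell remains. *)
Lemma bsum_shrink G c r : 0 < r ->
  (forall u, square c r u -> u != c -> exists a, cdiff G u a) ->
  forall e : R, 0 < e -> exists m0, forall m, (m0 <= m)%N ->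
   cn (bsum m.+1 G c r%:C - bsum m G c (r / 3)%:C) <= e.
Proof.
move=> r0 hG e e0.
have cellP (p q : R) : `|p| <= 1 -> `|q| <= 1 -> `|p| = 1 \/ `|q| = 1 ->
    exists m0, forall m, (m0 <= m)%N ->
    cn (bsum m G (c + 2 / 3 * r%:C * (p%:C + 'i * q%:C)) (r / 3)%:C) <= e / 8.
  move=> hp hq hpq; apply: goursat; [by lra| |by lra].
  move=> u hu; apply: hG; first exact: cell_square hu.
  apply/eqP => uc; move: hu; rewrite uc /square.
  rewrite (_ : c - _ = (- (2 / 3 * r))%:C * (p%:C + 'i * q%:C)); last first.
    by rewrite rmorphN !rmorphM/= fmorphV !rmorph_nat; ring.
  rewrite !RI oppr0 add0r addr0 !normrM normrN.
  have -> : `|2 / 3 * r| = 2 / 3 * r by rewrite ger0_norm//; lra.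
  by case: hpq => ->; lra.
have n1 : `|-1 : R| <= 1 by rewrite normrN normr1.
have n2 : `|0 : R| <= 1 by rewrite normr0.
have n3 : `|1 : R| <= 1 by rewrite normr1.
have o1 : `|-1 : R| = 1 by rewrite normrN normr1.
have o3 : `|1 : R| = 1 by rewrite normr1.
have [m1 h1] := cellP _ _ n1 n1 (or_introl o1).
have [m2 h2] := cellP _ _ n2 n1 (or_intror o1).
have [m3 h3] := cellP _ _ n3 n1 (or_intror o1).
have [m4 h4] := cellP _ _ n1 n2 (or_introl o1).
have [m6 h6] := cellP _ _ n3 n2 (or_introl o3).
have [m7 h7] := cellP _ _ n1 n3 (or_introl o1).
have [m8 h8] := cellP _ _ n2 n3 (or_intror o3).
have [m9 h9] := cellP _ _ n3 n3 (or_introl o3).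
exists (m1 + m2 + m3 + m4 + 0 + m6 + m7 + m8 + m9)%N => m hm.
have [[l1 l2 l3] [l4 l5 l6] [l7 l8 l9]] := le_sum9 (hm : (_ < m.+1)%N).
rewrite bsumS /=.
have r3 : r%:C / 3 = (r / 3)%:C by rewrite rmorphM/= fmorphV rmorph_nat.
rewrite !r3.
move: (h1 m l1) (h2 m l2) (h3 m l3) (h4 m l4) (h6 m l6) (h7 m l7) (h8 m l8) (h9 m l9).
rewrite !rmorphN !rmorph0 !rmorph1.
have -> : c + 2 / 3 * r%:C * (0 + 'i * 0) = c by rewrite mulr0 addr0 mulr0 addr0.
move: (bsum m G c _) => x5.
move: (bsum m G _ _) => x1; move: (bsum m G _ _) => x2; move: (bsum m G _ _) => x3.
move: (bsum m G _ _) => x4; move: (bsum m G _ _) => x6.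
move: (bsum m G _ _) => x7; move: (bsum m G _ _) => x8; move: (bsum m G _ _) => x9.
move=> {}h1 {}h2 {}h3 {}h4 {}h6 {}h7 {}h8 {}h9.
rewrite (_ : _ - x5 = (x1 + x2 + x3) + (x4 + x6) + (x7 + x8 + x9)); last by ring.
apply: le_trans (cnD_le (cnD_le (cnD_le (cnD_le h1 h2) h3)
  (cnD_le h4 h6)) (cnD_le (cnD_le h7 h8) h9)) _.
by rewrite le_eqVlt; apply/orP; left; apply/eqP; field.
Qed.

Lemma square_le c r r' u : r <= r' -> square c r u -> square c r' u.
Proof. by move=> rr [h1 h2]; split; lra. Qed.

Lemma bsum_shrinkn G c r k : 0 < r ->
  (forall u, square c r u -> u != c -> exists a, cdiff G u a) ->
  forall e : R, 0 < e -> exists m0, forall m, (m0 <= m)%N ->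
   cn (bsum (m + k) G c r%:C - bsum m G c (r / 3 ^+ k)%:C) <= e.
Proof.
move=> r0 hG; elim: k => [|k IH] e e0.
  by exists 0%N => m _; rewrite addn0 expr0 divr1 subrr cn0 ltW.
have [m1 h1] := IH (e / 2) ltac:(lra).
have e3 : 0 < r / 3 ^+ k by rewrite divr_gt0// exprn_gt0.
have rk : r / 3 ^+ k <= r.
  by rewrite ler_pdivrMr ?exprn_gt0// ler_peMr ?(ltW r0)// exprn_ege1// ler1n.
have [m2 h2] := @bsum_shrink G c _ e3 (fun u hu => hG u (square_le rk hu)) (e / 2) ltac:(lra).
exists (m1 + m2)%N => m hm; rewrite addnS -addSn.
have l1 : (m1 <= m.+1)%N by lia.
have l2 : (m2 <= m)%N by lia.
have {}h1 := h1 _ l1; have {}h2 := h2 _ l2.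
rewrite exprSr invfM mulrA.
apply: le_trans (cn_tri (bsum m.+1 G c (r / 3 ^+ k)%:C) _ _) _.
lra.
Qed.

(** The m-th midpoint sum for the number pi. *)
Definition kappa m : C := avg m (fun t : R => (4 / (1 + t ^+ 2))%:C).

Lemma kappa_ge m : 2 <= cn (kappa m).
Proof.
apply: le_trans (cn_Re _); apply: le_trans (ler_norm _).
apply: Re_avg => t; rewrite ler_norml => /andP[t1 t2] /=.
by rewrite ler_pdivlMr; nra.
Qed.

Lemma kappa_neq0 m : kappa m != 0.
Proof. by rewrite -cn_gt0; have := kappa_ge m; lra. Qed.

(** On the boundary of the square |u - c|^2 = r^2 (1 + t^2), so the four edges
    add up to the midpoint sum of 4 / (1 + t^2). *)
Lemma bsum_pole m c r : 0 < r -> bsum m (fun u => (u - c)^-1) c r%:C = kappa m.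
Proof.
have lin (f1 f2 f3 f4 : R -> C) :
    r%:C * (avg m f1 - avg m f2 + 'i * (avg m f3 - avg m f4)) =
    avg m (fun t => r%:C * ((f1 t + -1 * f2 t) + 'i * (f3 t + -1 * f4 t))).
  by rewrite avgZ avgD avgZ !avgD !avgZ; ring.
move=> r0; rewrite /bsum /edge lin.
apply: avg_ext => t _.
have rC : r%:C != 0 by rewrite -cn_gt0 cn_real normr_gt0 gt_eqF.
have n0 (x y : R) : x != 0 \/ y != 0 -> x%:C + 'i * y%:C != 0 :> C.
  move=> h; apply/eqP => e; have e1 : x = 0.
    by have := congr1 (@complex.Re R) e; rewrite !RI oppr0 addr0.
  have e2 : y = 0 by have := congr1 (@complex.Im R) e; rewrite !RI add0r.
  by move: h; rewrite e1 e2 eqxx; case.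
have i2 := sqrCi R.
have n1 : 1 + t%:C * 'i != 0 :> C.
  by rewrite mulrC -(rmorph1 (real_complex R)); apply: n0; left; exact: oner_neq0.
have n2 : -1 + t%:C * 'i != 0 :> C.
  by rewrite mulrC -(rmorph1 (real_complex R)) -rmorphN; apply: n0; left; rewrite oppr_eq0 oner_eq0.
have n3 : 'i + t%:C != 0 :> C.
  rewrite addrC (_ : t%:C + 'i = t%:C + 'i * 1%:C); last by rewrite rmorph1 mulr1.
  by apply: n0; right; exact: oner_neq0.
have n4 : - 'i + t%:C != 0 :> C.
  rewrite addrC (_ : t%:C - 'i = t%:C + 'i * (-1)%:C); last by rewrite rmorphN rmorph1 mulrN1.
  by apply: n0; right; rewrite oppr_eq0 oner_eq0.
have n5 : 1 + t%:C ^+ 2 != 0 :> C.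
  have -> : 1 + t%:C ^+ 2 = (1 + t%:C * 'i) * - (-1 + t%:C * 'i) :> C.
    by rewrite (_ : _ * - _ = 1 - t%:C ^+ 2 * ('i * 'i)); [rewrite i2; ring|ring].
  by rewrite mulf_neq0// oppr_eq0.
have ni : 'i != 0 :> C by rewrite -cn_gt0 cn_i.
rewrite rmorphM/= fmorphV rmorph_nat rmorphD rmorphXn/= rmorph1.
have E1 : (c + r%:C + t%:C * ('i * r%:C) - c)^-1 = r%:C^-1 * (1 - t%:C * 'i) / (1 + t%:C ^+ 2).
  have -> : 1 + t%:C ^+ 2 = (1 + t%:C * 'i) * (1 - t%:C * 'i) :> C.
    by rewrite (_ : _ * (1 - _) = 1 - t%:C ^+ 2 * ('i * 'i)); [rewrite i2; ring|ring].
  have n6 : 1 - t%:C * 'i != 0 :> C by rewrite -oppr_eq0 opprB addrC.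
  have -> : c + r%:C + t%:C * ('i * r%:C) - c = r%:C * (1 + t%:C * 'i) by ring.
  by field; rewrite rC n1 n6.
have E2 : (c - r%:C + t%:C * ('i * r%:C) - c)^-1 = - r%:C^-1 * (1 + t%:C * 'i) / (1 + t%:C ^+ 2).
  have -> : 1 + t%:C ^+ 2 = (1 + t%:C * 'i) * (1 - t%:C * 'i) :> C.
    by rewrite (_ : _ * (1 - _) = 1 - t%:C ^+ 2 * ('i * 'i)); [rewrite i2; ring|ring].
  have n6 : 1 - t%:C * 'i != 0 :> C by rewrite -oppr_eq0 opprB addrC.
  have -> : c - r%:C + t%:C * ('i * r%:C) - c = r%:C * (-1 + t%:C * 'i) by ring.
  have n7 : -1 + t%:C * 'i = - (1 - t%:C * 'i) :> C by ring.
  by rewrite n7; field; rewrite ?n1 ?n6 ?rC ?oppr_eq0 ?n6.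
have E3 : (c + 'i * r%:C + t%:C * r%:C - c)^-1 = r%:C^-1 * (t%:C - 'i) / (1 + t%:C ^+ 2).
  have -> : 1 + t%:C ^+ 2 = (t%:C + 'i) * (t%:C - 'i) :> C.
    by rewrite (_ : _ * (_ - _) = t%:C ^+ 2 - ('i * 'i)); [rewrite i2; ring|ring].
  have n6 : t%:C - 'i != 0 :> C by rewrite addrC.
  have n7 : t%:C + 'i != 0 :> C by rewrite addrC.
  have -> : c + 'i * r%:C + t%:C * r%:C - c = r%:C * (t%:C + 'i) by ring.
  by field; rewrite rC n6 n7.
have E4 : (c - 'i * r%:C + t%:C * r%:C - c)^-1 = r%:C^-1 * (t%:C + 'i) / (1 + t%:C ^+ 2).
  have -> : 1 + t%:C ^+ 2 = (t%:C + 'i) * (t%:C - 'i) :> C.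
    by rewrite (_ : _ * (_ - _) = t%:C ^+ 2 - ('i * 'i)); [rewrite i2; ring|ring].
  have n6 : t%:C - 'i != 0 :> C by rewrite addrC.
  have n7 : t%:C + 'i != 0 :> C by rewrite addrC.
  have -> : c - 'i * r%:C + t%:C * r%:C - c = r%:C * (t%:C - 'i) by ring.
  by field; rewrite rC n6 n7.
rewrite E1 E2 E3 E4.
transitivity ((2 - 2 * ('i * 'i)) / (1 + t%:C ^+ 2)); first by field; rewrite rC n5.
by rewrite i2; field.
Qed.

Lemma sqbound_neq c r u : 0 < r -> sqbound c r u -> u != c.
Proof. by move=> r0 [_ h]; rewrite -subr_eq0 -cn_gt0; lra. Qed.

(** Subtracting the pole L / (u - c) leaves a function H with (u - c) H -> 0, and
    boundary sums of such a function over a small square are small; passing to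
    a small concentric square does not change boundary sums in the limit. *)
Lemma residue G c r L : 0 < r ->
  (forall u, square c r u -> u != c -> exists a, cdiff G u a) ->
  (forall eta : R, 0 < eta -> exists d : R, 0 < d /\
     forall u, u != c -> cn (u - c) <= d -> cn ((u - c) * G u - L) <= eta) ->
  forall e : R, 0 < e -> exists m0, forall m, (m0 <= m)%N ->
   cn (bsum m G c r%:C - L * kappa m) <= e.
Proof.
move=> r0 hG hL e e0.
pose H u := G u - L * (u - c)^-1.
have hH u : square c r u -> u != c -> exists a, cdiff H u a.
  move=> hu uc; have [a ha] := hG u hu uc.
  have [b hb] := cdiff_pole 1 uc.
  have h3 := cdiffD ha (cdiffM (cdiff_cst (- L) u) hb).
  by eexists; apply: (cdiff_near ltr01 _ h3) => w _; rewrite /H mulNr.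
have [d [d0 hd]] := hL (e / 8) ltac:(lra).
have [k hk] := @small_third R r (d / 2) ltac:(lra).
have [m1 h1] := @bsum_shrinkn H c r k r0 hH (e / 2) ltac:(lra).
exists (m1 + k)%N => m hm.
have {}h1 := h1 (m - k)%N ltac:(lia).
have mk : (m - k + k)%N = m by lia.
rewrite mk in h1.
have rk0 : 0 < r / 3 ^+ k by rewrite divr_gt0// exprn_gt0.
have h2 : cn (bsum (m - k) H c (r / 3 ^+ k)%:C) <= 4 * (r / 3 ^+ k) * (e / 8 / (r / 3 ^+ k)).
  apply: bsum_bound => [|u hu]; first exact: ltW.
  have uc := sqbound_neq rk0 hu; have [hu1 hu2] := hu.
  have := hd u uc ltac:(have := square_cn hu1; lra).
  have nuc : u - c != 0 by rewrite subr_eq0.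
  have -> : (u - c) * G u - L = (u - c) * H u by rewrite /H; field.
  rewrite cnM mulrC -ler_pdivlMr ?cn_gt0// => /le_trans; apply.
  by rewrite ler_wpM2l ?lef_pV2 ?posrE ?cn_gt0//; lra.
have {}h2 : cn (bsum (m - k) H c (r / 3 ^+ k)%:C) <= e / 2.
  rewrite (le_trans h2)// le_eqVlt; apply/orP; left; apply/eqP.
  by field; apply/andP; split; rewrite ?expf_neq0// gt_eqF.
have -> : bsum m G c r%:C - L * kappa m = bsum m H c r%:C.
  rewrite -(bsum_pole m c r0) -mulNr -bsumZ -bsumD; apply: bsum_ext => [|u hu].
    exact: ltW.
  by rewrite /H mulNr.
have := cn_tri (bsum (m - k) H c (r / 3 ^+ k)%:C) (bsum m H c r%:C) 0.
rewrite !subr0; lra.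
Qed.

(** The right-hand side of Cauchy's formula for h c, discretised. *)
Definition mean m (h : C -> C) c r := (kappa m)^-1 * bsum m (fun u => h u / (u - c)) c r%:C.

(** The boundary sum is at most 4 r * (M / r), and kappa m is at least 2. *)
Lemma mean_bound m h c r M : 0 < r -> (forall u, sqbound c r u -> cn (h u) <= M) ->
  cn (mean m h c r) <= 2 * M.
Proof.
move=> r0 hM; rewrite /mean cnM cnV mulrC ler_pdivrMr; last by have := kappa_ge m; lra.
have hu u : sqbound c r u -> cn (h u / (u - c)) <= M / r.
  move=> [hu1 hu2]; have hMu := hM u (conj hu1 hu2).
  have cu0 := cn_ge0 (h u).
  rewrite cnM cnV ler_pM ?invr_ge0 ?cn_ge0//.
  by rewrite lef_pV2 ?posrE//; lra.
have := bsum_bound m (ltW r0) hu.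
have -> : 4 * r * (M / r) = 4 * M by field; rewrite gt_eqF.
have [M0|M0] := leP 0 M.
  move=> h1; have := kappa_ge m; nra.
have /hM : sqbound c r (c + r%:C).
  rewrite /sqbound /square (_ : c + r%:C - c = r%:C); last by ring.
  by rewrite !RI cn_real normr0 ger0_norm ?(ltW r0).
by have := cn_ge0 (h (c + r%:C)); lra.
Qed.

Lemma mean_cvg h c r : 0 < r -> (forall u, square c r u -> exists a, cdiff h u a) ->
  forall e : R, 0 < e -> exists m0, forall m, (m0 <= m)%N -> cn (mean m h c r - h c) <= e.
Proof.
move=> r0 hd e e0.
have cc : square c r c by rewrite /square subrr /= normr0; split; lra.
have [a ha] := hd c cc.
have h1 u : square c r u -> u != c -> exists a, cdiff (fun u => h u / (u - c)) u a.
  move=> hu uc; have [b hb] := hd u hu.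
  have [b2 hb2] := cdiff_pole 1 uc.
  by eexists; exact: cdiffM hb hb2.
have [|m0 hm] := @residue _ c r (h c) r0 h1 _ e e0.
  move=> eta eta0; have [d [d0 hdd]] := cdiff_continuous ha eta0.
  exists d; split=> // u uc ud.
  have nuc : u - c != 0 by rewrite subr_eq0.
  have -> : (u - c) * (h u / (u - c)) - h c = h u - h c by field.
  exact: hdd.
exists m0 => m /hm; rewrite /mean => hh.
have -> : (kappa m)^-1 * bsum m (fun u => h u / (u - c)) c r%:C - h c =
  (kappa m)^-1 * (bsum m (fun u => h u / (u - c)) c r%:C - h c * kappa m).
  by field; exact: kappa_neq0.
rewrite cnM cnV mulrC ler_pdivrMr; last by have := kappa_ge m; lra.
rewrite (le_trans hh)//; have := kappa_ge m; nra.
Qed.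

Lemma mean_value_bound h c r M : 0 < r -> (forall u, square c r u -> exists a, cdiff h u a) ->
  (forall u, sqbound c r u -> cn (h u) <= M) -> cn (h c) <= 2 * M.
Proof.
move=> r0 hd hM; apply/ler_addgt0Pr => e e0.
have [m0 /(_ m0 (leqnn _)) hm] := mean_cvg r0 hd e0.
have := mean_bound m0 r0 hM; have := cn_tri (mean m0 h c r) (h c) 0.
rewrite !subr0 (cnC (h c)); lra.
Qed.

(** The derivative of h at c is the residue at c of (h u - h c) / (u - c)^2. *)
Lemma cauchy_estimate h c r M a : 0 < r -> (forall u, square c r u -> exists a, cdiff h u a) ->
  (forall u, square c r u -> cn (h u) <= M) -> cdiff h c a -> cn a <= 4 * M / r.
Proof.
move=> r0 hd hM ha; apply/ler_addgt0Pr => e e0.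
have cc : square c r c by rewrite /square subrr /= normr0; split; lra.
pose G u := (h u - h c) / (u - c) ^+ 2.
have h1 u : square c r u -> u != c -> exists a, cdiff G u a.
  move=> hu uc; have [b hb] := hd u hu.
  have [b2 hb2] := cdiff_pole 2 uc.
  by eexists; exact: cdiffM (cdiffD hb (cdiff_cst (- h c) u)) hb2.
have [|m0 /(_ m0 (leqnn _)) hm] := @residue G c r a r0 h1 _ e e0.
  move=> eta eta0; have [d [d0 hdd]] := ha eta eta0.
  exists d; split=> // u uc ud.
  have nuc : u - c != 0 by rewrite subr_eq0.
  have -> : (u - c) * G u - a = (h (c + (u - c)) - h c - a * (u - c)) / (u - c).
    by rewrite (_ : c + (u - c) = u) ?/G; [field|ring].
  by rewrite cnM cnV ler_pdivrMr ?cn_gt0//; exact: hdd.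
have hb : cn (bsum m0 G c r%:C) <= 4 * r * (2 * M / r ^+ 2).
  apply: bsum_bound => [|u [hu1 hu2]]; first exact: ltW.
  rewrite /G cnM cnV cnX ler_pM ?invr_ge0 ?exprn_ge0 ?cn_ge0//.
    by rewrite (le_trans (cnB _ _))//; have := hM u hu1; have := hM c cc; lra.
  rewrite lef_pV2 ?posrE ?exprn_gt0//; last by lra.
  by rewrite ler_pXn2r// nnegrE; lra.
have E : 4 * r * (2 * M / r ^+ 2) = 2 * (4 * M / r) by field; rewrite gt_eqF.
rewrite E in hb.
have hk := kappa_ge m0.
have := cn_tri (bsum m0 G c r%:C) (a * kappa m0) 0.
rewrite !subr0 cnM (cnC (a * _)) => h2.
have ca := cn_ge0 a.
nra.
Qed.

End Residue.

(** * Differentials in several complex variables *)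

Section DifferentiableEps.
Variables (K : numFieldType) (V W : normedModType K).

Lemma differentiable_flat (g : V -> W) (z : V) :
  (forall e : K, 0 < e -> \forall h \near 0, `|g (h + z) - g z| <= e * `|h|) ->
  differentiable g z.
Proof.
move=> hg.
have key : g \o shift z = cst (g z) + (\0 : V -> W) +o_ 0 id.
  apply/eqaddoP => e e0; apply: filterS (hg e e0) => h.
  by rewrite [X in _ -> `|X| <= _](_ : _ = g (h + z) - (g z + 0)) ?addr0.
apply/diff_locallyP.
have -> : 'd g z = \0 :> (V -> W).
  by apply: diff_unique key => x; exact: cvg_cst.
by split=> // x; exact: cvg_cst.
Qed.

Lemma differentiable_eps (g : V -> W) (z : V) (e : K) : differentiable g z -> 0 < e ->
  \forall h \near 0, `|g (h + z) - (g z + 'd g z h)| <= e * `|h|.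
Proof. by move=> dg e0; have /eqaddoP/(_ e e0) := diff_locally dg. Qed.

End DifferentiableEps.

Section VectorNorm.
Variables (R : realType) (n : nat).
Local Notation C := R[i].
Local Notation Cn := 'rV[C]_n.
Implicit Types (h v w z : Cn) (a : Cn) (f g : Cn -> C).

(** The maximum norm of C^n as an element of R, like cn. *)
Definition nv h : R := complex.Re `|h|.

Lemma nvE h : `|h| = (nv h)%:C.
Proof.
have := normr_ge0 h; rewrite lecE /= /nv => /andP[/eqP].
by case: (`|h|) => a b /= ->.
Qed.

Lemma nv_ge0 h : 0 <= nv h.
Proof. by have := normr_ge0 h; rewrite nvE lecR. Qed.

Lemma cn_le_nv h j : cn (h 0 j) <= nv h.
Proof.
rewrite -lecR -normE -nvE [leRHS]mx_normE -[leLHS]nngE num_le.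
exact: (@le_bigmax _ _ _ _ (fun i : 'I_1 * 'I_n => `|h i.1 i.2|%:nng) (0, j)).
Qed.

Lemma nv_le h M : 0 <= M -> (forall j, cn (h 0 j) <= M) -> nv h <= M.
Proof.
move=> M0 hM; rewrite -lecR -nvE.
have [h0|/mx_norm_neq0[[i j] /= E]] := eqVneq (mx_norm h) 0.
  by rewrite (_ : `|h| = mx_norm h)// h0 lecR.
rewrite (_ : `|h| = mx_norm h)// E ord1 normE lecR; exact: hM.
Qed.

Lemma nv_lt h M : 0 < M -> (forall j, cn (h 0 j) < M) -> nv h < M.
Proof.
move=> M0 hM; rewrite -ltcR -nvE.
have [h0|/mx_norm_neq0[[i j] /= E]] := eqVneq (mx_norm h) 0.
  by rewrite (_ : `|h| = mx_norm h)// h0 ltcR.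
rewrite (_ : `|h| = mx_norm h)// E ord1 normE ltcR; exact: hM.
Qed.

Lemma nv0 : nv 0 = 0.
Proof. by rewrite /nv normr0. Qed.

Lemma nv_eq0 h : (nv h == 0) = (h == 0).
Proof.
apply/eqP/eqP => [h0|->]; last exact: nv0.
by apply/eqP; rewrite -normr_eq0 nvE h0.
Qed.

Lemma nvD h v : nv (h + v) <= nv h + nv v.
Proof. by rewrite -lecR rmorphD /= -!nvE ler_normD. Qed.
Lemma nvN h : nv (- h) = nv h.
Proof. by rewrite /nv normrN. Qed.
Lemma nvC h v : nv (h - v) = nv (v - h).
Proof. by rewrite -nvN opprB. Qed.
Lemma nv_tri v h w : nv (h - w) <= nv (h - v) + nv (v - w).
Proof. by rewrite -{1}(subrK v h) -addrA nvD. Qed.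
Lemma nvZ (k : C) h : nv (k *: h) = cn k * nv h.
Proof.
by apply: (@complexI R); rewrite rmorphM /= -!nvE -normE normrZ.
Qed.

Lemma nbhs_nv z (A : set Cn) :
  nbhs z A <-> exists r : R, 0 < r /\ forall w, nv (w - z) < r -> A w.
Proof.
split=> [/nbhs_ballP[e /= e0 eA]|[r [r0 rA]]].
  have [r [r0 er]] := posC e0; exists r; split=> // w wc; apply: eA.
  by rewrite -ball_normE /= nvE er ltcR nvC.
apply/nbhs_ballP; exists r%:C => /=; first by rewrite ltcR.
by move=> w; rewrite -ball_normE /= nvE ltcR nvC => /rA.
Qed.

Lemma open_nv (A : set Cn) :
  open A <-> forall z, A z -> exists r : R, 0 < r /\ forall w, nv (w - z) < r -> A w.
Proof.
rewrite openE; split=> h z Az; first by have /nbhs_nv := h z Az.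
by apply/nbhs_nv; exact: h.
Qed.

Definition dot a h : C := \sum_j a 0 j * h 0 j.

Lemma dotD a h v : dot a (h + v) = dot a h + dot a v.
Proof. by rewrite /dot -big_split; apply: eq_bigr => j _; rewrite mxE mulrDr. Qed.
Lemma dotZ a (k : C) h : dot a (k *: h) = k * dot a h.
Proof. by rewrite /dot mulr_sumr; apply: eq_bigr => j _; rewrite mxE mulrCA. Qed.
Lemma dotDl a v h : dot (a + v) h = dot a h + dot v h.
Proof. by rewrite /dot -big_split; apply: eq_bigr => j _; rewrite mxE mulrDl. Qed.
Lemma dotZl a (k : C) h : dot (k *: a) h = k * dot a h.
Proof. by rewrite /dot mulr_sumr; apply: eq_bigr => j _; rewrite mxE mulrA. Qed.
Lemma dotBl a v h : dot (a - v) h = dot a h - dot v h.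
Proof. by rewrite dotDl -scaleN1r dotZl mulN1r. Qed.
Lemma dot0 h : dot 0 h = 0.
Proof. by rewrite /dot big1// => j _; rewrite mxE mul0r. Qed.
Lemma dot_delta a j : dot a (delta_mx 0 j) = a 0 j.
Proof.
rewrite /dot (bigD1 j)//= mxE !eqxx mulr1 big1 ?addr0// => k kj.
by rewrite mxE (negbTE kj) andbF mulr0.
Qed.
Lemma cn_dot a h : cn (dot a h) <= (\sum_j cn (a 0 j)) * nv h.
Proof.
rewrite (le_trans (cn_sum _ _ _))// mulr_suml ler_sum// => j _.
by rewrite cnM ler_wpM2l ?cn_ge0// cn_le_nv.
Qed.

(** The differential of f at z is dot a, expressed with real epsilons. *)
Definition hdiff f z a := forall eta : R, 0 < eta -> exists delta : R, 0 < delta /\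
  forall h, nv h <= delta -> cn (f (z + h) - f z - dot a h) <= eta * nv h.

Lemma hdiff_differentiable f z a : hdiff f z a -> differentiable f z.
Proof.
pose L : Cn -> C := fun w => dot a w.
have dL : differentiable L z.
  have -> : L = \sum_(j < n) (fun w : Cn => a 0 j *: w 0 j).
    by apply/funext => w; rewrite fct_sumE.
  by apply: differentiable_sum => j; apply: differentiableZ; exact: differentiable_coord.
move=> hf; have -> : f = (f - L) + L by rewrite subrK.
suff dfL : differentiable (f - L) z by exact: differentiableD dfL dL.
apply: differentiable_flat => e /posC[r [r0 ->]].
have [d [d0 hd]] := hf r r0.
apply/nbhs_nv; exists d; split=> // w; rewrite subr0 => wd.
have := hd w (ltW wd); rewrite -lecR rmorphM /= -normE -nvE [w + z]addrC.
rewrite [(f - L) (z + w) - _](_ : _ = (f (z + w) - L (z + w)) - (f z - L z))//.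
suff -> : f (z + w) - L (z + w) - (f z - L z) = f (z + w) - f z - dot a w by [].
by rewrite /L dotD; ring.
Qed.

Lemma differentiable_hdiff f z : differentiable f z ->
  hdiff f z (\row_j 'd f z (delta_mx 0 j)).
Proof.
move=> df eta eta0.
have := @differentiable_eps _ _ _ f z eta%:C df.
rewrite ltcR => /(_ eta0) /nbhs_nv[r [r0 hr]].
exists (r / 2); split=> [|h hh]; first by lra.
have := hr h; rewrite subr0 => /(_ ltac:(lra)).
rewrite normE [leRHS](_ : _ = (eta * nv h)%:C); last by rewrite rmorphM /= -nvE.
rewrite lecR (addrC h) => hle.
rewrite (_ : dot _ h = 'd f z h); last first.
  rewrite {2}(row_sum_delta h) linear_sum /dot; apply: eq_bigr => j _.
  by rewrite mxE linearZ mulrC.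
by rewrite -addrA -opprD.
Qed.

Lemma hdiff_partial f z a j : hdiff f z a -> 'D_(delta_mx 0 j) f z = a 0 j.
Proof.
move=> hf; have df := hdiff_differentiable hf.
rewrite deriveE//; have hf' := differentiable_hdiff df.
have E : a 0 j - 'd f z (delta_mx 0 j) = 0; last by apply/esym/eqP; rewrite -subr_eq0 E.
apply/eqP; rewrite -cn_eq0 eq_le cn_ge0 andbT; apply/ler_addgt0Pr => e e0.
have [d1 [d10 h1]] := hf (e / 2) ltac:(lra).
have [d2 [d20 h2]] := hf' (e / 2) ltac:(lra).
pose t := Num.min d1 d2.
have t0 : 0 < t by rewrite lt_min d10 d20.
have nd : nv (delta_mx 0 j : Cn) <= 1.
  apply: nv_le => // k; rewrite mxE eqxx /=; case: (k == j); rewrite ?cn0 ?cn1//.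
have nt : nv (t%:C *: delta_mx 0 j : Cn) <= t.
  by rewrite nvZ cn_real gtr0_norm// ler_piMr// ltW.
have td : t <= d1 /\ t <= d2 by rewrite /t !ge_min !lexx orbT.
have {}h1 := h1 _ (le_trans nt td.1).
have {}h2 := h2 _ (le_trans nt td.2).
move: h1 h2; rewrite !dotZ !dot_delta mxE; set F := f _ - f z => h1 h2.
have : cn (t%:C * (a 0 j - 'd f z (delta_mx 0 j))) <= e * t.
  rewrite (_ : _ * _ = (F - t%:C * 'd f z (delta_mx 0 j)) - (F - t%:C * a 0 j)); last by ring.
  rewrite (le_trans (cnB _ _))//; nra.
by rewrite cnM cn_real gtr0_norm// mulrC ler_pM2r// add0r.
Qed.

Lemma hdiff_line f z a v (u : C) : hdiff f (z + u *: v) a ->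
  cdiff (fun s => f (z + s *: v)) u (dot a v).
Proof.
move=> hf eta eta0.
have nv1 : 0 < 1 + nv v by have := nv_ge0 v; lra.
have [d [d0 hd]] := hf (eta / (1 + nv v)) ltac:(by rewrite divr_gt0).
exists (d / (1 + nv v)); split=> [|s]; first by rewrite divr_gt0.
rewrite ler_pdivlMr// => sd.
have nsv : nv (s *: v) <= cn s * (1 + nv v).
  by rewrite nvZ ler_wpM2l ?cn_ge0//; lra.
have := hd _ (le_trans nsv sd); rewrite dotZ -(addrA z) -scalerDl (mulrC (dot a v)).
move=> /le_trans; apply.
rewrite mulrAC ler_pdivrMr// -mulrA ler_wpM2l//; exact: ltW.
Qed.

Lemma hdiff_continuous f z a : hdiff f z a ->
  forall e : R, 0 < e -> exists d : R, 0 < d /\ forall w, nv (w - z) <= d -> cn (f w - f z) <= e.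
Proof.
move=> h e e0; have [d [d0 hd]] := h 1 ltr01.
pose A := \sum_j cn (a 0 j).
have A0 : 0 <= A by rewrite sumr_ge0// => j _; exact: cn_ge0.
pose d' := Num.min d (e / (1 + A)).
exists d'; split=> [|w]; first by rewrite lt_min d0 divr_gt0//; lra.
rewrite le_min => /andP[h1 h2].
have := hd _ h1; rewrite (_ : z + (w - z) = w); last by rewrite addrC subrK.
move=> h3; rewrite (_ : f w - f z = (f w - f z - dot a (w - z)) + dot a (w - z)); last by ring.
apply: le_trans (cnD _ _) _; have h4 := cn_dot a (w - z); rewrite -/A in h4.
have : (1 + A) * nv (w - z) <= e by rewrite mulrC -ler_pdivlMr//; lra.
lra.
Qed.

Lemma holo_hdiff (U : set Cn) f z : holomorphic_on U f -> U z -> exists a, hdiff f z a.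
Proof. by move=> hf /hf h; eexists; exact: differentiable_hdiff. Qed.

Lemma hdiff_near f g z a (r : R) : 0 < r ->
  (forall w, nv (w - z) < r -> f w = g w) -> hdiff g z a -> hdiff f z a.
Proof.
move=> r0 e h eta eta0; have [d [d0 hd]] := h eta eta0.
exists (Num.min d (r / 2)); split=> [|s]; first by rewrite lt_min d0/=; lra.
rewrite le_min => /andP[sd sr]; rewrite !e ?subrr ?nv0//; first exact: hd.
by rewrite addrC addKr; lra.
Qed.

Lemma holo_near f g (U : set Cn) : open U -> (forall w, U w -> f w = g w) ->
  holomorphic_on U g -> holomorphic_on U f.
Proof.
move=> /open_nv oU e hg z Uz; have [r [r0 hr]] := oU z Uz.
have [a ha] := holo_hdiff hg Uz.
by apply: (@hdiff_differentiable _ _ a); apply: (hdiff_near r0 _ ha) => w /hr /e.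
Qed.

Lemma holoW (U V : set Cn) f : V `<=` U -> holomorphic_on U f -> holomorphic_on V f.
Proof. by move=> VU hf z /VU /hf. Qed.

Lemma holoD (U : set Cn) f g : holomorphic_on U f -> holomorphic_on U g ->
  holomorphic_on U (fun z => f z + g z).
Proof. by move=> hf hg z Uz; apply: differentiableD; [exact: hf|exact: hg]. Qed.
Lemma holoB (U : set Cn) f g : holomorphic_on U f -> holomorphic_on U g ->
  holomorphic_on U (fun z => f z - g z).
Proof. by move=> hf hg z Uz; apply: differentiableB; [exact: hf|exact: hg]. Qed.
Lemma holoM (U : set Cn) f g : holomorphic_on U f -> holomorphic_on U g ->
  holomorphic_on U (fun z => f z * g z).
Proof. by move=> hf hg z Uz; apply: differentiableM; [exact: hf|exact: hg]. Qed.
Lemma holo_cst (U : set Cn) (k : C) : holomorphic_on U (fun _ => k).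
Proof. by move=> z _; exact: differentiable_cst. Qed.
Lemma holo_coord (U : set Cn) j : holomorphic_on U (fun z => z 0 j).
Proof. by move=> z _; exact: differentiable_coord. Qed.
Lemma holo_sum (U : set Cn) (k : nat) (F : 'I_k -> Cn -> C) :
  (forall j, holomorphic_on U (F j)) -> holomorphic_on U (fun z => \sum_j F j z).
Proof.
move=> hF z Uz; have -> : (fun z => \sum_j F j z) = \sum_j F j.
  by apply/funext => w; rewrite fct_sumE.
by apply: differentiable_sum => j; exact: hF.
Qed.

Lemma nv_mulmx (A : 'M[C]_n) : exists K : R, 0 < K /\ forall h, nv (h *m A) <= K * nv h.
Proof.
pose K := \sum_i \sum_j cn (A i j); exists (1 + K).
have K0 : 0 <= K by do 2!(apply: sumr_ge0 => ? _); exact: cn_ge0.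
split=> [|h]; first by lra.
have hh := nv_ge0 h; apply: nv_le => [|j]; first by rewrite mulr_ge0//; lra.
rewrite mxE (le_trans (cn_sum _ _ _))//.
apply: (@le_trans _ _ (K * nv h)); last by rewrite ler_wpM2r//; lra.
rewrite /K mulr_suml ler_sum// => i _.
rewrite cnM mulrC ler_pM ?cn_ge0 ?cn_le_nv// (bigD1 j)//= lerDl sumr_ge0// => k _.
exact: cn_ge0.
Qed.

Lemma dot_mulmx a h (A : 'M[C]_n) : dot a (h *m A) = dot (a *m A^T) h.
Proof.
have dotE x y : dot x y = (x *m y^T) 0 0.
  by rewrite mxE; apply: eq_bigr => j _; rewrite mxE.
by rewrite !dotE trmx_mul mulmxA.
Qed.

Lemma holo_affine (U V : set Cn) f p (A : 'M[C]_n) :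
  (forall w, V w -> U (p + w *m A)) ->
  holomorphic_on U f -> holomorphic_on V (fun w => f (p + w *m A)).
Proof.
move=> hV hf w Vw; have [a ha] := holo_hdiff hf (hV w Vw).
apply: (@hdiff_differentiable _ _ (a *m A^T)) => eta eta0.
have [K [K0 hK]] := nv_mulmx A.
have [d [d0 hd]] := ha (eta / K) ltac:(by rewrite divr_gt0).
exists (d / K); split=> [|h]; first by rewrite divr_gt0.
rewrite ler_pdivlMr// mulrC => hh.
have := hd _ (le_trans (hK h) hh); rewrite dot_mulmx mulmxDl addrA => /le_trans; apply.
by rewrite mulrAC ler_pdivrMr// -mulrA ler_wpM2l ?(ltW eta0)// mulrC.
Qed.

End VectorNorm.

(** * Mean value inequalities *)

Section MeanValue.
Variable R : realType.
Local Notation C := R[i].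

Definition rdiff (g : R -> R) t b := forall eta : R, 0 < eta -> exists delta : R, 0 < delta /\
  forall s, `|s| <= delta -> `|g (t + s) - g t - b * s| <= eta * `|s|.

Lemma rdiffP (g : R -> R) t b : rdiff g t b <-> is_derive t 1 g b.
Proof.
have slope (w : R) : w != 0 -> w^-1 *: ((g \o shift t) (w *: (1 : R)) - g t) - b =
    (g (t + w) - g t - b * w) * w^-1.
  move=> w0; rewrite /= (_ : w *: (1 : R) = w); last exact: mulr1.
  rewrite (addrC w) (_ : w^-1 *: (g (t + w) - g t) = w^-1 * (g (t + w) - g t))//.
  by field.
have key : rdiff g t b <->
    (fun h : R => h^-1 *: ((g \o shift t) (h *: (1 : R)) - g t)) @ 0^' --> b.
  split=> [h|h e e0].
    apply/cvgrPdist_le => e e0; have [d [d0 hd]] := h e e0.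
    apply/nbhs_ballP; exists d => //= w; rewrite -ball_normE /= sub0r normrN => wd w0.
    have := hd w (ltW wd); have nw0 : 0 < `|w| by rewrite normr_gt0.
    by rewrite -ler_pdivrMr// -normfV -normrM distrC -slope.
  have /cvgrPdist_le/(_ e e0)/nbhs_ballP[r /= r0 hr] := h.
  exists (r / 2); split=> [|s sr]; first by lra.
  have [->|s0] := eqVneq s 0; first by rewrite addr0 subrr mulr0 subrr normr0 mulr0.
  have := hr s; rewrite -ball_normE /= sub0r normrN => /(_ ltac:(lra) s0).
  by rewrite distrC -ler_pdivrMr ?normr_gt0// -normfV -normrM -slope.
split=> [/key h|[hd hv]].
  have h' : derivable g t 1 by apply/cvg_ex; exists b.
  by split=> //; apply: cvg_lim h => //; exact: norm_hausdorff.
by apply/key; rewrite -hv; exact: hd.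
Qed.

Lemma rdiff_continuous (g : R -> R) t b : rdiff g t b -> {for t, continuous g}.
Proof.
move=> /rdiffP[hd _].
by apply: differentiable_continuous; apply/derivable1_diffP.
Qed.

Lemma rdiff_mvt (g : R -> R) (t : R) : 0 <= t ->
  (forall s, 0 <= s <= t -> exists b, rdiff g s b /\ b <= 0) -> g t <= g 0.
Proof.
rewrite le_eqVlt => /predU1P[<-//|t0 h].
have hd s : s \in `]0, t[ -> is_derive s 1 g ('D_1 g s).
  rewrite in_itv /= => /andP[s0 st].
  by have [b [/rdiffP hb _]] := h s ltac:(lra); split; [exact: ex_derive|].
have hc : {within `[0, t], continuous g}.
  apply: continuous_in_subspaceT => s; rewrite inE /= in_itv /= => hs.
  by have [b [hb _]] := h s hs; exact: rdiff_continuous hb.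
have [c] := MVT_segment (ltW t0) hd hc.
rewrite in_itv /= => hcc E.
have [b [/rdiffP hb b0]] := h c hcc.
have eb := @derive_val _ _ _ _ _ _ _ hb.
rewrite eb subr0 in E.
nra.
Qed.

Lemma rdiffD (g k : R -> R) t a b : rdiff g t a -> rdiff k t b ->
  rdiff (fun s => g s + k s) t (a + b).
Proof.
move=> hg hk e e0.
have [d1 [d10 h1]] := hg (e / 2) ltac:(lra).
have [d2 [d20 h2]] := hk (e / 2) ltac:(lra).
exists (Num.min d1 d2); split=> [|s]; first by rewrite lt_min d10.
rewrite le_min => /andP[/h1 {}h1 /h2 {}h2].
rewrite (_ : _ - _ - _ = (g (t + s) - g t - a * s) + (k (t + s) - k t - b * s)); last by ring.
by rewrite (le_trans (ler_normD _ _))//; lra.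
Qed.

Lemma rdiff_power (B : R) (N : nat) t :
  rdiff (fun s => B * s ^+ N.+1 / N.+1%:R) t (B * t ^+ N).
Proof.
have -> : (fun s => B * s ^+ N.+1 / N.+1%:R) = (B / N.+1%:R) \*: ((@id R) ^+ N.+1).
  by apply/funext => s; rewrite /= exprfctE mulrAC.
apply/rdiffP; have := is_deriveZ (B / N.+1%:R) (is_deriveX N.+1 (is_derive_id t 1)).
move=> h; apply: is_derive_eq h _.
rewrite /= /GRing.scale /=.
have n0 : N.+1%:R != 0 :> R by rewrite pnatr_eq0.
by rewrite mulr1 mulrA divfK.
Qed.

(** The real mean value theorem, applied to the real and to the imaginary part
    of F; this is the origin of the factor 2. *)
Lemma mvt_power (F : C -> C) (B : R) (N : nat) (t : R) : 0 <= t <= 1 -> 0 <= B ->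
  (forall s : R, 0 <= s <= 1 -> exists a, cdiff F s%:C a /\ cn a <= B * s ^+ N) ->
  cn (F t%:C - F 0) <= 2 * (B * t ^+ N.+1 / N.+1%:R).
Proof.
move=> /andP[t0 t1] B0 hF.
pose P s := B * s ^+ N.+1 / N.+1%:R.
have P0 : P 0 = 0 by rewrite /P expr0n /= mulr0 mul0r.
have gen (g : R -> R) : (forall s, 0 <= s <= 1 -> exists b, rdiff g s b /\ b <= B * s ^+ N) ->
    g t - g 0 <= P t.
  move=> hg; pose k s := g s + (- B) * s ^+ N.+1 / N.+1%:R.
  have : k t <= k 0.
    apply: rdiff_mvt => // s /andP[s0 st].
    have [b [hb hbB]] := hg s ltac:(lra).
    exists (b + (- B) * s ^+ N); split; last by lra.
    by apply: rdiffD => //; exact: rdiff_power.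
  have kE s : k s = g s - P s by rewrite /k /P !mulNr.
  by rewrite !kE P0; lra.
have part (e : R) (p : C -> R) : e = 1 \/ e = -1 -> (forall x y, p (x + y) = p x + p y) ->
    (forall x, p (- x) = - p x) -> (forall (x : R) y, p (x%:C * y) = x * p y) ->
    (forall x, `|p x| <= cn x) -> e * (p (F t%:C - F 0)) <= P t.
  move=> he pD pN pZ pc.
  have ne : `|e| = 1 by case: he => ->; rewrite ?normrN normr1.
  suff hh s : 0 <= s <= 1 -> exists b, rdiff (fun s : R => e * p (F s%:C)) s b /\ b <= B * s ^+ N.
    by have := gen _ hh; rewrite pD pN rmorph0; lra.
  move=> hs; have [a [ha haB]] := hF s hs.
  exists (e * p a); split; last first.
    rewrite (le_trans (ler_norm _))// normrM ne mul1r (le_trans (pc _))//.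
  move=> eta eta0; have [d [d0 hd]] := ha eta eta0.
  exists d; split=> // x xd; have := hd x%:C; rewrite cn_real => /(_ xd) hh.
  rewrite (_ : _ - _ - _ = e * p (F (s%:C + x%:C) - F s%:C - a * x%:C)); last first.
    by rewrite !pD !pN (mulrC a) pZ rmorphD /=; ring.
  by rewrite normrM ne mul1r (le_trans (pc _)).
have ReP := part 1 (@complex.Re R) (or_introl erefl) (@ReD R) (@ReN R) (@ReZ R) (@cn_Re R).
have ReN := part (-1) (@complex.Re R) (or_intror erefl) (@ReD R) (@ReN R) (@ReZ R) (@cn_Re R).
have ImP := part 1 (@complex.Im R) (or_introl erefl) (@ImD R) (@ImN R) (@ImZ R) (@cn_Im R).
have ImN := part (-1) (@complex.Im R) (or_intror erefl) (@ImD R) (@ImN R) (@ImZ R) (@cn_Im R).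
rewrite (le_trans (cn_le_ReIm _))// mulrDl mul1r -/(P t).
by apply: lerD; rewrite ler_norml; lra.
Qed.

Lemma mvt_bound (F : C -> C) (B : R) : 0 <= B ->
  (forall s : R, 0 <= s <= 1 -> exists a, cdiff F s%:C a /\ cn a <= B) ->
  cn (F 1 - F 0) <= 2 * B.
Proof.
move=> B0 hF; have := @mvt_power F B 0 1 ltac:(lra) B0.
rewrite rmorph1 expr1n divr1 mulr1; apply => s hs.
exact: hF.
Qed.

End MeanValue.

(** * Limits along an ultrafilter *)

Section UltraLimit.
Variables (R : realType) (T : Type) (F : set_system T).
Context {UF : UltraFilter F}.
Local Notation C := R[i].

(** Bounded families always have a limit along an ultrafilter. Taking such limits
    replaces the extraction of convergent subsequences. *)
Definition ulim (b : T -> C) (l : C) := forall e : R, 0 < e -> F [set t | cn (b t - l) <= e].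

Lemma ulim_realE (b : T -> R) (M : R) : (forall t, `|b t| <= M) ->
  exists l, forall e : R, 0 < e -> F [set t | `|b t - l| <= e].
Proof.
move=> hb; pose S := [set x : R | F [set t | x <= b t]].
have hS : has_sup S.
  split.
    exists (- M); apply: filterS filterT => t _.
    by have := hb t; rewrite ler_norml => /andP[].
  exists M => x Sx; have [t /= xt] := filter_ex Sx.
  by rewrite (le_trans xt)// (le_trans (ler_norm _)).
exists (sup S) => e e0.
have [x Sx xe] := sup_adherent e0 hS.
have nS : ~ S (sup S + e).
  by move=> h; have := sup_upper_bound hS h; rewrite gerDl; lra.
have [//|FC] := in_ultra_setVsetC [set t | sup S + e <= b t] UF.
apply: filterS (filterI Sx FC) => t [/= h1 /negP]; rewrite -ltNge => h2.
by rewrite ler_norml; lra.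
Qed.

Lemma ulim_exists (b : T -> C) (M : R) : (forall t, cn (b t) <= M) -> exists l, ulim b l.
Proof.
move=> hb.
have [l1 h1] := @ulim_realE (fun t => complex.Re (b t)) M (fun t => le_trans (cn_Re _) (hb t)).
have [l2 h2] := @ulim_realE (fun t => complex.Im (b t)) M (fun t => le_trans (cn_Im _) (hb t)).
exists (l1 +i* l2) => e e0; have e2 : 0 < e / 2 by lra.
apply: filterS (filterI (h1 _ e2) (h2 _ e2)) => t [/= h3 h4].
by apply: le_trans (cn_le_ReIm _) _; rewrite ReD ImD ReN ImN /=; lra.
Qed.

Lemma ulim_le (b : T -> C) l M : ulim b l -> F [set t | cn (b t) <= M] -> cn l <= M.
Proof.
move=> hl hb; apply/ler_addgt0Pr => e e0.
have [t [/= h1 h2]] := filter_ex (filterI (hl e e0) hb).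
have := cn_tri (b t) l 0; rewrite !subr0 cnC; lra.
Qed.

Lemma ulimD b c l k : ulim b l -> ulim c k -> ulim (fun t => b t + c t) (l + k).
Proof.
move=> hb hc e e0; have e2 : 0 < e / 2 by lra.
apply: filterS (filterI (hb _ e2) (hc _ e2)) => t [/= h1 h2].
rewrite opprD addrACA; have := cnD (b t - l) (c t - k); lra.
Qed.

Lemma ulimZ (a : C) b l : ulim b l -> ulim (fun t => a * b t) (a * l).
Proof.
move=> hb e e0; have a0 := cn_ge0 a.
have e2 : 0 < e / (1 + cn a) by rewrite divr_gt0//; lra.
apply: filterS (hb _ e2) => t /=; rewrite ler_pdivlMr; last by lra.
by rewrite -mulrBr cnM; have := cn_ge0 (b t - l); lra.
Qed.

Lemma ulim_cst (a : C) : ulim (fun _ => a) a.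
Proof. by move=> e e0; apply: filterS filterT => t _ /=; rewrite subrr cn0 ltW. Qed.

Lemma ulim_sum (I : Type) (r : seq I) (b : I -> T -> C) (l : I -> C) :
  (forall i, ulim (b i) (l i)) -> ulim (fun t => \sum_(i <- r) b i t) (\sum_(i <- r) l i).
Proof.
move=> h; elim: r => [|i r IH].
  rewrite big_nil; under [fun t => _]eq_fun do rewrite big_nil; exact: ulim_cst.
by rewrite big_cons; under [fun t => _]eq_fun do rewrite big_cons; exact: ulimD.
Qed.

Lemma ulim_unique b l k : ulim b l -> ulim b k -> l = k.
Proof.
move=> hl hk; apply/eqP; rewrite -subr_eq0 -cn_eq0 eq_le cn_ge0 andbT.
apply: (@ulim_le (fun t => (b t) + (-1) * b t)).
  by have := ulimD hl (ulimZ (-1) hk); rewrite mulN1r.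
by apply: filterS filterT => t _ /=; rewrite mulN1r subrr cn0.
Qed.

End UltraLimit.

(** * Polydiscs and Cauchy estimates *)

Section Estimates.
Variables (R : realType) (n : nat).
Local Notation C := R[i].
Local Notation Cn := 'rV[C]_n.
Implicit Types (h v w z : Cn) (a : Cn) (f g : Cn -> C) (r M : R).

Definition pd z r : set Cn := [set w | nv (w - z) < r].

Lemma convex_lt (x y c s : R) : 0 <= s -> s <= 1 -> x < c -> y < c -> (1 - s) * x + s * y < c.
Proof.
move=> s0 s1 xc yc; have [h|h] := leP s (1 / 2).
  have : 0 < (1 - s) * (c - x) by rewrite mulr_gt0; lra.
  have : 0 <= s * (c - y) by rewrite mulr_ge0; lra.
  lra.
have : 0 <= (1 - s) * (c - x) by rewrite mulr_ge0; lra.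
have : 0 < s * (c - y) by rewrite mulr_gt0; lra.
lra.
Qed.

Lemma pd_convex z r w w' (s : R) : 0 <= s <= 1 -> pd z r w -> pd z r w' ->
  pd z r (w' + s%:C *: (w - w')).
Proof.
move=> /andP[s0 s1]; rewrite /pd /= => hw hw'.
rewrite (_ : _ - z = (1 - s)%:C *: (w' - z) + s%:C *: (w - z)); last first.
  by apply/rowP => j; rewrite !mxE rmorphB rmorph1 /=; ring.
rewrite (le_lt_trans (nvD _ _))// !nvZ !cn_real !ger0_norm//; last by lra.
exact: convex_lt.
Qed.

Lemma pd_open z r : open (pd z r).
Proof.
apply/open_nv => w zw; exists (r - nv (w - z)); split; first by move: zw; rewrite /pd /=; lra.
by move=> x xw; rewrite /pd /=; have := nv_tri w x z; lra.
Qed.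

Lemma pd_center z r : 0 < r -> pd z r z.
Proof. by rewrite /pd /= subrr nv0. Qed.

Lemma pd_sub z w r s : nv (w - z) + s <= r -> pd w s `<=` pd z r.
Proof. by move=> h x; rewrite /pd /= => xw; have := nv_tri w x z; lra. Qed.

(** The one-variable Cauchy estimate for u |-> f (z + u v) on the square of half
    side r / (3 |v|), which this line maps into the polydisc. *)
Lemma line_derivative_bound f z a v r M : 0 < r -> holomorphic_on (pd z r) f ->
  (forall w, pd z r w -> cn (f w) <= M) -> hdiff f z a ->
  cn (dot a v) <= 12 * M / r * nv v.
Proof.
move=> r0 hf hM ha.
have M0 : 0 <= M by apply: le_trans (cn_ge0 _) (hM z (pd_center z r0)).
have [v0|v0] := leP (nv v) 0.
  have /eqP : nv v = 0 by apply/eqP; rewrite eq_le v0 nv_ge0.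
  rewrite nv_eq0 => /eqP ->; rewrite nv0 mulr0 -(scale0r 0) dotZ mul0r cn0//.
have h1 u : square 0 (r / (3 * nv v)) u -> pd z r (z + u *: v).
  move=> /square_cn; rewrite subr0 /pd /= addrAC subrr add0r nvZ => hu.
  rewrite (le_lt_trans (ler_wpM2r (ltW v0) hu))//.
  by rewrite (_ : _ * _ = 2 / 3 * r); [lra|field; rewrite gt_eqF].
have hd : cdiff (fun s => f (z + s *: v)) 0 (dot a v).
  by apply: hdiff_line; rewrite scale0r addr0.
have r3 : 0 < r / (3 * nv v) by rewrite divr_gt0// mulr_gt0.
have := @cauchy_estimate R (fun s => f (z + s *: v)) 0 _ M (dot a v) r3 _ _ hd.
rewrite (_ : 4 * M / (r / (3 * nv v)) = 12 * M / r * nv v); last first.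
  by field; rewrite !gt_eqF//.
apply=> u hu; last exact: hM (h1 u hu).
have [b hb] := holo_hdiff hf (h1 u hu).
by exists (dot b v); exact: hdiff_line.
Qed.

Lemma holo_lipschitz f z r M w w' : 0 < r -> holomorphic_on (pd z r) f ->
  (forall w, pd z r w -> cn (f w) <= M) -> pd z (r / 2) w -> pd z (r / 2) w' ->
  cn (f w - f w') <= 48 * M / r * nv (w - w').
Proof.
move=> r0 hf hM hw hw'.
have M0 : 0 <= M by apply: le_trans (cn_ge0 _) (hM z (pd_center z r0)).
pose F (s : C) := f (w' + s *: (w - w')).
have nn := nv_ge0 (w - w').
have B0 : 0 <= 12 * M / (r / 2) * nv (w - w') by rewrite !mulr_ge0// invr_ge0; lra.
have := @mvt_bound R F _ B0; rewrite /F scale1r scale0r addr0 (addrC w') subrK => hh.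
apply: (@le_trans _ _ (2 * (12 * M / (r / 2) * nv (w - w')))); last first.
  by rewrite le_eqVlt; apply/orP; left; apply/eqP; field; rewrite gt_eqF.
apply: hh => s /andP[s0 s1].
have hs : pd z (r / 2) (w' + s%:C *: (w - w')) by apply: pd_convex => //; lra.
have sub : pd (w' + s%:C *: (w - w')) (r / 2) `<=` pd z r.
  by apply: pd_sub; move: hs; rewrite /pd /=; lra.
have hr2 : 0 < r / 2 by lra.
have [a ha] := holo_hdiff hf (sub _ (pd_center _ hr2)).
exists (dot a (w - w')); split; first exact: hdiff_line.
apply: (line_derivative_bound _ hr2 (holoW sub hf) _ ha) => x /sub; exact: hM.
Qed.

(** The derivative of f at z + s h in the direction h differs from the one at z
    by the derivative at z of q w = f (w + s h) - f w, and q is of size |h| by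
    the Lipschitz bound. *)
Lemma holo_second_order f z r M a h : 0 < r -> holomorphic_on (pd z r) f ->
  (forall w, pd z r w -> cn (f w) <= M) -> hdiff f z a -> nv h < r / 4 ->
  cn (f (z + h) - f z - dot a h) <= 4608 * M / r ^+ 2 * nv h ^+ 2.
Proof.
move=> r0 hf hM ha hh.
have M0 : 0 <= M by apply: le_trans (cn_ge0 _) (hM z (pd_center z r0)).
have nn := nv_ge0 h.
pose F (s : C) := f (z + s *: h) + (- dot a h) * s.
pose B := 12 * (48 * M / r * nv h) / (r / 4) * nv h.
have B0 : 0 <= B by rewrite /B !mulr_ge0// invr_ge0; lra.
have := @mvt_bound R F B B0; rewrite /F scale1r scale0r addr0 mulr1 mulr0 addr0.
rewrite (_ : f (z + h) + _ - _ = f (z + h) - f z - dot a h); last by ring.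
rewrite (_ : 2 * B = 4608 * M / r ^+ 2 * nv h ^+ 2); last first.
  by rewrite /B; field; rewrite gt_eqF.
apply=> s /andP[s0 s1].
have nsh : nv (s%:C *: h) <= nv h by rewrite nvZ cn_real ger0_norm// ler_piMl.
have hs : pd z r (z + s%:C *: h) by rewrite /pd /= addrAC subrr add0r; lra.
have [b hb] := holo_hdiff hf hs.
exists (dot b h + ((- dot a h) * 1 + s%:C * 0)); split.
  by apply: cdiffD; [exact: hdiff_line|apply: cdiffM; [exact: cdiff_cst|exact: cdiff_id]].
have -> : dot b h + (- dot a h * 1 + s%:C * 0) = dot (b - a) h.
  by rewrite dotBl; ring.
pose q w := f (w + s%:C *: h) - f w.
have sub w : pd z (r / 4) w -> pd z (r / 2) w /\ pd z (r / 2) (w + s%:C *: h).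
  rewrite /pd /= => hw; split; first by lra.
  by rewrite addrAC (le_lt_trans (nvD _ _))//; lra.
have r4 : 0 < r / 4 by lra.
have hq : holomorphic_on (pd z (r / 4)) q.
  apply: holoB; last by apply: holoW hf => w /sub[]; rewrite /pd /=; lra.
  have := @holo_affine R n (pd z r) (pd z (r / 4)) f (s%:C *: h) 1%:M.
  have -> : (fun w => f (s%:C *: h + w *m 1%:M)) = fun w => f (w + s%:C *: h).
    by apply/funext => w; rewrite mulmx1 addrC.
  apply=> // w; rewrite mulmx1 addrC => /sub[_]; rewrite /pd /=; lra.
apply: (line_derivative_bound h r4 hq (M := 48 * M / r * nv h)) => [w /sub[h1 h2]|].
  apply: le_trans (holo_lipschitz r0 hf hM h2 h1) _.
  rewrite [w + _]addrC addrK.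
  by rewrite ler_wpM2l// !mulr_ge0// invr_ge0; lra.
move=> eta eta0.
have [d1 [d10 h1]] := hb (eta / 2) ltac:(lra).
have [d2 [d20 h2]] := ha (eta / 2) ltac:(lra).
exists (Num.min d1 d2); split=> [|k]; first by rewrite lt_min d10.
rewrite le_min => /andP[/h1 {}h1 /h2 {}h2].
have -> : q (z + k) - q z - dot (b - a) k =
  (f (z + s%:C *: h + k) - f (z + s%:C *: h) - dot b k) - (f (z + k) - f z - dot a k).
  by rewrite /q dotBl (addrAC z k); ring.
by rewrite (le_trans (cnB _ _))//; lra.
Qed.

(** Weierstrass's theorem for pointwise limits: the differentials of the f t at
    z are bounded, hence have a limit, and the second order remainder bound does
    not depend on t. *)
Lemma holo_ulim (T : Type) (F : set_system T) {UF : UltraFilter F} (f : T -> Cn -> C) g z r M :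
  0 < r -> (forall t, holomorphic_on (pd z r) (f t)) ->
  (forall t w, pd z r w -> cn (f t w) <= M) ->
  (forall w, pd z r w -> ulim F (fun t => f t w) (g w)) -> differentiable g z.
Proof.
move=> r0 hf hM hg.
have [a ha] := choice (fun t => holo_hdiff (hf t) (pd_center z r0)).
have nd j : nv (delta_mx 0 j : Cn) <= 1.
  apply: nv_le => // k; rewrite mxE eqxx /=; case: (k == j); rewrite ?cn0 ?cn1//.
have hex j : exists l, ulim F (fun t => a t 0 j) l.
  apply: (@ulim_exists _ _ _ _ _ (12 * M / r * 1)) => t; rewrite -dot_delta.
  have M0 : 0 <= M by apply: le_trans (cn_ge0 _) (hM t z (pd_center z r0)).
  rewrite (le_trans (line_derivative_bound _ r0 (hf t) (hM t) (ha t)))//.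
  by rewrite ler_wpM2l// !mulr_ge0// invr_ge0; lra.
have [l hl] := choice hex.
apply: (@hdiff_differentiable _ _ _ _ (\row_j l j)) => eta eta0.
pose A := 4608 * M / r ^+ 2.
have A0 : 0 <= A.
  have [t _] := filter_ex (@filterT _ F _).
  have M0 : 0 <= M by apply: le_trans (cn_ge0 _) (hM t z (pd_center z r0)).
  apply: divr_ge0; last by apply: exprn_ge0; exact: ltW.
  by apply: mulr_ge0; [exact: ler0n|exact: M0].
exists (Num.min (r / 5) (eta / (1 + A))); split=> [|h].
  by rewrite lt_min; apply/andP; split; [lra|rewrite divr_gt0//; lra].
rewrite le_min => /andP[h1 h2].
have hh : ulim F (fun t => (f t (z + h) + (-1) * f t z) + (-1) * dot (a t) h)
   ((g (z + h) + (-1) * g z) + (-1) * dot (\row_j l j) h).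
  apply: ulimD; last first.
    apply: ulimZ; apply: ulim_sum => j; rewrite mxE.
    rewrite mulrC; under [fun t => _]eq_fun do rewrite mulrC; exact: ulimZ.
  apply: ulimD; first by apply: hg; rewrite /pd /= addrAC subrr add0r; lra.
  by apply: ulimZ; apply: hg; exact: pd_center.
rewrite !mulN1r in hh; apply: (ulim_le hh).
apply: filterS filterT => t _ /=; rewrite !mulN1r.
have h3 : nv h < r / 4 by lra.
apply: le_trans (holo_second_order r0 (hf t) (hM t) (ha t) h3) _.
rewrite -/A expr2 mulrA ler_wpM2r ?nv_ge0//.
rewrite ler_pdivlMr in h2; last by lra.
by have := nv_ge0 h; nra.
Qed.

End Estimates.

(** * Compactness *)

Section Compactness.
Variables (R : realType) (n : nat).
Local Notation C := R[i].
Local Notation Cn := 'rV[C]_n.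
Implicit Types (h v w z : Cn) (a : Cn) (f g : Cn -> C) (r M : R).

Lemma disc_compact (c : C) r : compact [set u : C | cn (u - c) <= r].
Proof.
rewrite compact_ultra => F UF FD.
pose b (u : C) := if cn (u - c) <= r then u else c.
have [l hl] : exists l, ulim F b l.
  apply: (@ulim_exists _ _ _ _ _ (cn c + `|r|)) => u; rewrite /b.
  case: ifPn => h; last by have := normr_ge0 r; lra.
  by have := cn_tri c u 0; rewrite !subr0; have := ler_norm r; lra.
have lD : cn (l - c) <= r.
  apply: (@ulim_le _ _ F _ (fun u => b u + - c)).
    exact: ulimD hl (ulim_cst (- c)).
  by apply: filterS FD => u /= hu; rewrite /b hu.
exists l; split=> // A /nbhs_cn[e [e0 eA]].
have e2 : 0 < e / 2 by lra.
apply: filterS (filterI FD (hl _ e2)) => u [/= h1]; rewrite /b h1 => h2.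
by apply: eA; lra.
Qed.

Lemma cpd_compact z r : 0 <= r -> compact [set w | nv (w - z) <= r].
Proof.
move=> r0.
have := @rV_compact C n (fun i => [set u : C | cn (u - z 0 i) <= r]) (fun i => @disc_compact (z 0 i) r).
rewrite [X in compact X -> _](_ : _ = [set w | nv (w - z) <= r])//.
apply/seteqP; split=> w /= hw.
  by apply: nv_le => // j; rewrite !mxE; exact: hw.
by move=> j; apply: le_trans hw; have := cn_le_nv (w - z) j; rewrite !mxE.
Qed.

Lemma compact_bounded_fun (K : set Cn) f : compact K ->
  (forall z, K z -> exists d : R, 0 < d /\ forall w, nv (w - z) <= d -> cn (f w - f z) <= 1) ->
  exists M : R, forall z, K z -> cn (f z) <= M.
Proof.
move=> /compact_near_coveringP cK hf.
have := @cK R (pinfty_nbhs R) (fun M z => cn (f z) <= M) _.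
move=> /(_ _)[|M [Mr hM]]; last by exists (M + 1) => z Kz; apply: hM => //; lra.
move=> z Kz; have [d [d0 hd]] := hf z Kz.
exists ([set w | nv (w - z) <= d], [set M | cn (f z) + 1 < M]) => /=.
  split; first by apply/nbhs_nv; exists d; split=> // w /ltW.
  by exists (cn (f z) + 1); split=> //; exact: num_real.
move=> [w M] [/= /hd h1 h2]; have := cn_tri (f z) (f w) 0; rewrite !subr0; lra.
Qed.

Lemma holo_compact_bounded (K U : set Cn) f : compact K -> K `<=` U -> holomorphic_on U f ->
  exists M : R, 0 <= M /\ forall z, K z -> cn (f z) <= M.
Proof.
move=> cK KU hf; have [|M hM] := @compact_bounded_fun K f cK.
  move=> z /KU Uz; have [a ha] := holo_hdiff hf Uz.
  exact: hdiff_continuous ha _ ltr01.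
exists `|M|; split=> // z /hM h; exact: le_trans h (ler_norm _).
Qed.

Lemma compact_thick (K U : set Cn) : compact K -> open U -> K `<=` U ->
  exists s : R, 0 < s /\ forall z, K z -> pd z s `<=` U.
Proof.
move=> /compact_near_coveringP cK /open_nv oU KU.
have := @cK R (0%R^'+) (fun s z => pd z s `<=` U) _.
move=> /(_ _)[|s /= s0 hs].
  move=> z Kz; have [r [r0 hr]] := oU z (KU z Kz).
  exists ([set w | nv (w - z) <= r / 2], [set s : R | s < r / 2]) => /=.
    split; first by apply/nbhs_nv; exists (r / 2); split=> [|w /ltW//]; lra.
    by apply: nbhs_right_lt; lra.
  move=> [w s] [/= h1 h2] x; rewrite /pd /= => h3; apply: hr.
  by have := nv_tri w x z; lra.
exists (s / 2); split; first by rewrite divr_gt0.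
move=> z Kz; apply: hs => //=; last by rewrite divr_gt0.
by rewrite sub0r normrN ger0_norm; move: s0 => /= s0; lra.
Qed.

Lemma path_thick (gam : R -> Cn) (L : R) (U : set Cn) : open U ->
  (forall s t, nv (gam s - gam t) <= L * `|s - t|) ->
  (forall t, 0 <= t <= 1 -> U (gam t)) ->
  exists s : R, 0 < s /\ forall t, 0 <= t <= 1 -> pd (gam t) s `<=` U.
Proof.
move=> /open_nv oU hL hU.
have /compact_near_coveringP cK := @segment_compact R 0 1.
have := @cK R (0%R^'+) (fun s t => pd (gam t) s `<=` U) _.
move=> /(_ _)[|s /= s0 hs].
  move=> t; rewrite /= in_itv /= => ht; have [r [r0 hr]] := oU _ (hU t ht).
  have L1 : 0 < 1 + `|L| by have := normr_ge0 L; lra.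
  pose d := r / 2 / (1 + `|L|).
  have d0 : 0 < d by rewrite !divr_gt0.
  exists ([set t' | `|t' - t| < d], [set s : R | s < r / 2]) => /=.
    split; last by apply: nbhs_right_lt; lra.
    by apply/nbhs_ballP; exists d => //= x; rewrite -ball_normE /= distrC.
  move=> [t' s] [/= h1 h2] x; rewrite /pd /= => h3; apply: hr.
  have h4 := hL t' t; have := nv_tri (gam t') x (gam t).
  have : (1 + `|L|) * `|t' - t| <= r / 2 by rewrite mulrC -ler_pdivlMr// ltW.
  have : L * `|t' - t| <= `|L| * `|t' - t| by rewrite ler_wpM2r// ler_norm.
  by have := normr_ge0 (t' - t); lra.
exists (s / 2); split; first by rewrite divr_gt0.
move=> t ht; apply: hs => /=; last by rewrite in_itv.
  by rewrite sub0r normrN ger0_norm; move: s0 => /= s0; lra.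
by rewrite divr_gt0.
Qed.

End Compactness.

(** * The identity theorem and partial derivatives *)

Section Identity.
Variables (R : realType) (n : nat).
Local Notation C := R[i].
Local Notation Cn := 'rV[C]_n.
Implicit Types (h v w z : Cn) (a : Cn) (f g : Cn -> C) (r M : R).

Lemma geometric_small (q e : R) : 0 <= q -> q < 1 -> 0 < e -> exists N, forall k, (N <= k)%N -> q ^+ k <= e.
Proof.
move=> q0 q1 e0.
have := @cvg_expr R q; rewrite ger0_norm// => /(_ q1)/cvgrPdist_le/(_ e e0)[N _ hN].
exists N => k /hN /=; rewrite sub0r normrN ger0_norm// exprn_ge0//.
Qed.

(** Since phi vanishes near 0, phi / u^k is holomorphic for every k. The mean
    value bound on the square about s of half side r / 4, whose boundary stays at
    distance r / 8 from 0, gives |phi s| <= 2 M (8 |s| / r)^k. *)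
Lemma flat_zero (phi : C -> C) r M (d : R) (s : C) : 0 < r -> 0 < d ->
  (forall u, cn u < r -> exists a : C, cdiff phi u a) -> (forall u, cn u < r -> cn (phi u) <= M) ->
  (forall u, cn u < d -> phi u = 0) -> cn s < r / 8 -> phi s = 0.
Proof.
move=> r0 d0 hd hM h0 hs.
have [->|s0] := eqVneq s 0; first by apply: h0; rewrite cn0.
have cs0 : 0 < cn s by rewrite cn_gt0.
have M0 : 0 <= M by apply: le_trans (cn_ge0 (phi 0)) _; apply: hM; rewrite cn0.
pose q := cn s / (r / 8).
have r8 : 0 < r / 8 by lra.
have q1 : q < 1 by rewrite ltr_pdivrMr// mul1r.
have q0 : 0 <= q by rewrite divr_ge0// ltW.
have key k : cn (phi s) <= 2 * M * q ^+ k.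
  pose G u := phi u * ((u - 0) ^+ k)^-1.
  have sq u : square s (r / 4) u -> cn u < r.
    by move=> /square_cn h; have := cn_tri s u 0; rewrite !subr0; lra.
  have r4 : 0 < r / 4 by lra.
  have Gd u : square s (r / 4) u -> exists a : C, cdiff G u a.
    move=> /sq ur; have [b hb] := hd u ur.
    have [->|u0] := eqVneq u 0.
      exists 0; apply: (cdiff_near d0 _ (cdiff_cst 0 0)) => w; rewrite subr0 => /h0.
      by rewrite /G => ->; rewrite mul0r.
    have [c hc] := cdiff_pole k u0.
    by eexists; exact: cdiffM hb hc.
  have Gb u : sqbound s (r / 4) u -> cn (G u) <= M / (r / 8) ^+ k.
    move=> [hu1 hu2]; rewrite /G subr0 cnM cnV cnX.
    have ru : r / 8 <= cn u.
      by have := cn_tri s u 0; rewrite !subr0; have := cn_tri u s 0; have := cnD u (- s); rewrite cnN; lra.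
    rewrite ler_pM ?invr_ge0 ?exprn_ge0 ?cn_ge0//; first by apply: hM; exact: sq.
    rewrite lef_pV2 ?posrE ?exprn_gt0//; last by lra.
    by rewrite lerXn2r// nnegrE; lra.
  have := mean_value_bound r4 Gd Gb.
  rewrite /G subr0 cnM cnV cnX ler_pdivrMr ?exprn_gt0//.
  have -> : q ^+ k = cn s ^+ k / (r / 8) ^+ k by rewrite /q expr_div_n.
  move=> h; apply: le_trans h _; move: ((r / 8) ^+ k) (cn s ^+ k) => X Y.
  by rewrite le_eqVlt; apply/orP; left; apply/eqP; ring.
apply/eqP; rewrite -cn_eq0 eq_le cn_ge0 andbT; apply/ler_addgt0Pr => e e0.
have e1 : 0 < e / (2 * M + 1) by rewrite divr_gt0//; lra.
have [k hk] := geometric_small q0 q1 e1.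
apply: le_trans (key k) _; rewrite add0r.
have := hk k (leqnn _); rewrite ler_pdivlMr; last by lra.
by have := exprn_ge0 k q0; lra.
Qed.

Lemma identity_local f z r M (d : R) : 0 < r -> 0 < d -> holomorphic_on (pd z r) f ->
  (forall w, pd z r w -> cn (f w) <= M) -> (forall w, pd z d w -> f w = 0) ->
  forall w, pd z (r / 8) w -> f w = 0.
Proof.
move=> r0 d0 hf hM h0 w; rewrite /pd /= => hw.
have [v0|v0] := leP (nv (w - z)) 0.
  by apply: h0; rewrite /pd /=; apply: le_lt_trans d0.
pose phi (u : C) := f (z + u *: (w - z)).
have -> : f w = phi 1 by rewrite /phi scale1r (addrC z) subrK.
apply: (@flat_zero phi (r / nv (w - z)) M (d / nv (w - z)) 1).
- by rewrite divr_gt0.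
- by rewrite divr_gt0.
- move=> u; rewrite ltr_pdivlMr// -nvZ => hu.
  have [a ha] : exists a, hdiff f (z + u *: (w - z)) a.
    by apply: holo_hdiff hf _; rewrite /pd /= addrAC subrr add0r.
  by exists (dot a (w - z)); exact: hdiff_line.
- move=> u; rewrite ltr_pdivlMr// -nvZ => hu.
  by apply: hM; rewrite /pd /= addrAC subrr add0r.
- move=> u; rewrite ltr_pdivlMr// -nvZ => hu.
  by apply: h0; rewrite /pd /= addrAC subrr add0r.
- by rewrite cn1 ltr_pdivlMr// ltr_pdivlMr//; lra.
Qed.

(** The radius r / 8 in identity_local does not depend on d, so vanishing
    propagates along the segment in steps of a fixed length. *)
Lemma identity_segment (U : set Cn) f z w : open U -> holomorphic_on U f ->
  (forall t : R, 0 <= t <= 1 -> U (z + t%:C *: (w - z))) ->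
  (exists d : R, 0 < d /\ forall x, pd z d x -> f x = 0) ->
  exists d : R, 0 < d /\ forall x, pd w d x -> f x = 0.
Proof.
move=> oU hf hU hz.
pose gam (t : R) := z + t%:C *: (w - z).
have hL s t : nv (gam s - gam t) <= nv (w - z) * `|s - t|.
  rewrite /gam opprD addrACA subrr add0r -scalerBl nvZ -rmorphB cn_real mulrC//.
have [r [r0 hr]] := path_thick oU hL hU.
pose Z t := exists d : R, 0 < d /\ forall x, pd (gam t) d x -> f x = 0.
have step t : 0 <= t <= 1 -> Z t -> forall x, pd (gam t) (r / 2 / 8) x -> f x = 0.
  move=> ht [d [d0 hd]].
  have r2 : 0 < r / 2 by lra.
  have r2' : 0 <= r / 2 by lra.
  have sub : [set x | nv (x - gam t) <= r / 2] `<=` U.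
    by move=> x hx; apply: (hr t ht); rewrite /pd /=; move: hx => /=; lra.
  have [M [M0 hM]] := holo_compact_bounded (@cpd_compact R n (gam t) _ r2') sub hf.
  apply: (identity_local r2 d0 _ _ hd (M := M)) => x; rewrite /pd /= => hx.
    by apply: hf; apply: sub; exact: ltW.
  by apply: hM => /=; exact: ltW.
pose N := (Num.truncn (nv (w - z) / (r / 16))).+1.
have hN : nv (w - z) / (r / 16) < N%:R by exact: truncnS_gt.
have N0 : 0 < N%:R :> R by rewrite ltr0n.
have aux (A B : R) : A < r / 16 - B -> A + B < r / 2 / 8 by lra.
have all i : (i <= N)%N -> Z (i%:R / N%:R).
  elim: i => [|i IH] iN.
    by rewrite mul0r /Z /gam rmorph0 scale0r addr0.
  have ht : 0 <= (i%:R / N%:R : R) <= 1.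
    by rewrite divr_ge0//= ler_pdivrMr// mul1r ler_nat ltnW.
  have hz' := step _ ht (IH (ltnW iN)).
  have hdist : nv (gam (i.+1%:R / N%:R) - gam (i%:R / N%:R)) < r / 16.
    apply: le_lt_trans (hL _ _) _.
    rewrite -mulrBl -natrB ?leqnSn// subSnn mul1r ger0_norm ?invr_ge0 ?ltW//.
    by rewrite ltr_pdivrMr// mulrC -ltr_pdivrMr//; lra.
  exists (r / 16 - nv (gam (i.+1%:R / N%:R) - gam (i%:R / N%:R))); split; first by lra.
  move=> x hx; apply: hz'; move: hx; rewrite /pd /= => hx.
  apply: le_lt_trans (nv_tri (gam (i.+1%:R / N%:R)) _ _) _.
  exact: aux hx.
have := all N (leqnn _); rewrite divff ?gt_eqF// /Z /gam rmorph1 scale1r (addrC z) subrK//.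
Qed.

Definition pdj (j : 'I_n) f : Cn -> C := fun z => 'D_(delta_mx 0 j) f z.

Lemma ultra_nat : exists F : set_system nat, UltraFilter F /\ \oo `<=` F.
Proof. exact: ultraFilterLemma. Qed.

Lemma ulim_seq (F : set_system nat) {UF : UltraFilter F} (b : nat -> C) l : \oo `<=` F ->
  (forall e : R, 0 < e -> exists N, forall k, (N <= k)%N -> cn (b k - l) <= e) -> ulim F b l.
Proof.
move=> hF hb e e0; have [N hN] := hb e e0; apply: hF; exists N => //.
Qed.

Lemma nv_delta (j : 'I_n) : nv (delta_mx 0 j : Cn) <= 1.
Proof.
by apply: nv_le => // k; rewrite mxE eqxx /=; case: (k == j); rewrite ?cn0 ?cn1.
Qed.

Lemma inv_nat_small (e : R) : 0 < e -> exists N, forall k, (N <= k)%N -> k.+1%:R^-1 <= e.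
Proof.
move=> e0; exists (Num.truncn e^-1) => k hk.
rewrite invf_ple ?posrE// (le_trans (ltW (truncnS_gt _)))// ler_nat ltnS//.
Qed.

(** The partial derivative is a pointwise limit of difference quotients, which
    are bounded near z by the Lipschitz constant of f. *)
Lemma holo_partial (U : set Cn) f j : open U -> holomorphic_on U f -> holomorphic_on U (pdj j f).
Proof.
move=> oU hf z Uz.
have [d [d0 hd]] := (open_nv U).1 oU z Uz.
have [a ha] := holo_hdiff hf Uz.
have [d' [d'0 hd']] := hdiff_continuous ha ltr01.
pose r := Num.min d d'.
have r0 : 0 < r by rewrite lt_min d0.
have hfr : holomorphic_on (pd z r) f.
  by apply: holoW hf => w; rewrite /pd /= lt_min => /andP[/hd].
have hM w : pd z r w -> cn (f w) <= cn (f z) + 1.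
  rewrite /pd /= lt_min => /andP[_ /ltW/hd']; have := cn_tri (f z) (f w) 0; rewrite !subr0; lra.
set M := cn (f z) + 1 in hM.
have M0 : 0 <= M by rewrite addr_ge0// cn_ge0.
have [F [UF hF]] := ultra_nat.
pose t k : R := r / 4 / k.+1%:R.
have t0 k : 0 < t k by rewrite !divr_gt0.
have tr k : t k <= r / 4.
  by rewrite ler_pdivrMr// ler_peMr//; [lra|rewrite ler1n].
have r4 : 0 < r / 4 by lra.
pose fk k w := ((t k)^-1)%:C * (f (w + (t k)%:C *: delta_mx 0 j) - f w).
have ntk k : nv ((t k)%:C *: delta_mx 0 j : Cn) <= t k.
  by rewrite nvZ cn_real gtr0_norm// ler_piMr ?nv_delta// ltW.
have shift k w : pd z (r / 4) w -> pd z (r / 2) (w + (t k)%:C *: delta_mx 0 j).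
  rewrite /pd /= addrAC => hw; have := nvD (w - z) ((t k)%:C *: delta_mx 0 j).
  by have := ntk k; have := tr k; lra.
apply: (@holo_ulim R n _ F UF fk (pdj j f) z (r / 4) (48 * M / r)).
- exact: r4.
- move=> k; apply: holoM; first exact: holo_cst.
  apply: holoB; last by apply: holoW hfr; apply: pd_sub; rewrite subrr nv0; lra.
  have := @holo_affine R n (pd z r) (pd z (r / 4)) f ((t k)%:C *: delta_mx 0 j) 1%:M.
  have -> : (fun w => f ((t k)%:C *: delta_mx 0 j + w *m 1%:M)) =
      fun w => f (w + (t k)%:C *: delta_mx 0 j).
    by apply/funext => w; rewrite mulmx1 addrC.
  apply=> // w; rewrite mulmx1 addrC => /(shift k); rewrite /pd /=; lra.
- move=> k w hw.
  have hw2 : pd z (r / 2) w by move: hw; rewrite /pd /=; lra.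
  have := holo_lipschitz r0 hfr hM (shift k w hw) hw2.
  rewrite {2}[w + _]addrC addrK => hh.
  rewrite /fk cnM cn_real gtr0_norm ?invr_gt0// mulrC ler_pdivrMr//.
  apply: le_trans hh _; rewrite ler_wpM2l//.
  by rewrite !mulr_ge0// invr_ge0 ltW.
- move=> w hw.
  have Uw : pd z r w by move: hw; rewrite /pd /=; lra.
  have [b hb] := holo_hdiff hfr Uw.
  rewrite /pdj (hdiff_partial j hb).
  apply: ulim_seq => // e e0; have [de [de0 hde]] := hb e e0.
  have [N hN] := inv_nat_small (divr_gt0 de0 r4).
  exists N => k /hN; rewrite ler_pdivlMr// mulrC -/(t k) => tde.
  have := hde _ (le_trans (ntk k) tde); rewrite dotZ dot_delta => hh.
  have {}hh := le_trans hh (ler_wpM2l (ltW e0) (ntk k)).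
  have tk : (t k)%:C != 0 by rewrite -cn_eq0 cn_real normr_eq0 gt_eqF.
  have -> : fk k w - b 0 j = ((t k)^-1)%:C * (f (w + (t k)%:C *: delta_mx 0 j) - f w - (t k)%:C * b 0 j).
    by rewrite /fk fmorphV; field.
  by rewrite cnM cn_real gtr0_norm ?invr_gt0// mulrC ler_pdivrMr.
Qed.

End Identity.

(** * Taylor polynomials *)

Section Taylor.
Variables (R : realType) (n : nat).
Local Notation C := R[i].
Local Notation Cn := 'rV[C]_n.
Implicit Types (h v w z : Cn) (a : Cn) (f g : Cn -> C) (r M s : R) (U : set Cn).

(** The k-th derivative at 0 of t |-> f (z + t v), as a form of degree k in v with
    the partial derivatives of f at z as coefficients. It is thus holomorphic in
    v as well as in z. *)
Fixpoint tay k f v z : C :=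
  if k is k'.+1 then \sum_j v 0 j * tay k' (pdj j f) v z else f z.

Lemma tay_holo U k f v : open U -> holomorphic_on U f -> holomorphic_on U (tay k f v).
Proof.
move=> oU; elim: k f => [//|k IH] f hf /=.
apply: holo_sum => j; apply: holoM; first exact: holo_cst.
by apply: IH; exact: holo_partial.
Qed.

Lemma tay_holo_dir U k f z : holomorphic_on U (fun v => tay k f v z).
Proof.
elim: k f => [|k IH] f /=; first exact: holo_cst.
by apply: holo_sum => j; apply: holoM; [exact: holo_coord|exact: IH].
Qed.

Lemma frac_le (c E N : R) : 0 <= c -> 0 <= E -> 0 <= N -> c * (E / (1 + c) * N) <= E * N.
Proof.
move=> c0 E0 N0; have c1 : 0 < 1 + c by lra.
have -> : c * (E / (1 + c) * N) = E * N * (c / (1 + c)) by field; rewrite gt_eqF.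
by rewrite ler_piMr ?mulr_ge0// ler_pdivrMr//; lra.
Qed.

Lemma hdiff_sum (I : Type) (s : seq I) (F : I -> Cn -> C) (c : I -> C) (A : I -> Cn) z :
  (forall i, hdiff (F i) z (A i)) ->
  hdiff (fun w => \sum_(i <- s) c i * F i w) z (\sum_(i <- s) c i *: A i).
Proof.
move=> hF; elim: s => [|i s IH] eta eta0.
  exists 1; split=> // h _; rewrite !big_nil dot0 !subr0 cn0 mulr_ge0 ?nv_ge0 ?ltW//.
have c0 := cn_ge0 (c i).
have [d1 [d10 h1]] := hF i (eta / 2 / (1 + cn (c i))) ltac:(by rewrite !divr_gt0//; lra).
have [d2 [d20 h2]] := IH (eta / 2) ltac:(lra).
exists (Num.min d1 d2); split=> [|h]; first by rewrite lt_min d10.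
rewrite le_min => /andP[/h1 {}h1 /h2 {}h2].
rewrite !big_cons dotDl dotZl.
set S := \sum_(j <- s) _ in h2 *; set S' := \sum_(j <- s) _ in h2 *; set S'' := \sum_(j <- s) _ in h2 *.
rewrite (_ : _ - _ - _ = c i * (F i (z + h) - F i z - dot (A i) h) + (S - S' - dot S'' h)); last by ring.
apply: le_trans (cnD _ _) _; rewrite cnM.
have nh := nv_ge0 h.
have : cn (c i) * cn (F i (z + h) - F i z - dot (A i) h) <= eta / 2 * nv h.
  apply: le_trans (ler_wpM2l c0 h1) _.
  by apply: frac_le; rewrite ?cn_ge0 ?nv_ge0//; lra.
lra.
Qed.

Lemma tay_line U k f v z : open U -> holomorphic_on U f -> U z ->
  exists a, hdiff (tay k f v) z a /\ dot a v = tay k.+1 f v z.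
Proof.
move=> oU; elim: k f => [|k IH] f hf Uz.
  have [a ha] := holo_hdiff hf Uz; exists a; split=> //.
  by apply: eq_bigr => j _; rewrite /= /pdj (hdiff_partial j ha) mulrC.
have hj j : exists a, hdiff (tay k (pdj j f) v) z a /\ dot a v = tay k.+1 (pdj j f) v z.
  by apply: IH => //; exact: holo_partial.
have [A hA] := choice hj.
exists (\sum_j v 0 j *: A j); split.
  by apply: (@hdiff_sum _ _ (fun j => tay k (pdj j f) v) (fun j => v 0 j)) => j; have [] := hA j.
transitivity (\sum_j v 0 j * tay k.+1 (pdj j f) v z) => //.
rewrite (eq_bigr (fun j => v 0 j * dot (A j) v)); last by move=> j _; have [_ ->] := hA j.
elim/big_ind2 : _ => [|x a y b <- <-|j _]; [exact: dot0|exact: dotDl|exact: dotZl].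
Qed.

(** Each of the k derivatives costs a Cauchy estimate on a polydisc of radius s. *)
Lemma tay_bound U k f v w s M : open U -> holomorphic_on U f -> 0 < s -> 
  pd w (k.+1%:R * s) `<=` U -> (forall x, pd w (k.+1%:R * s) x -> cn (f x) <= M) ->
  cn (tay k f v w) <= M * (12 * nv v / s) ^+ k.
Proof.
move=> oU hf s0; elim: k w => [|k IH] w hsub hM.
  by rewrite expr0 mulr1; apply: hM; apply: pd_center; rewrite mul1r.
have sub x : pd w s x -> pd x (k.+1%:R * s) `<=` pd w (k.+2%:R * s).
  rewrite /pd /= => hx; apply: pd_sub.
  by rewrite -[k.+2%:R]natr1 mulrDl mul1r addrC lerD2l; exact: ltW.
have Uw : U w by apply: hsub; apply: pd_center; rewrite mulr_gt0.
have [a [ha <-]] := tay_line k v oU hf Uw.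
have ho : holomorphic_on (pd w s) (tay k f v).
  apply: holoW (tay_holo k v oU hf) => x hx; apply: hsub; apply: (sub x hx).
  by apply: pd_center; rewrite mulr_gt0.
have := line_derivative_bound v s0 ho _ ha (M := M * (12 * nv v / s) ^+ k).
move=> h; apply: le_trans (h _) _ => [x hx|].
  apply: IH; first by move=> y /(sub x hx) /hsub.
  by move=> y /(sub x hx) /hM.
rewrite exprSr; move: (_ ^+ k) => X.
by rewrite le_eqVlt; apply/orP; left; apply/eqP; ring.
Qed.

(** The polynomial of degree less than N whose j-th derivative at 0 is c j. *)
Definition tpoly (c : nat -> C) N (x : C) : C := \sum_(j < N) x ^+ j / j`!%:R * c j.

Lemma tpolyS c N x : tpoly c N.+1 x = tpoly c N x + x ^+ N / N`!%:R * c N.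
Proof. by rewrite /tpoly big_ord_recr. Qed.

Lemma fact_neq0 k : k`!%:R != 0 :> C.
Proof. by rewrite pnatr_eq0 -lt0n fact_gt0. Qed.

Lemma cdiff_exp (x : C) k : cdiff (fun u => u ^+ k.+1) x (k.+1%:R * x ^+ k).
Proof.
elim: k => [|k IH].
  by rewrite expr0 mulr1; apply: (cdiff_near ltr01 _ (cdiff_id x)) => w _; rewrite expr1.
have := cdiffM (cdiff_id x) IH.
rewrite (_ : x * _ + _ = k.+2%:R * x ^+ k.+1); last by rewrite !exprS -[k.+2%:R]natr1; ring.
by apply: (cdiff_near ltr01) => w _; rewrite exprS.
Qed.

Lemma cdiff_tpoly c N x : cdiff (tpoly c N.+1) x (tpoly (fun j => c j.+1) N x).
Proof.
elim: N => [|N IH].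
  rewrite /tpoly big_ord0; apply: (cdiff_near ltr01 _ (cdiff_cst (c 0%N) x)) => w _.
  by rewrite big_ord1 expr0 divr1 mul1r.
rewrite tpolyS.
have := cdiffD IH (cdiffM (cdiff_exp x N) (cdiff_cst (c N.+1 / N.+1`!%:R) x)).
rewrite mulr0 add0r (_ : _ * (_ * _) = x ^+ N / N`!%:R * c N.+1); last first.
  rewrite factS natrM; field; rewrite fact_neq0 /=.
  by rewrite addrC natr1 pnatr_eq0.
by apply: (cdiff_near ltr01) => w _; rewrite tpolyS -!mulrA (mulrC (c N.+1)).
Qed.

Lemma tpoly0 c N : tpoly c N.+1 0 = c 0%N.
Proof.
rewrite /tpoly big_ord_recl expr0 divr1 mul1r big1 ?addr0// => j _.
by rewrite expr0n /= !mul0r.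
Qed.

(** By induction on N, from the derivative back to the function: differentiating
    the k-th remainder of order N + 1 along v gives the (k + 1)-st remainder of
    order N. *)
Lemma tay_remainder U f v w (A : R) N k : open U -> holomorphic_on U f ->
  (forall t : R, 0 <= t <= 1 -> U (w + t%:C *: v)) ->
  (forall t : R, 0 <= t <= 1 -> cn (tay (k + N) f v (w + t%:C *: v)) <= A) ->
  forall t : R, 0 <= t <= 1 ->
  cn (tay k f v (w + t%:C *: v) - tpoly (fun j => tay (k + j) f v w) N t%:C) <=
    2 ^+ N * A * t ^+ N / N`!%:R.
Proof.
move=> oU hf hU; elim: N k => [|N IH] k hA t ht.
  by rewrite /tpoly big_ord0 subr0 !expr0 mul1r mulr1 divr1 -{1}(addn0 k); exact: hA.
have A0 : 0 <= A by apply: le_trans (cn_ge0 _) (hA 0 _); lra.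
pose F (s : C) := tay k f v (w + s *: v) + (-1) * tpoly (fun j => tay (k + j) f v w) N.+1 s.
pose B := 2 ^+ N * A / N`!%:R.
have B0 : 0 <= B by rewrite /B divr_ge0// mulr_ge0// exprn_ge0.
have hd s : 0 <= s <= 1 -> exists a : C, cdiff F s%:C a /\ cn a <= B * s ^+ N.
  move=> hs; have [a [ha ea]] := tay_line k v oU hf (hU s hs).
  have h1 := hdiff_line ha; rewrite ea in h1.
  have h2 := cdiffM (cdiff_cst (-1) s%:C) (cdiff_tpoly (fun j => tay (k + j) f v w) N s%:C).
  have := cdiffD h1 h2; rewrite mulr0 addr0 mulN1r => h3.
  eexists; split; first exact: h3.
  have := IH k.+1 _ s hs.
  rewrite /B mulrAC.
  rewrite (_ : (fun j => tay (k + j.+1) f v w) = (fun j => tay (k.+1 + j) f v w)); last first.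
    by apply/funext => j; rewrite addnS addSn.
  by apply=> x hx; rewrite addSn -addnS; exact: hA.
have := mvt_power ht B0 hd.
rewrite /F scale0r addr0 tpoly0 addn0 !mulN1r subrr subr0 => /le_trans; apply.
rewrite le_eqVlt; apply/orP; left; apply/eqP.
have f0 : N`!%:R != 0 :> R by rewrite pnatr_eq0 -lt0n fact_gt0.
have n0 : N.+1%:R != 0 :> R by rewrite pnatr_eq0.
rewrite /B factS natrM (exprS 2).
move: (N`!%:R : R) (N.+1%:R : R) f0 n0 (2 ^+ N : R) (t ^+ N.+1) => x y x0 y0 p q.
by field; rewrite x0.
Qed.

(** k^k <= (2k)! / k! = k! C(2k, k) <= k! 4^k. *)
Lemma pow_fact_bound k : (k ^ k <= k`! * 4 ^ k)%N.
Proof.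
have h1 : (k ^ k <= (k + k) ^_ k)%N.
  have gen m j : (m ^ j <= (m + j) ^_ j)%N.
    elim: j => [|j IH]; first by rewrite expn0 ffactn0.
    rewrite expnS addnS ffactnS mulnC /= mulnC.
    by apply: leq_mul => //; rewrite ltnW// ltnS leq_addr.
  exact: gen.
apply: leq_trans h1 _; rewrite -bin_ffact mulnC leq_mul2l; apply/orP; right.
have -> : (4 ^ k = (1 + 1) ^ (k + k))%N by rewrite expnD -expnMn.
rewrite expnDn (bigD1 (inord k : 'I_(k + k).+1)) //= inordK ?ltnS ?leq_addr//.
by rewrite !exp1n !muln1 leq_addr.
Qed.

Lemma pow_fact_real k : (k.+1%:R : R) ^+ k / k`!%:R <= 4 * 4 ^+ k.
Proof.
rewrite ler_pdivrMr ?ltr0n ?fact_gt0//.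
have := pow_fact_bound k.+1; rewrite expnS factS -mulnA leq_mul2l /= => h.
by rewrite -natrX -exprS -!natrX -natrM ler_nat mulnC.
Qed.

End Taylor.

(** * Convergence of Taylor series *)

Section TaylorExtension.
Variables (R : realType) (n : nat).
Local Notation C := R[i].
Local Notation Cn := 'rV[C]_n.
Implicit Types (h v w z : Cn) (a : Cn) (f g : Cn -> C) (r M s : R) (U : set Cn).

(** The radius s is divided into k + 1 equal steps for tay_bound. *)
Lemma tay_estimate U k f v w s M : open U -> holomorphic_on U f -> 0 < s ->
  pd w s `<=` U -> (forall x, pd w s x -> cn (f x) <= M) ->
  cn (tay k f v w) <= M * (12 * k.+1%:R * nv v / s) ^+ k.
Proof.
move=> oU hf s0 hs hM.
have k0 : k.+1%:R != 0 :> R by rewrite pnatr_eq0.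
have E : k.+1%:R * (s / k.+1%:R) = s by rewrite mulrC divfK.
have := @tay_bound R n U k f v w (s / k.+1%:R) M oU hf.
rewrite E divr_gt0 ?ltr0n// => /(_ isT hs hM).
suff -> : 12 * nv v / (s / k.+1%:R) = 12 * k.+1%:R * nv v / s by [].
by field; rewrite ?(gt_eqF s0)// addrC natr1.
Qed.

Lemma tay_coef_bound k (x M t : R) : 0 <= M -> 0 <= t -> x <= M * (k.+1%:R * t) ^+ k ->
  x / k`!%:R <= 4 * M * (4 * t) ^+ k.
Proof.
move=> M0 t0 hx; have f0 : 0 < k`!%:R :> R by rewrite ltr0n fact_gt0.
apply: (@le_trans _ _ (M * (k.+1%:R * t) ^+ k / k`!%:R)).
  by rewrite ler_wpM2r// invr_ge0 ltW.
rewrite !exprMn (_ : M * (_ * _) / _ = M * t ^+ k * (k.+1%:R ^+ k / k`!%:R)); last first.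
  by move: (k`!%:R^-1 : R) (k.+1%:R ^+ k : R) (t ^+ k) => *; ring.
rewrite (_ : 4 * M * _ = M * t ^+ k * (4 * 4 ^+ k)); last first.
  by move: (4 ^+ k : R) (t ^+ k) => *; ring.
by rewrite ler_wpM2l ?pow_fact_real// mulr_ge0// exprn_ge0.
Qed.

Lemma half_pow_le (q : R) k : 0 <= q -> q <= 2^-1 -> q ^+ k <= 2^-1 ^+ k.
Proof. by move=> q0 q2; rewrite lerXn2r// nnegrE; lra. Qed.

(** For |v| < s / 400 the k-th remainder is at most 4 M (4 * 48 |v| / s)^k, and
    192 / 400 < 1 / 2. *)
Lemma tay_expand U f z v s M : open U -> holomorphic_on U f -> 0 < s ->
  pd z s `<=` U -> (forall x, pd z s x -> cn (f x) <= M) -> nv v < s / 400 ->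
  forall e : R, 0 < e -> exists N, forall k, (N <= k)%N ->
    cn (f (z + v) - tpoly (fun j => tay j f v z) k 1) <= e.
Proof.
move=> oU hf s0 hs hM hv e e0.
have M0 : 0 <= M by apply: le_trans (cn_ge0 _) (hM z (pd_center z s0)).
have nv0' := nv_ge0 v.
have hin (t : R) : 0 <= t <= 1 -> pd (z + t%:C *: v) (s / 2) `<=` pd z s.
  move=> /andP[t0 t1]; apply: pd_sub; rewrite addrAC subrr add0r nvZ cn_real ger0_norm//.
  have h : t * nv v <= nv v by rewrite ler_piMl.
  lra.
have s2 : 0 < s / 2 by lra.
have hU (t : R) : 0 <= t <= 1 -> U (z + t%:C *: v).
  by move=> ht; apply: hs; apply: (hin t ht); exact: pd_center.
have e1 : 0 < e / (4 * M + 1) by rewrite divr_gt0//; lra.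
have h12 : 0 <= (2^-1 : R) by rewrite invr_ge0.
have h12' : (2^-1 : R) < 1 by lra.
have [N hN] := geometric_small h12 h12' e1.
exists N => k /hN hk.
pose A := M * (12 * k.+1%:R * nv v / (s / 2)) ^+ k.
have hA (t : R) : 0 <= t <= 1 -> cn (tay (0 + k) f v (z + t%:C *: v)) <= A.
  move=> ht; rewrite add0n; apply: (@tay_estimate U) => //; first by move=> x /(hin t ht) /hs.
  by move=> x /(hin t ht) /hM.
have one : 0 <= (1 : R) <= 1 by rewrite ler01 lexx.
have := tay_remainder oU hf hU hA one.
rewrite rmorph1 scale1r expr1n mulr1 => h; apply: le_trans h _.
have hx : 2 ^+ k * A <= M * (k.+1%:R * (48 * nv v / s)) ^+ k.
  rewrite /A mulrCA -exprMn le_eqVlt; apply/orP; left; apply/eqP; congr (_ * _ ^+ _).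
  by field; rewrite (gt_eqF s0).
have t0 : 0 <= 48 * nv v / s by rewrite divr_ge0 ?mulr_ge0// ltW.
apply: le_trans (tay_coef_bound M0 t0 hx) _.
have q2 : 4 * (48 * nv v / s) <= 2^-1.
  by rewrite -mulrA mulrA mulrA ler_pdivrMr//; lra.
have q0 : 0 <= 4 * (48 * nv v / s) by rewrite mulr_ge0.
have YX := half_pow_le k q0 q2.
have X0 := exprn_ge0 k h12.
rewrite ler_pdivlMr in hk; last by lra.
have M4 : 0 <= 4 * M by lra.
apply: le_trans (ler_wpM2l M4 YX) _.
by move: (2^-1 ^+ k) X0 hk => X X0 hk; lra.
Qed.

(** The hypothesis bounds the Taylor coefficients of f at z only; they define a
    holomorphic function on the polydisc of radius s / 400, whatever the size of
    U around z. It equals f as far as the expansion of f itself is known to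
    converge. *)
Lemma tay_extension U f z s M : open U -> holomorphic_on U f -> 0 < s -> 0 <= M ->
  (forall k v, cn (tay k f v z) <= M * (12 * k.+1%:R * nv v / s) ^+ k) ->
  exists g, holomorphic_on (pd z (s / 400)) g /\
    forall s', 0 < s' -> pd z s' `<=` U ->
      forall w, pd z (s / 400) w -> pd z (s' / 800) w -> g w = f w.
Proof.
move=> oU hf s0 M0 hM.
have [F [UF hF]] := ultra_nat.
pose S k w := tpoly (fun j => tay j f (w - z) z) k 1.
have hcoef j w : pd z (s / 400) w ->
    cn (1 ^+ j / j`!%:R * tay j f (w - z) z) <= 4 * M * 2^-1 ^+ j.
  rewrite /pd /= => hw; rewrite expr1n mul1r mulrC cnM cnV cn_nat.
  have n0 := nv_ge0 (w - z).
  have t0 : 0 <= 12 * nv (w - z) / s by rewrite divr_ge0 ?mulr_ge0// ltW.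
  have := @tay_coef_bound j (cn (tay j f (w - z) z)) M _ M0 t0.
  move=> h; apply: le_trans (h _) _.
    apply: le_trans (hM _ _) _; rewrite le_eqVlt; apply/orP; left; apply/eqP; congr (_ * _ ^+ _).
    by ring.
  rewrite ler_wpM2l ?mulr_ge0//; apply: half_pow_le; first by rewrite mulr_ge0.
  by rewrite mulrA mulrA ler_pdivrMr//; lra.
have hS k w : pd z (s / 400) w -> cn (S k w) <= 8 * M.
  move=> hw; suff : cn (S k w) <= 8 * M - 8 * M * 2^-1 ^+ k.
    move=> h; apply: le_trans h _; rewrite gerBl mulr_ge0// ?exprn_ge0//; lra.
  elim: k => [|k IH]; first by rewrite /S /tpoly big_ord0 cn0 expr0; lra.
  rewrite /S tpolyS; apply: le_trans (cnD_le IH (hcoef k w hw)) _.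
  by rewrite exprS; move: (_ ^+ k) => X; lra.
have hex w : exists l, pd z (s / 400) w -> ulim F (fun k => S k w) l.
  have [hw|] := pselect (pd z (s / 400) w); last by exists 0.
  have [l hl] := @ulim_exists R _ F UF (fun k => S k w) _ (fun k => hS k w hw).
  by exists l.
have [g hg] := choice hex.
exists g; split=> [x hx|s' s'0 hs' w hw hw'].
  have r0 : 0 < s / 400 - nv (x - z) by move: hx; rewrite /pd /=; lra.
  have sub : pd x (s / 400 - nv (x - z)) `<=` pd z (s / 400) by apply: pd_sub; rewrite addrC subrK.
  apply: (@holo_ulim R n _ F UF S g x _ (8 * M) r0) => [k|k w /sub|w /sub].
  - rewrite /S /tpoly; apply: holo_sum => j; apply: holoM; first exact: holo_cst.
    have := @holo_affine R n setT (pd x (s / 400 - nv (x - z))) (fun v => tay j f v z) (- z) 1%:M.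
    have -> : (fun w => tay j f (- z + w *m 1%:M) z) = fun w => tay j f (w - z) z.
      by apply/funext => w; rewrite mulmx1 addrC.
    by apply=> //; exact: tay_holo_dir.
  - exact: hS.
  - exact: hg.
have s2 : 0 <= s' / 2 by lra.
have sub : [set x | nv (x - z) <= s' / 2] `<=` U.
  by move=> x /= hx; apply: hs'; rewrite /pd /=; lra.
have [M' [M'0 hM']] := holo_compact_bounded (@cpd_compact R n z _ s2) sub hf.
apply: (ulim_unique (hg w hw)); apply: ulim_seq => // e e0.
have s2' : 0 < s' / 2 by lra.
have sub2 : pd z (s' / 2) `<=` U by move=> x hx; apply: sub => /=; exact: ltW.
have hb x : pd z (s' / 2) x -> cn (f x) <= M' by move=> hx; apply: hM' => /=; exact: ltW.
have hv : nv (w - z) < s' / 2 / 400 by move: hw'; rewrite /pd /=; lra.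
have [N hN] := tay_expand oU hf s2' sub2 hb hv e0.
exists N => k /hN; rewrite (addrC z) subrK cnC; apply.
Qed.

End TaylorExtension.

(** * A criterion for Stein open sets *)

Section SteinCriterion.
Variables (R : realType) (n : nat).
Local Notation C := R[i].
Local Notation Cn := 'rV[C]_n.
Implicit Types (h v w z p : Cn) (a : Cn) (f g : Cn -> C) (r M s : R) (U V K : set Cn).

Lemma hullP V K z : holomorphic_hull V K z <-> V z /\
  forall f, holomorphic_on V f -> forall M, (forall w, K w -> cn (f w) <= M) -> cn (f z) <= M.
Proof.
split=> -[Vz h]; split=> // f hf M hM.
  by have := h f hf M; rewrite normE lecR; apply=> w Kw; rewrite normE lecR; exact: hM.
by rewrite normE lecR; apply: (h f hf) => w Kw; have := hM w Kw; rewrite normE lecR.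
Qed.

Lemma hdiff_coord z (i : 'I_n) : hdiff (fun w => w 0 i) z (delta_mx 0 i).
Proof.
move=> eta eta0; exists 1; split=> // h _.
rewrite (_ : dot (delta_mx 0 i) h = h 0 i); last first.
  rewrite /dot (bigD1 i)//= mxE !eqxx mul1r big1 ?addr0// => k ki.
  by rewrite mxE (negbTE ki) andbF mul0r.
by rewrite mxE [_ + h 0 i]addrC addrK subrr cn0 mulr_ge0 ?nv_ge0// ltW.
Qed.

Lemma coord_bounded K : compact K -> exists B : R, 0 <= B /\ forall j z, K z -> cn (z 0 j) <= B.
Proof.
move=> cK; have hj (j : 'I_n) : exists M : R, 0 <= M /\ forall z, K z -> cn (z 0 j) <= M.
  by apply: (@holo_compact_bounded R n K setT (fun z => z 0 j) cK) => //; exact: holo_coord.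
have [B hB] := choice hj.
exists (\sum_j B j); split; first by apply: sumr_ge0 => j _; have [] := hB j.
move=> j z Kz; have [_ h] := hB j; apply: le_trans (h z Kz) _.
rewrite (bigD1 j)//= lerDl sumr_ge0// => k _; by have [] := hB k.
Qed.

(** The coordinate functions bound the hull and separate points. A limit of points
    of the hull lies in V because the points of the hull keep a fixed distance
    from the complement of V. *)
Lemma Stein_crit V : open V ->
  (forall K, compact K -> K `<=` V -> exists r, 0 < r /\ forall p, holomorphic_hull V K p -> pd p r `<=` V) ->
  Stein V.
Proof.
move=> oV hV; split=> //.
- move=> K KV cK; have [r [r0 hr]] := hV K cK KV.
  have [B [B0 hB]] := coord_bounded cK.
  apply: (subclosed_compact _ (@cpd_compact R n 0 B B0)); last first.
    move=> p /hullP[Vp hp] /=; rewrite subr0; apply: nv_le => // j.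
    by apply: (hp (fun z => z 0 j)) => [|w Kw]; [exact: holo_coord|exact: hB].
  move=> z hz.
  have near e : 0 < e -> exists p, holomorphic_hull V K p /\ nv (p - z) < e.
    move=> e0; have [p [hp pe]] : (holomorphic_hull V K `&` pd z e) !=set0.
      by apply: hz; apply/nbhs_nv; exists e.
    by exists p.
  have Vz : V z by have [p [hp pz]] := near r r0; apply: (hr p hp); rewrite /pd /= nvC.
  apply/hullP; split=> // f hf M hM.
  have [a ha] := holo_hdiff hf Vz.
  apply/ler_addgt0Pr => e e0; have [d [d0 hd]] := hdiff_continuous ha e0.
  have [p [/hullP[_ hp] pz]] := near d d0.
  have := hd p (ltW pz); have := hp f hf M hM; have := cn_tri (f p) (f z) 0.
  rewrite !subr0 (cnC (f z)); lra.
- move=> z w Vz Vw zw; have [j hj] : exists j, z 0 j <> w 0 j.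
    by apply: contrapT => h; apply: zw; apply/rowP => j; apply: contrapT => hj; apply: h; exists j.
  by exists (fun x => x 0 j); split=> //; exact: holo_coord.
- move=> z Vz; exists (fun i x => x 0 i); split=> [i|]; first exact: holo_coord.
  rewrite (_ : \matrix_(_, _) _ = 1%:M) ?unitmx1//.
  apply/matrixP => i j; rewrite !mxE (hdiff_partial j (hdiff_coord z i)) mxE eqxx /=.
  by rewrite eq_sym.
Qed.

Lemma compact_in_pd K (e : R) : 0 < e -> compact K -> K `<=` pd 0 e ->
  exists s, [/\ 0 < s, s < e & forall z, K z -> nv z <= e - s].
Proof.
move=> e0 cK Ke; have [s [s0 hs]] := compact_thick cK (@pd_open R n 0 e) Ke.
pose s' := Num.min (s / 2) (e / 2).
have s'0 : 0 < s' by rewrite lt_min; apply/andP; split; lra.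
have [h1 h2] : s' <= s / 2 /\ s' <= e / 2 by rewrite /s' !ge_min !lexx orbT.
exists s'; split=> //; first by lra.
move=> z Kz; have [nz|nz] := leP (nv z) 0; first by lra.
have := hs z Kz (z + (s' / nv z)%:C *: z).
rewrite /pd /= addrAC subrr add0r subr0 nvZ cn_real gtr0_norm ?divr_gt0//.
rewrite divfK ?gt_eqF// => /(_ ltac:(lra)).
have -> : z + (s' / nv z)%:C *: z = (1 + s' / nv z)%:C *: z.
  by rewrite rmorphD rmorph1 scalerDl scale1r.
rewrite nvZ cn_real; have q0 : 0 < s' / nv z by rewrite divr_gt0.
rewrite ger0_norm; last by lra.
by rewrite mulrDl mul1r divfK ?gt_eqF//; lra.
Qed.

Lemma pd_Stein (e : R) : 0 < e -> Stein (pd (0 : Cn) e).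
Proof.
move=> e0; apply: Stein_crit; first exact: pd_open.
move=> K cK Ke; have [s [s0 se hs]] := compact_in_pd e0 cK Ke.
exists s; split=> // p /hullP[_ hp]; apply: pd_sub; rewrite subr0.
suff : nv p <= e - s by lra.
apply: nv_le => [|j]; first by lra.
apply: (hp (fun z => z 0 j)) => [|w Kw]; first exact: holo_coord.
exact: le_trans (cn_le_nv _ _) (hs w Kw).
Qed.

Lemma pd_connected (e : R) : connected (pd (0 : Cn) e).
Proof.
have [e0|e0] := leP e 0.
  rewrite (_ : pd _ _ = set0); first exact: connected0.
  apply/seteqP; split=> // z; rewrite /pd /= subr0 => h; have := nv_ge0 z; lra.
pose seg (z : Cn) := (fun t : R => t%:C *: z) @` `[0, 1].
have -> : pd (0 : Cn) e = \bigcup_(z in pd 0 e) seg z.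
  apply/seteqP; split=> [z hz|z [w hw [t ht <-]]].
    by exists z => //; exists 1 => /=; [rewrite in_itv /= ler01 lexx|rewrite rmorph1 scale1r].
  move: hw ht; rewrite /pd /= in_itv /= !subr0 nvZ cn_real => hw /andP[t0 t1].
  by rewrite ger0_norm//; have := nv_ge0 w; nra.
apply: bigcup_connected.
  exists 0 => z hz; exists 0; first by rewrite /= in_itv /= lexx ler01.
  by rewrite rmorph0 scale0r.
move=> z hz; apply: connected_continuous_connected; first exact: segment_connected.
apply: continuous_subspaceT => t; move=> A /nbhs_nv[r [r0 hr]].
have nz := nv_ge0 z; have nz1 : 0 < 1 + nv z by lra.
apply/nbhs_ballP; exists (r / (1 + nv z)) => /=; first by rewrite divr_gt0.
move=> t'; rewrite -ball_normE /= distrC ltr_pdivlMr// => ht; apply: hr.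
rewrite -scalerBl nvZ -rmorphB cn_real; have := normr_ge0 (t' - t); lra.
Qed.

End SteinCriterion.

(** * Contraction of a group of coordinates *)

Section Scaling.
Variables (R : realType) (n : nat) (N : pred 'I_n).
Local Notation C := R[i].
Local Notation Cn := 'rV[C]_n.
Implicit Types (h v w z p : Cn) (t s : R).

Definition sc t z : Cn := \row_j (if N j then z 0 j else t%:C * z 0 j).

Lemma scE t z j : sc t z 0 j = if N j then z 0 j else t%:C * z 0 j.
Proof. by rewrite mxE. Qed.

Lemma sc_mulmx t : exists A : 'M[C]_n, forall z, sc t z = 0 + z *m A.
Proof.
exists (diag_mx (\row_j (if N j then 1 else t%:C))) => z; apply/rowP => j.
rewrite add0r mul_mx_diag !mxE.
by case: (N j); rewrite ?mulr1// mulrC.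
Qed.

Lemma sc1 z : sc 1 z = z.
Proof. by apply/rowP => j; rewrite scE rmorph1 mul1r; case: (N j). Qed.

Lemma sc_sc s t z : sc s (sc t z) = sc (s * t) z.
Proof. by apply/rowP => j; rewrite !scE; case: (N j) => //; rewrite rmorphM /= mulrA. Qed.

Lemma scB t z w : sc t z - sc t w = sc t (z - w).
Proof. by apply/rowP => j; rewrite !mxE; case: (N j) => //; rewrite mulrBr. Qed.

Lemma nv_sc t z : 0 <= t <= 1 -> nv (sc t z) <= nv z.
Proof.
move=> /andP[t0 t1]; apply: nv_le => [|j]; first exact: nv_ge0.
have h := cn_le_nv z j; rewrite scE; case: (N j) => //.
rewrite cnM cn_real ger0_norm//; apply: le_trans h.
by rewrite ler_piMl// cn_ge0.
Qed.

Lemma sc_lip_t s t z : nv (sc s z - sc t z) <= nv z * `|s - t|.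
Proof.
apply: nv_le => [|j]; first by rewrite mulr_ge0// nv_ge0.
have h := cn_le_nv z j; have h0 := cn_ge0 (z 0 j).
rewrite !mxE; case: (N j).
  by rewrite subrr cn0 mulr_ge0// nv_ge0.
by rewrite -mulrBl cnM -rmorphB cn_real mulrC ler_wpM2r.
Qed.

Lemma sc_segment t z : sc t z = sc 0 z + t%:C *: (z - sc 0 z).
Proof.
apply/rowP => j; rewrite !mxE; case: (N j); first by rewrite subrr mulr0 addr0.
by rewrite rmorph0 mul0r subr0 add0r.
Qed.

Lemma sc_interpolate t t' (x : R) z :
  sc t z + x%:C *: (sc t' z - sc t z) = sc (t + (t' - t) * x) z.
Proof.
apply/rowP => j; rewrite !mxE; case: (N j); first by rewrite subrr mulr0 addr0.
by rewrite rmorphD rmorphM rmorphB /=; ring.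
Qed.

Lemma unit_interpolate t t' (x : R) : 0 <= t <= 1 -> 0 <= t' <= 1 -> 0 <= x <= 1 ->
  0 <= t + (t' - t) * x <= 1.
Proof.
move=> /andP[t0 t1] /andP[t0' t1'] /andP[x0 x1].
have -> : t + (t' - t) * x = (1 - x) * t + x * t' by ring.
by apply/andP; split; nra.
Qed.

Lemma holo_sc (U V : set Cn) f t : (forall z, V z -> U (sc t z)) -> holomorphic_on U f ->
  holomorphic_on V (fun z => f (sc t z)).
Proof.
move=> hV hf; have [A hA] := sc_mulmx t.
have -> : (fun z => f (sc t z)) = fun z => f (0 + z *m A) by apply/funext => z; rewrite hA.
by apply: holo_affine hf => w /hV; rewrite hA.
Qed.

Lemma compact_sc (K : set Cn) : compact K ->
  compact [set w | exists t z, [/\ 0 <= t <= 1, K z & w = sc t z]].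
Proof.
move=> cK; pose F (x : R * Cn) := sc x.1 x.2.
have -> : [set w | exists t z, [/\ 0 <= t <= 1, K z & w = sc t z]] = F @` (`[0, 1] `*` K).
  apply/seteqP; split=> [w [t [z [ht Kz ->]]]|w [[t z] [/= ht Kz] <-]].
    by exists (t, z) => //; split=> //=; rewrite in_itv.
  by exists t, z; split=> //; move: ht; rewrite in_itv.
apply: continuous_compact; last by apply: compact_setX => //; exact: segment_compact.
apply: continuous_subspaceT => -[t z] A /nbhs_nv[r [r0 hr]].
have nz := nv_ge0 z; have nt := normr_ge0 t.
pose d1 := Num.min 1 (r / 2 / (1 + nv z)).
pose d2 := r / 2 / (2 + `|t|).
have d10 : 0 < d1 by rewrite lt_min ltr01 !divr_gt0//; lra.
have d20 : 0 < d2 by rewrite !divr_gt0//; lra.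
exists ([set t' | `|t' - t| < d1], [set z' | nv (z' - z) < d2]) => /=.
  split; last by apply/nbhs_nv; exists d2.
  by apply/nbhs_ballP; exists d1 => //= x; rewrite -ball_normE /= distrC.
move=> [t' z'] [/=]; rewrite /d1 lt_min => /andP[h1 h2] h3; apply: hr; rewrite /F /=.
apply: le_lt_trans (nv_tri (sc t' z) _ _) _.
rewrite scB; have h4 := sc_lip_t t' t z.
have h5 : nv (sc t' (z' - z)) <= (1 + `|t'|) * nv (z' - z).
  apply: nv_le => [|j]; first by rewrite mulr_ge0 ?nv_ge0//; have := normr_ge0 t'; lra.
  have h := cn_le_nv (z' - z) j; have h0 := cn_ge0 ((z' - z) 0 j); have nt' := normr_ge0 t'.
  rewrite scE; case: (N j); last by rewrite cnM cn_real; nra.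
  by nra.
have h6 : `|t'| <= 1 + `|t| by have := ler_normD (t' - t) t; rewrite subrK; lra.
have h7 := nv_ge0 (z' - z).
rewrite ltr_pdivlMr in h2; last by lra.
rewrite ltr_pdivlMr in h3; last by lra.
have h8 := normr_ge0 (t' - t).
have h9 : (1 + `|t'|) * nv (z' - z) <= (2 + `|t|) * nv (z' - z) by rewrite ler_wpM2r//; lra.
lra.
Qed.

End Scaling.

(** * Extension with two negative directions *)

Section Hartogs.
Variables (R : realType) (n : nat) (N : pred 'I_n).
Local Notation C := R[i].
Local Notation Cn := 'rV[C]_n.
Implicit Types (h v w z p : Cn) (f : Cn -> C) (r M s : R).
Variables (e : R) (e0 : 0 < e) (O : set Cn).
Hypothesis O_open : open O.
Hypothesis O_cone : forall z, pd 0 e z ->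
  (exists i, [/\ N i, z 0 i != 0 & forall j, ~~ N j -> cn (z 0 j) < 10 * cn (z 0 i)]) -> O z.
Hypothesis O_sc : forall z (t : R), O z -> 0 <= t <= 1 -> O (sc N t z).

Lemma avg_holo (D : set Cn) (F : Cn -> R -> C) m :
  (forall t : R, `|t| <= 1 -> holomorphic_on D (fun w => F w t)) ->
  holomorphic_on D (fun w => avg m (F w)).
Proof.
elim: m F => [|m IH] F hF /=; first by apply: hF; rewrite normr0.
have h t : `|t| <= 1 -> [/\ `|(t - 2) / 3| <= 1, `|t / 3| <= 1 & `|(t + 2) / 3| <= 1 :> R].
  by rewrite !ler_norml => ?; split; lra.
apply: holoM; last exact: holo_cst.
apply: holoD; first apply: holoD.
- by apply: (IH (fun w t => F w ((t - 2) / 3))) => t /h[? ? ?]; exact: hF.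
- by apply: (IH (fun w t => F w (t / 3))) => t /h[? ? ?]; exact: hF.
- by apply: (IH (fun w t => F w ((t + 2) / 3))) => t /h[? ? ?]; exact: hF.
Qed.

Lemma holo_translate (U D : set Cn) f v : (forall w, D w -> U (w + v)) ->
  holomorphic_on U f -> holomorphic_on D (fun w => f (w + v)).
Proof.
move=> hD hf; have -> : (fun w => f (w + v)) = fun w => f (v + w *m 1%:M).
  by apply/funext => w; rewrite mulmx1 addrC.
by apply: holo_affine hf => w /hD; rewrite mulmx1 addrC.
Qed.

Lemma mean_holo (D U : set Cn) f v m r : 0 < r -> holomorphic_on U f ->
  (forall w u, D w -> sqbound 0 r u -> U (w + u *: v)) ->
  holomorphic_on D (fun w => mean m (fun u => f (w + u *: v)) 0 r).
Proof.
move=> r0 hf hD; apply: holoM; first exact: holo_cst.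
have H (q : R -> C) : (forall t, `|t| <= 1 -> sqbound 0 r (q t)) ->
    holomorphic_on D (fun w => avg m (fun t => f (w + q t *: v) / (q t - 0))).
  move=> hq; apply: avg_holo => t /hq ht; apply: holoM; last exact: holo_cst.
  by apply: holo_translate hf => w Dw; exact: hD.
have sq (t : R) ht := @sqbound_edges R 0 r t (ltW r0) ht.
apply: holoM; first exact: holo_cst.
apply: holoD; first (apply: holoB); last (apply: holoM; [exact: holo_cst|apply: holoB]).
- by apply: (H (fun t => 0 + r%:C + t%:C * ('i * r%:C))) => t /sq[].
- by apply: (H (fun t => 0 - r%:C + t%:C * ('i * r%:C))) => t /sq[].
- by apply: (H (fun t => 0 + 'i * r%:C + t%:C * r%:C)) => t /sq[].
- by apply: (H (fun t => 0 - 'i * r%:C + t%:C * r%:C)) => t /sq[].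
Qed.

Variables (i0 i1 : 'I_n).
Hypothesis (Ni0 : N i0) (Ni1 : N i1) (i01 : i1 != i0).

Let e_ := delta_mx 0 i0 : Cn.
(** For z in U1, the square with centre z and half side e / 3 in the direction i0
    lies in the polydisc, and its boundary lies in O: the i0-th coordinate exceeds
    e / 3 - e / 5 > e / 10 there. *)
Let U1 : set Cn := [set z | pd 0 e z /\ cn (z 0 i0) < e / 5].

Let addE (z : Cn) (u : C) j : (z + u *: e_) 0 j = if j == i0 then z 0 j + u else z 0 j.
Proof. by rewrite !mxE eqxx /= ; case: (j == i0); rewrite ?mulr1// mulr0 addr0. Qed.

Let U1_open : open U1.
Proof.
have e_gt0 := e0.
apply/open_nv => z [hz hz0]; pose d := Num.min (e - nv z) (e / 5 - cn (z 0 i0)).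
exists d; split.
  by move: hz; rewrite /pd /= subr0 => hz; rewrite lt_min; apply/andP; split; lra.
move=> w; rewrite /d lt_min => /andP[h1 h2]; split.
  by rewrite /pd /= subr0; have := nv_tri z w 0; rewrite !subr0; lra.
have := cn_le_nv (w - z) i0; rewrite !mxE; have := cn_tri (z 0 i0) (w 0 i0) 0; rewrite !subr0; lra.
Qed.

Let node_in (z : Cn) (u : C) : U1 z -> square 0 (e / 3) u -> pd 0 e (z + u *: e_).
Proof.
have e_gt0 := e0.
move=> [hz hz0] hu; have hu' := square_cn hu.
rewrite subr0 in hu'; rewrite /pd /= subr0; apply: nv_lt => // j.
rewrite addE; case: eqP => [->|_]; first by apply: le_lt_trans (cnD _ _) _; lra.
by apply: le_lt_trans (cn_le_nv z j) _; move: hz; rewrite /pd /= subr0.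
Qed.

Let node_O (z : Cn) (u : C) : U1 z -> sqbound 0 (e / 3) u -> O (z + u *: e_).
Proof.
have e_gt0 := e0.
move=> Uz [hu1]; rewrite subr0 => hu2; have hz := node_in Uz hu1; apply: O_cone => //.
have [hz1 hz0] := Uz.
have big : e / 3 - e / 5 < cn ((z + u *: e_) 0 i0).
  by rewrite addE eqxx; apply: lt_le_trans (cn_addr_ge _ _); lra.
exists i0; split=> //; first by rewrite -cn_gt0; lra.
move=> j _; have := cn_le_nv (z + u *: e_) j; move: hz; rewrite /pd /= subr0; lra.
Qed.

(** Cauchy's formula over these squares defines a holomorphic function E on U1.
    If the i1-th coordinate of z dominates, moving the i0-th one does not leave
    the cone, so the whole square lies in O and E z = f z. From there the
    equality reaches every point of the intersection of O and U1 with nonzero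
    i1-th coordinate along the segment that contracts the coordinates outside N, and the others by
    continuity. Finally O and U1 cover the polydisc. *)
Lemma hartogs_extension f : holomorphic_on O f ->
  exists g, holomorphic_on (pd 0 e) g /\ forall z, O z -> g z = f z.
Proof.
have e_gt0 := e0.
move=> hf; have [F [UF hF]] := @ultra_nat.
have r0 : 0 < e / 3 by lra.
pose Em m z := mean m (fun u => f (z + u *: e_)) 0 (e / 3).
(* The squares about the points close to z have their boundaries in a common
   compact subset of O. *)
have bnd z : U1 z -> exists r M : R, [/\ 0 < r, pd z r `<=` U1 &
    forall w u, pd z r w -> sqbound 0 (e / 3) u -> cn (f (w + u *: e_)) <= M].
  move=> Uz; have [r1 [r10 hr1]] := (open_nv U1).1 U1_open z Uz.
  have [hz1 hz0] := Uz; rewrite /pd /= subr0 in hz1.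
  pose eta := Num.min ((e - nv z) / 2) (e / 10).
  have eta0 : 0 < eta by rewrite lt_min; apply/andP; split; lra.
  have [eta1 eta2] : eta <= (e - nv z) / 2 /\ eta <= e / 10 by rewrite /eta !ge_min !lexx orbT.
  pose K : set Cn := [set x | nv (x - 0) <= e - eta /\ e / 3 - e / 5 <= cn (x 0 i0)].
  have cK : compact K.
    apply: (subclosed_compact _ (@cpd_compact R n 0 (e - eta) ltac:(lra))) => [|x []//].
    move=> x hx; have near d : 0 < d -> exists y, K y /\ nv (y - x) < d.
      move=> d0; have [y [Ky yd]] : (K `&` pd x d) !=set0.
        by apply: hx; apply/nbhs_nv; exists d.
      by exists y.
    split; apply/ler_addgt0Pr => d d0; have [y [[h1 h2] h3]] := near d d0.
      by have := nv_tri y x 0; rewrite (nvC x y); lra.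
    have := cn_le_nv (y - x) i0; rewrite !mxE.
    by have := cn_tri (x 0 i0) (y 0 i0) 0; rewrite !subr0; lra.
  have KO : K `<=` O.
    move=> x [h1 h2]; rewrite subr0 in h1; apply: O_cone; first by rewrite /pd /= subr0; lra.
    exists i0; split=> //; first by rewrite -cn_gt0; lra.
    by move=> j _; have := cn_le_nv x j; lra.
  have [M [_ hM]] := holo_compact_bounded cK KO hf.
  exists (Num.min r1 eta), M; split; first by rewrite lt_min r10.
    by move=> w; rewrite /pd /= lt_min => /andP[/hr1].
  move=> w u; rewrite /pd /= lt_min => /andP[/hr1 Uw h2] hu; apply: hM.
  have [hw1 hw0] := Uw; have [hu1 hu2] := hu; rewrite subr0 in hu2.
  have hu3 := square_cn hu1; rewrite subr0 in hu3.
  split; last first.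
    by rewrite addE eqxx; apply: le_trans (cn_addr_ge _ _); lra.
  rewrite subr0; apply: nv_le => [|j]; first by lra.
  rewrite addE; case: eqP => [->|_]; first by apply: le_trans (cnD _ _) _; lra.
  have := cn_le_nv w j; have := nv_tri z w 0; rewrite !subr0; lra.
have hex z : exists l, U1 z -> ulim F (fun m => Em m z) l.
  have [Uz|] := pselect (U1 z); last by exists 0.
  have [r [M [rz0 _ hM]]] := bnd z Uz.
  have hb m : cn (Em m z) <= 2 * M.
    by apply: mean_bound => // u hu; apply: hM => //; exact: pd_center.
  by have [l hl] := @ulim_exists R _ F UF (fun m => Em m z) _ hb; exists l.
have [E hE] := choice hex.
have Eholo : holomorphic_on U1 E.
  move=> z Uz; have [r [M [rz0 sub hM]]] := bnd z Uz.
  apply: (@holo_ulim R n _ F UF Em E z r (2 * M) rz0) => [m|m w hw|w /sub].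
  - apply: (@mean_holo _ O) => // w u /sub Uw; exact: node_O.
  - by apply: mean_bound => // u hu; exact: hM.
  - exact: hE.
have Ef1 z : U1 z -> z 0 i1 != 0 -> (forall j, ~~ N j -> cn (z 0 j) < 10 * cn (z 0 i1)) -> E z = f z.
  move=> Uz z1 hz; apply: (ulim_unique (hE z Uz)); apply: ulim_seq => // d d0.
  have hd u : square 0 (e / 3) u -> exists a : C, cdiff (fun u => f (z + u *: e_)) u a.
    move=> hu; have Ou : O (z + u *: e_).
      apply: O_cone; first exact: node_in.
      exists i1; rewrite addE (negbTE i01); split=> // j Nj.
      rewrite addE; case: eqP => [ji|_]; last exact: hz.
      by move: Nj; rewrite ji Ni0.
    by have [a ha] := holo_hdiff hf Ou; exists (dot a e_); exact: hdiff_line.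
  have := mean_cvg r0 hd d0; rewrite scale0r addr0; apply.
have Ef z : O z -> U1 z -> E z = f z.
  move=> Oz Uz.
  pose D := O `&` U1.
  have oD : open D by exact: openI.
  have hD : holomorphic_on D (fun w => f w - E w).
    by apply: holoB; [apply: holoW hf|apply: holoW Eholo] => w [].
  have gen x : D x -> x 0 i1 != 0 -> f x - E x = 0.
    move=> [Ox Ux] x1.
    have segD (t : R) : 0 <= t <= 1 -> D (sc N 0 x + t%:C *: (x - sc N 0 x)).
      move=> ht; rewrite -sc_segment; split; first exact: O_sc.
      have [h1 h2] := Ux; split; last by rewrite scE Ni0.
      by move: h1; rewrite /pd /= !subr0; have := nv_sc N x ht; lra.
    have [|d [d0 hd]] := identity_segment oD hD segD; last by apply: hd; exact: pd_center.
    have c1 : 0 < cn (x 0 i1) by rewrite cn_gt0.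
    have D0 : D (sc N 0 x) by have := segD 0; rewrite rmorph0 scale0r addr0; apply; rewrite lexx ler01.
    have [d [d0 hd]] := (open_nv D).1 oD _ D0.
    pose d' := Num.min d (cn (x 0 i1) / 2); exists d'; split; first by rewrite lt_min d0 divr_gt0.
    move=> y; rewrite /pd /= lt_min => /andP[/hd[Oy Uy] hy].
    have y1 : cn (x 0 i1) / 2 < cn (y 0 i1).
      have := cn_le_nv (y - sc N 0 x) i1; rewrite !mxE Ni1.
      by have := cn_tri (y 0 i1) (x 0 i1) 0; rewrite !subr0 cnC; lra.
    apply/eqP; rewrite subr_eq0; apply/eqP/esym; apply: Ef1 => //; first by rewrite -cn_gt0; lra.
    move=> j Nj; have := cn_le_nv (y - sc N 0 x) j; rewrite !mxE (negbTE Nj) rmorph0 mul0r subr0.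
    lra.
  (* If the i1-th coordinate of z vanishes, move it by a small amount tau. *)
  have [z1|z1] := eqVneq (z 0 i1) 0; last first.
    by apply/esym/eqP; rewrite -subr_eq0; apply/eqP; exact: gen.
  have Dz : D z by [].
  have [a ha] := holo_hdiff hD Dz.
  apply/esym/eqP; rewrite -subr_eq0 -cn_eq0 eq_le cn_ge0 andbT; apply/ler_addgt0Pr => d d0.
  have [d1 [d10 h1]] := hdiff_continuous ha d0.
  have [d2 [d20 h2]] := (open_nv D).1 oD z Dz.
  pose tau := Num.min d1 (d2 / 2).
  have tau0 : 0 < tau by rewrite lt_min d10 divr_gt0.
  have [tau1 tau2] : tau <= d1 /\ tau <= d2 / 2 by rewrite /tau !ge_min !lexx orbT.
  pose x := z + tau%:C *: delta_mx 0 i1.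
  have xz : nv (x - z) <= tau.
    by rewrite /x addrAC subrr add0r nvZ cn_real gtr0_norm// ler_piMr ?nv_delta// ltW.
  have Dx : D x by apply: h2; lra.
  have x1 : x 0 i1 != 0.
    by rewrite !mxE z1 !eqxx add0r mulr1 -cn_gt0 cn_real gtr0_norm.
  have := h1 x (le_trans xz tau1); rewrite (gen x Dx x1) sub0r cnN add0r.
  exact.
exists (fun z => if pselect (O z) then f z else E z); split; last first.
  by move=> z Oz; case: pselect.
move=> z hz; have [Oz|nOz] := pselect (O z).
  have [d [d0 hd]] := (open_nv O).1 O_open z Oz.
  have [a ha] := holo_hdiff hf Oz.
  apply: (@hdiff_differentiable _ _ _ _ a); apply: (hdiff_near d0 _ ha) => w /hd Ow.
  by case: pselect.
have Uz : U1 z.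
  split=> //; rewrite ltNge; apply/negP => h; apply: nOz; apply: O_cone => //.
  exists i0; split=> //; first by rewrite -cn_gt0; lra.
  by move=> j _; have := cn_le_nv z j; move: hz; rewrite /pd /= subr0; lra.
have [d [d0 hd]] := (open_nv U1).1 U1_open z Uz.
have [a ha] := holo_hdiff Eholo Uz.
apply: (@hdiff_differentiable _ _ _ _ a); apply: (hdiff_near d0 _ ha) => w /hd Uw.
by case: pselect => // Ow; exact/esym/Ef.
Qed.

End Hartogs.

(** * The envelope for one negative direction *)

Section Envelope.
Variables (R : realType) (n : nat).
Local Notation C := R[i].
Local Notation Cn := 'rV[C]_n.
Implicit Types (h v w z p : Cn) (f g : Cn -> C) (r M s : R).
Variables (i0 : 'I_n) (e : R) (e0 : 0 < e) (O : set Cn).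
Local Notation sc := (sc (pred1 i0)).
Hypothesis O_open : open O.

Let U' : set Cn := [set z | pd 0 e z /\ z 0 i0 != 0].
Let Om0 : set Cn := [set z | U' z /\ forall j, j != i0 -> cn (z 0 j) < 10 * cn (z 0 i0)].

Hypothesis O_sub : O `<=` U'.
Hypothesis O_cone : Om0 `<=` O.
Hypothesis O_sc : forall z (t : R), O z -> 0 <= t <= 1 -> O (sc t z).

Let sc_i0 t z : sc t z 0 i0 = z 0 i0.
Proof. by rewrite scE /= eqxx. Qed.

Let U'_open : open U'.
Proof.
apply/open_nv => z [hz z0]; have cz : 0 < cn (z 0 i0) by rewrite cn_gt0.
move: hz; rewrite /pd /= subr0 => hz.
exists (Num.min (e - nv z) (cn (z 0 i0))); split.
  by rewrite lt_min; apply/andP; split; lra.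
move=> w; rewrite lt_min => /andP[h1 h2]; split.
  by rewrite /pd /= subr0; have := nv_tri z w 0; rewrite !subr0; lra.
have := cn_le_nv (w - z) i0; rewrite !mxE -cn_gt0.
by have := cn_tri (w 0 i0) (z 0 i0) 0; rewrite !subr0 cnC; lra.
Qed.

Let Om0_open : open Om0.
Proof.
apply/open_nv => z [Uz hz]; have [r1 [r10 hr1]] := (open_nv U').1 U'_open z Uz.
have gap : exists d : R, 0 < d /\ forall j, j != i0 -> cn (z 0 j) + d <= 10 * cn (z 0 i0).
  have hj j : exists d : R, 0 < d /\ (j != i0 -> cn (z 0 j) + d <= 10 * cn (z 0 i0)).
    have [->|ji] := eqVneq j i0; first by exists 1.
    by exists (10 * cn (z 0 i0) - cn (z 0 j)); have := hz j ji; split; [|move=> _]; lra.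
  have [dj hdj] := choice hj.
  exists (\big[Num.min/1]_j dj j); split.
    by elim/big_ind : _ => // [x y x0 y0|j _]; [rewrite lt_min x0|have [] := hdj j].
  move=> j ji; have [_ /(_ ji)] := hdj j.
  have : \big[Num.min/1]_j dj j <= dj j by rewrite (bigD1 j)//= ge_min lexx.
  lra.
have [d [d0 hd]] := gap.
exists (Num.min r1 (d / 20)); split; first by rewrite lt_min r10 divr_gt0.
move=> w; rewrite lt_min => /andP[/hr1 Uw h2]; split=> // j ji.
have := cn_le_nv (w - z) i0; have := cn_le_nv (w - z) j; rewrite !mxE.
have := cn_tri (z 0 j) (w 0 j) 0; have := cn_tri (w 0 i0) (z 0 i0) 0.
rewrite !subr0 (cnC (z 0 i0)); have := hd j ji; lra.
Qed.

(** A neighbourhood of the segment from p to its contraction sc 0 p. *)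
Definition tube p r : set Cn := [set w | exists t, 0 <= t <= 1 /\ nv (w - sc t p) < r].

Lemma tube_open p r : open (tube p r).
Proof.
apply/open_nv => w [t [ht hw]]; exists (r - nv (w - sc t p)); split; first by lra.
by move=> x hx; exists t; split=> //; have := nv_tri w x (sc t p); lra.
Qed.

Lemma tube_pd p r t : 0 <= t <= 1 -> pd (sc t p) r `<=` tube p r.
Proof. by move=> ht w hw; exists t. Qed.

Lemma tube_center p r t : 0 < r -> 0 <= t <= 1 -> tube p r (sc t p).
Proof. by move=> r0 ht; apply: (tube_pd ht); exact: pd_center. Qed.

Lemma tube_shift p p' r s : nv (p' - p) + r <= s -> tube p' r `<=` tube p s.
Proof.
move=> hp w [t [ht hw]]; exists t; split=> //.
have := nv_tri (sc t p') w (sc t p); rewrite scB; have := nv_sc (pred1 i0) (p' - p) ht; lra.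
Qed.

Let unit_mul (s t : R) : 0 <= s <= 1 -> 0 <= t <= 1 -> 0 <= s * t <= 1.
Proof. by move=> /andP[s0 s1] /andP[t0 t1]; rewrite mulr_ge0//= mulr_ile1. Qed.

Lemma tube_sc p r t : 0 <= t <= 1 -> tube (sc t p) r `<=` tube p r.
Proof.
by move=> ht w [s [hs hw]]; exists (s * t); rewrite -sc_sc; split=> //; exact: unit_mul.
Qed.

Let I0 : 0 <= (0 : R) <= 1. Proof. by rewrite lexx ler01. Qed.
Let I1 : 0 <= (1 : R) <= 1. Proof. by rewrite lexx ler01. Qed.

(** The agreement with f is required on the cone Om0 only, which is contained in O
    and contains sc 0 p; this determines g at p. *)
Definition good p r f g := holomorphic_on (tube p r) g /\
  forall w, tube p r w -> Om0 w -> g w = f w.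

(** The points p to which all functions on O extend along the contraction of p.
    Keeping the whole segment in the definition makes the extension single-valued
    and the set stable under contraction. *)
Definition envelope : set Cn := [set p | exists r, [/\ 0 < r, tube p r `<=` U' &
  forall f, holomorphic_on O f -> exists g, good p r f g]].
Let V := envelope.

Lemma good_shift p p' r s f g : nv (p' - p) + r <= s -> good p s f g -> good p' r f g.
Proof.
move=> hp [hg1 hg2]; have sub := tube_shift hp.
by split; [exact: holoW sub hg1|move=> w /sub; exact: hg2].
Qed.

Lemma envelope_shift p p' r : (0 < r) -> tube p r `<=` U' ->
  (forall f, holomorphic_on O f -> exists g, good p r f g) ->
  nv (p' - p) < r / 2 -> V p' /\ tube p' (r / 2) `<=` U'.
Proof.
move=> r0 hU hf hp; have hp' : nv (p' - p) + r / 2 <= r by lra.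
have sub := tube_shift hp'.
split; last by move=> w /sub /hU.
exists (r / 2); split; [lra|by move=> w /sub /hU|].
by move=> f /hf[g hg]; exists g; exact: good_shift hg.
Qed.

Lemma envelope_open : open V.
Proof.
apply/open_nv => p [r [r0 hU hf]]; exists (r / 2); split; first by lra.
by move=> w hw; have [] := envelope_shift r0 hU hf hw.
Qed.

Lemma envelope_sub : V `<=` U'.
Proof. by move=> p [r [r0 hU _]]; apply: hU; rewrite -{2}(sc1 (pred1 i0) p); exact: tube_center. Qed.

Lemma envelope_sc p t : V p -> 0 <= t <= 1 -> V (sc t p).
Proof.
move=> [r [r0 hU hf]] ht; exists r; split=> //; first by move=> w /(tube_sc ht) /hU.
move=> f /hf[g [g1 g2]]; exists g; split; first exact: holoW (tube_sc ht) g1.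
by move=> w /(tube_sc ht); exact: g2.
Qed.

Let base_Om0 p r : 0 < r -> tube p r `<=` U' -> Om0 (sc 0 p).
Proof.
move=> r0 hU; have Up : U' (sc 0 p) by apply: hU; exact: tube_center.
split=> // j ji; rewrite scE /= (negbTE ji) rmorph0 mul0r cn0.
by case: Up => _; rewrite -cn_gt0; lra.
Qed.

Let Om0_sc z t : Om0 z -> 0 <= t <= 1 -> Om0 (sc t z).
Proof.
move=> [[hz z0] hj] ht; split.
  split; last by rewrite sc_i0.
  by move: hz; rewrite /pd /= !subr0; have := nv_sc (pred1 i0) z ht; lra.
move=> j ji; rewrite sc_i0 scE /= (negbTE ji) cnM cn_real.
have := hj j ji; have := cn_ge0 (z 0 j); case/andP: ht => t0 t1.
by rewrite ger0_norm//; nra.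
Qed.

(** Both extensions agree with f near sc 0 p, and the segment from there to p lies
    in both tubes. *)
Lemma good_unique p r r' f g g' : 0 < r -> 0 < r' -> tube p r `<=` U' ->
  good p r f g -> good p r' f g' -> g p = g' p.
Proof.
move=> r0 r'0 hU [g1 g2] [g1' g2'].
pose D := tube p r `&` tube p r'.
have oD : open D by apply: openI; exact: tube_open.
have hD : holomorphic_on D (fun w => g w - g' w).
  by apply: holoB; [apply: holoW g1|apply: holoW g1'] => w [].
have seg (t : R) : 0 <= t <= 1 -> D (sc 0 p + t%:C *: (p - sc 0 p)).
  by move=> ht; rewrite -sc_segment; split; exact: tube_center.
have B0 := base_Om0 r0 hU.
have [|d [d0 hd]] := identity_segment oD hD seg; last first.
  by apply/eqP; rewrite -subr_eq0; apply/eqP; apply: hd; exact: pd_center.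
have D0 : D (sc 0 p) by split; exact: tube_center.
have [d [d0 hd]] := (open_nv (D `&` Om0)).1 (openI oD Om0_open) _ (conj D0 B0).
exists d; split=> // x /hd[[h1 h2] h3].
by rewrite g2// g2'// subrr.
Qed.

Lemma O_tube p : O p -> exists r, 0 < r /\ tube p r `<=` O.
Proof.
move=> Op; have [s [s0 hs]] := path_thick O_open (fun s t => sc_lip_t (pred1 i0) s t p) (fun t ht => O_sc Op ht).
by exists s; split=> // w [t [ht hw]]; exact: (hs t ht).
Qed.

Lemma O_envelope : O `<=` V.
Proof.
move=> p Op; have [r [r0 hr]] := O_tube Op.
exists r; split=> //; first by move=> w /hr /O_sub.
by move=> f hf; exists f; split=> //; exact: holoW hr hf.
Qed.

(** F p is the value at p of any extension to a tube about p. *)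
Lemma extension f : holomorphic_on O f -> exists F,
  holomorphic_on V F /\ forall z, O z -> F z = f z.
Proof.
move=> hf.
have hex p : exists y : C, V p ->
    exists r g, [/\ 0 < r, tube p r `<=` U', good p r f g & y = g p].
  have [Vp|] := pselect (V p); last by exists 0.
  have [r [r0 hU h]] := Vp; have [g hg] := h f hf.
  by exists (g p) => _; exists r, g.
have [F hF] := choice hex.
exists F; split.
  move=> p Vp; have [r [r0 hU h]] := Vp; have [g hg] := h f hf.
  have r2 : 0 < r / 2 by lra.
  have tp : tube p r p by rewrite -{2}(sc1 (pred1 i0) p); exact: tube_center.
  have [a ha] := holo_hdiff hg.1 tp.
  apply: (@hdiff_differentiable _ _ _ _ a); apply: (hdiff_near r2 _ ha) => w hw.
  have [Vw tw] := envelope_shift r0 hU h hw.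
  have [r' [g' [r'0 hU' hg' ->]]] := hF w Vw.
  have hw' : nv (w - p) + r / 2 <= r by lra.
  by apply: (good_unique r'0 r2 hU' hg'); exact: good_shift hw' hg.
move=> p Op; have [r' [g' [r'0 hU' hg' ->]]] := hF p (O_envelope Op).
have [r [r0 hr]] := O_tube Op.
by apply: (good_unique r'0 r0 hU' hg'); split=> //; exact: holoW hr hf.
Qed.

(** Suppose that F has, about every point sc t p of the segment, a holomorphic
    continuation G t to the polydisc of radius rho. Those with neighbouring
    centres agree with F near the centres, hence with each other on the
    intersection of their polydiscs, which is convex. For two distant parameters t and t' and a common
    point w the centres in between are also within rho of w, so a chain of
    neighbouring centres connects them, and the G t define a function g on the
    tube of radius r1 <= rho. It agrees with f near sc 0 p, then near sc 0 w for
    every w in the tube, and finally along the contraction of w. *)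
Lemma glue F f p rho r1 : holomorphic_on O f -> holomorphic_on V F ->
  (forall z, O z -> F z = f z) -> V p -> 0 < r1 -> r1 <= rho -> tube p r1 `<=` U' ->
  (forall t, 0 <= t <= 1 -> exists g, holomorphic_on (pd (sc t p) rho) g /\
    forall s', 0 < s' -> pd (sc t p) s' `<=` V ->
      forall w, pd (sc t p) rho w -> pd (sc t p) (s' / 800) w -> g w = F w) ->
  exists g, good p r1 f g.
Proof.
move=> hf hF Ff Vp r10 r1rho hU hloc.
have rho0 : 0 < rho by lra.
have hex t : exists g, 0 <= t <= 1 -> holomorphic_on (pd (sc t p) rho) g /\
    forall s', 0 < s' -> pd (sc t p) s' `<=` V ->
      forall w, pd (sc t p) rho w -> pd (sc t p) (s' / 800) w -> g w = F w.
  have [ht|] := pselect (0 <= t <= 1); last by exists (fun _ => 0).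
  by have [g hg] := hloc t ht; exists g.
have [G hG] := choice hex.
have [s0 [s00 hs0]] := path_thick envelope_open (fun s t => sc_lip_t (pred1 i0) s t p) (fun t ht => envelope_sc Vp ht).
pose c := Num.min (s0 / 800) rho.
have c0 : 0 < c by rewrite lt_min; apply/andP; split; lra.
have [c1 c2] : c <= s0 / 800 /\ c <= rho by rewrite /c !ge_min !lexx orbT.
have GF t w : 0 <= t <= 1 -> pd (sc t p) c w -> G t w = F w.
  move=> ht hw; have [_ h] := hG t ht; apply: (h s0 s00 (hs0 t ht)).
    by move: hw; rewrite /pd /=; lra.
  by move: hw; rewrite /pd /=; lra.
have adj t t' w : 0 <= t <= 1 -> 0 <= t' <= 1 -> nv (sc t p - sc t' p) < c / 2 ->
    pd (sc t p) rho w -> pd (sc t' p) rho w -> G t w = G t' w.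
  move=> ht ht' htt hw hw'.
  pose D := pd (sc t p) rho `&` pd (sc t' p) rho.
  have oD : open D by apply: openI; exact: pd_open.
  have hD : holomorphic_on D (fun x => G t x - G t' x).
    by apply: holoB; [apply: holoW (hG t ht).1|apply: holoW (hG t' ht').1] => x [].
  have D0 : D (sc t' p).
    by split; [rewrite /pd /= nvC; lra|exact: pd_center].
  have seg (x : R) : 0 <= x <= 1 -> D (sc t' p + x%:C *: (w - sc t' p)).
    by move=> hx; case: D0 => h1 h2; split; exact: pd_convex.
  have [|d [d0 hd]] := identity_segment oD hD seg; last first.
    by apply/eqP; rewrite -subr_eq0; apply/eqP; apply: hd; exact: pd_center.
  exists (c / 2); split; first by lra.
  move=> x hx; rewrite !GF ?subrr//.
    by move: hx; rewrite /pd /=; lra.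
  move: hx; rewrite /pd /= => hx; have := nv_tri (sc t' p) x (sc t p); rewrite (nvC (sc t' p) (sc t p)); lra.
have chain t t' w : 0 <= t <= 1 -> 0 <= t' <= 1 ->
    pd (sc t p) rho w -> pd (sc t' p) rho w -> G t w = G t' w.
  move=> ht ht' hw hw'.
  pose N := (Num.truncn (nv p / (c / 2))).+1.
  have c2' : 0 < c / 2 by lra.
  have hN : nv p / (c / 2) < N%:R by exact: truncnS_gt.
  have N0 : 0 < N%:R :> R by rewrite ltr0n.
  pose x i : R := t + (t' - t) * (i%:R / N%:R).
  have hi i : (i <= N)%N -> 0 <= (i%:R / N%:R : R) <= 1.
    by move=> iN; rewrite divr_ge0//= ler_pdivrMr// mul1r ler_nat.
  have hx i : (i <= N)%N -> 0 <= x i <= 1.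
    by move=> /hi; exact: unit_interpolate.
  have hwx i : (i <= N)%N -> pd (sc (x i) p) rho w.
    move=> iN; have h1 : pd w rho (sc t p) by move: hw; rewrite /pd /= nvC.
    have h2 : pd w rho (sc t' p) by move: hw'; rewrite /pd /= nvC.
    have := pd_convex (hi i iN) h2 h1; rewrite /pd /= nvC.
    suff -> : sc t p + (i%:R / N%:R)%:C *: (sc t' p - sc t p) = sc (x i) p by [].
    exact: sc_interpolate.
  have hdist i : (i < N)%N -> nv (sc (x i) p - sc (x i.+1) p) < c / 2.
    move=> iN; apply: le_lt_trans (sc_lip_t _ _ _ _) _.
    have -> : x i - x i.+1 = (t - t') * N%:R^-1.
      by rewrite /x -[i.+1%:R]natr1; move: (i%:R) (N%:R^-1) => a b; ring.
    rewrite normrM (ger0_norm (_ : 0 <= N%:R^-1)) ?invr_ge0 ?ltW//.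
    have tt : `|t - t'| <= 1.
      by case/andP: ht => t0 t1; case/andP: ht' => t0' t1'; rewrite ler_norml; lra.
    apply: (@le_lt_trans _ _ (nv p * N%:R^-1)).
      by rewrite ler_wpM2l ?nv_ge0// ler_piMl// invr_ge0 ltW.
    by rewrite ltr_pdivrMr// mulrC -ltr_pdivrMr.
  have all i : (i <= N)%N -> G t w = G (x i) w.
    elim: i => [|i IH] iN; first by rewrite /x mul0r mulr0 addr0.
    rewrite IH 1?ltnW//; apply: adj; [exact: hx (ltnW iN)|exact: hx iN|exact: hdist|exact: hwx (ltnW iN)|exact: hwx].
  have := all N (leqnn _); rewrite /x divff ?gt_eqF// mulr1 addrC subrK//.
have hex2 w : exists t, tube p r1 w -> 0 <= t <= 1 /\ nv (w - sc t p) < r1.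
  have [[t ht]|] := pselect (tube p r1 w); last by exists 0.
  by exists t.
have [T hT] := choice hex2.
pose g w := G (T w) w.
have gE t w : 0 <= t <= 1 -> pd (sc t p) r1 w -> g w = G t w.
  move=> ht hw; have [h1 h2] := hT w (tube_pd ht hw).
  apply: chain => //; rewrite /pd /=; first by lra.
  by move: hw; rewrite /pd /=; lra.
have hg : holomorphic_on (tube p r1) g.
  move=> w hw; have [ht hwt] := hT w hw.
  have hgt : holomorphic_on (pd (sc (T w) p) r1) g.
    apply: (@holo_near _ _ g (G (T w)) _ (@pd_open R n _ _)) => [x|]; first exact: gE.
    by apply: holoW (hG _ ht).1 => x; rewrite /pd /=; lra.
  by apply: hgt.
exists g; split=> // w hw Ow.
have [ht hwt] := hT w hw; set t := T w in ht hwt.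
pose D := tube p r1 `&` Om0.
have oD : open D by exact: openI (@tube_open _ _) Om0_open.
have hD : holomorphic_on D (fun x => g x - f x).
  by apply: holoB; [apply: holoW hg|apply: holoW hf] => x [] // _ /O_cone.
have near0 : exists d : R, 0 < d /\ forall x, pd (sc 0 p) d x -> g x - f x = 0.
  have B0 := base_Om0 r10 hU.
  have [d [d0 hd]] := (open_nv Om0).1 Om0_open _ B0.
  exists (Num.min d (Num.min c r1)); split; first by rewrite lt_min d0 /= lt_min c0.
  move=> x; rewrite /pd /= lt_min => /andP[/hd /O_cone Ox].
  rewrite lt_min => /andP[h2 h3].
  by rewrite (gE 0 x I0 h3) GF// Ff// subrr.
have w0 : pd (sc 0 p) r1 (sc 0 w).
  rewrite /pd /= (_ : sc 0 p = sc 0 (sc t p)); last by rewrite sc_sc mul0r.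
  by rewrite scB; apply: le_lt_trans hwt; exact: nv_sc.
have seg1 (x : R) : 0 <= x <= 1 -> D (sc 0 p + x%:C *: (sc 0 w - sc 0 p)).
  move=> hx; have h1 : tube p r1 (sc 0 p + x%:C *: (sc 0 w - sc 0 p)).
    by apply: (tube_pd I0); apply: pd_convex => //; exact: pd_center.
  split=> //; split; first exact: hU.
  move=> j ji; have -> : (sc 0 p + x%:C *: (sc 0 w - sc 0 p)) 0 j = 0.
    by rewrite !mxE /= (negbTE ji) rmorph0 !mul0r subrr mulr0 addr0.
  by case: (hU _ h1) => _; rewrite cn0 -cn_gt0; lra.
have near1 := identity_segment oD hD seg1 near0.
have seg2 (x : R) : 0 <= x <= 1 -> D (sc 0 w + x%:C *: (w - sc 0 w)).
  move=> hx; rewrite -sc_segment; split; last exact: Om0_sc.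
  exists (x * t); split; first exact: unit_mul.
  by rewrite -sc_sc scB; apply: le_lt_trans hwt; exact: nv_sc.
have [d [d0 hd]] := identity_segment oD hD seg2 near1.
by apply/eqP; rewrite -subr_eq0; apply/eqP; apply: hd; exact: pd_center.
Qed.

Lemma compact_add (K L : set Cn) : compact K -> compact L ->
  compact [set x | exists p q, [/\ K p, L q & x = p + q]].
Proof.
move=> cK cL; have -> : [set x | exists p q, [/\ K p, L q & x = p + q]] =
    (fun y : Cn * Cn => y.1 + y.2) @` (K `*` L).
  apply/seteqP; split=> [x [p [q [Kp Lq ->]]]|x [[p q] [/= Kp Lq] <-]].
    by exists (p, q).
  by exists p, q.
apply: continuous_compact; last exact: compact_setX.
by apply: continuous_subspaceT => x; exact: add_continuous.
Qed.

(** The argument of Cartan and Thullen. Let p be in the hull of a compact set K,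
    and F holomorphic on V. For each t, the Taylor forms of F at sc t z are
    holomorphic functions of z in V, and they satisfy Cauchy estimates on K with
    a radius s common to all t, since the contractions of K form a compact set.
    The hull transports these bounds to p, so the Taylor series of F at all
    points sc t p converge on polydiscs of a fixed radius. Glued together they
    extend F to a tube about p whose radius does not depend on p. The coordinates
    and 1 / z_i0 keep the hull away from the boundary of U'. *)
Lemma envelope_Stein : Stein V.
Proof.
have e_gt0 := e0.
apply: Stein_crit; first exact: envelope_open.
move=> K cK KV.
have Ke : K `<=` pd 0 e by move=> z /KV /envelope_sub[].
have [d1 [d10 d1e hd1]] := compact_in_pd e_gt0 cK Ke.
have hinv : holomorphic_on V (fun z => (z 0 i0)^-1).
  move=> z Vz; have [_ z0] := envelope_sub Vz.
  by apply: differentiableV => //; exact: differentiable_coord.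
have [M1 [M10 hM1]] := holo_compact_bounded cK KV hinv.
pose d2 := (1 + M1)^-1.
have d20 : 0 < d2 by rewrite invr_gt0; lra.
have hull_bd p : holomorphic_hull V K p -> nv p <= e - d1 /\ d2 <= cn (p 0 i0).
  move=> /hullP[Vp hp]; split.
    apply: nv_le => [|j]; first by lra.
    apply: (hp (fun z => z 0 j)) => [|w Kw]; first exact: holo_coord.
    exact: le_trans (cn_le_nv _ _) (hd1 w Kw).
  have := hp _ hinv M1 hM1; have [_ z0] := envelope_sub Vp.
  have c0 : 0 < cn (p 0 i0) by rewrite cn_gt0.
  rewrite cnV -div1r ler_pdivrMr// => h.
  by rewrite /d2 -div1r ler_pdivrMr; lra.
pose K1 : set Cn := [set w | exists t z, [/\ 0 <= t <= 1, K z & w = sc t z]].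
have cK1 : compact K1 by exact: compact_sc.
have K1V : K1 `<=` V by move=> _ [t [z [ht /KV Vz ->]]]; exact: envelope_sc.
have [s [s0 hs]] := compact_thick cK1 envelope_open K1V.
have s2 : 0 < s / 2 by lra.
pose K2 : set Cn := [set x | exists p q, [/\ K1 p, nv (q - 0) <= s / 2 & x = p + q]].
have cK2 : compact K2 by exact: (compact_add cK1 (@cpd_compact R n 0 _ (ltW s2))).
have K2V : K2 `<=` V.
  move=> _ [p [q [K1p hq ->]]]; apply: (hs p K1p).
  by rewrite /pd /= addrAC subrr add0r; move: hq; rewrite subr0; lra.
pose rho := s / 2 / 400.
have rho0 : 0 < rho by rewrite /rho; lra.
pose r1 := Num.min rho (Num.min d1 d2 / 2).
have [m1 m2] : Num.min d1 d2 <= d1 /\ Num.min d1 d2 <= d2 by rewrite !ge_min !lexx orbT.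
have m0 : 0 < Num.min d1 d2 by rewrite lt_min d10.
have [r1a r1b] : r1 <= rho /\ r1 <= Num.min d1 d2 / 2 by rewrite /r1 !ge_min !lexx orbT.
have r10 : 0 < r1 by rewrite lt_min rho0; lra.
exists (r1 / 2); split; first by lra.
move=> p hp; have [b1 b2] := hull_bd p hp.
have /hullP[Vp hullp] := hp.
have tU : tube p r1 `<=` U'.
  move=> w [t [ht hw]]; split.
    rewrite /pd /= subr0; have := nv_tri (sc t p) w 0; rewrite !subr0.
    by have := nv_sc (pred1 i0) p ht; lra.
  have := cn_le_nv (w - sc t p) i0; rewrite 2!mxE sc_i0.
  by have := cn_tri (w 0 i0) (p 0 i0) 0; rewrite !subr0 cnC -cn_gt0; lra.
have hgood f : holomorphic_on O f -> exists g, good p r1 f g.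
  move=> hf; have [F [hF Ff]] := extension hf.
  apply: (glue hf hF Ff Vp r10 r1a tU) => t ht.
  have [M [M0 hM]] := holo_compact_bounded cK2 K2V hF.
  apply: (tay_extension envelope_open hF s2 M0) => k v.
  have hT : holomorphic_on V (fun w => tay k F v (sc t w)).
    apply: (holo_sc _ (tay_holo k v envelope_open hF)) => z Vz; exact: envelope_sc.
  apply: (hullp _ hT) => w Kw.
  have K1w : K1 (sc t w) by exists t, w.
  have sub : pd (sc t w) (s / 2) `<=` K2.
    move=> x hx; exists (sc t w), (x - sc t w); split=> //; last by rewrite addrC subrK.
    by rewrite subr0; exact: ltW.
  apply: (tay_estimate k v envelope_open hF s2) => x /sub; [exact: K2V|exact: hM].
by move=> w hw; have [] := envelope_shift r10 tU hgood hw.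
Qed.

End Envelope.

(** * Extension and Stein envelopes for cone-like sets *)

Section Core.
Variables (R : realType) (n : nat).
Local Notation C := R[i].
Local Notation Cn := 'rV[C]_n.

(** With at least two negative directions every function extends to the whole
    polydisc. With only one, i0, the function 1 / z_i0 does not, and the set V
    is the envelope constructed above. *)
Lemma core_extension (N : pred 'I_n) (e : R) (O : set Cn) : 0 < e -> open O ->
  O `<=` pd 0 e -> (exists i, N i) ->
  (forall z, pd 0 e z -> (exists i, [/\ N i, z 0 i != 0 &
      forall j, ~~ N j -> cn (z 0 j) < 10 * cn (z 0 i)]) -> O z) ->
  (forall z, O z -> exists i, N i /\ z 0 i != 0) ->
  (forall z (t : R), O z -> 0 <= t <= 1 -> O (sc N t z)) ->
  exists V, [/\ Stein V, O `<=` V, V `<=` pd 0 e &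
    forall f, holomorphic_on O f -> exists g, holomorphic_on V g /\
      forall z, O z -> g z = f z].
Proof.
move=> e0 oO Oe [i0 Ni0] Ocone On0 Osc.
have [[i1 [i10 Ni1]]|none] := pselect (exists i1, i1 != i0 /\ N i1).
  exists (pd 0 e); split=> //; first exact: pd_Stein.
  move=> f; exact: (hartogs_extension e0 oO Ocone Osc Ni0 Ni1 i10).
have NE : N = pred1 i0.
  apply/funext => i /=; have [->|ii0] := eqVneq i i0; first by rewrite Ni0.
  by apply/negbTE/negP => Ni; apply: none; exists i.
rewrite {}NE in Ni0 Ocone On0 Osc.
have O_sub : O `<=` [set z | pd 0 e z /\ z 0 i0 != 0].
  by move=> z Oz; split; [exact: Oe|have [i [/eqP <-]] := On0 z Oz].
have O_cone : [set z | ([set z | pd 0 e z /\ z 0 i0 != 0] z) /\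
    forall j, j != i0 -> cn (z 0 j) < 10 * cn (z 0 i0)] `<=` O.
  by move=> z [[hz z0] hj]; apply: Ocone => //; exists i0; rewrite /= eqxx.
exists (envelope i0 e O); split.
- exact: (@envelope_Stein R n i0 e e0 O oO O_sub O_cone Osc).
- exact: (@O_envelope R n i0 e O oO O_sub Osc).
- by move=> z /envelope_sub[].
- by move=> f /(@extension R n i0 e O oO O_sub Osc).
Qed.

End Core.

(** * Real differential calculus *)

Section RealTaylor.
Variables (R : realType) (m : nat).
Local Notation Rm := 'rV[R]_m.
Implicit Types (f g : Rm -> R) (x y p h v : Rm) (D : set Rm).

Lemma coord_le_norm h j : `|h 0 j| <= `|h|.
Proof.
rewrite [leRHS](_ : _ = mx_norm h)// mx_normrE.
exact: (@le_bigmax _ _ _ _ (fun i : 'I_1 * 'I_m => `|h i.1 i.2|) (0, j)).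
Qed.

Lemma norm_le_coord h M : 0 <= M -> (forall j, `|h 0 j| <= M) -> `|h| <= M.
Proof.
move=> M0 hM; rewrite (_ : `|h| = mx_norm h)// mx_normrE; apply/bigmax_leP; split=> // -[i j] _ /=.
by rewrite ord1.
Qed.

Lemma nbhs_norm p (A : set Rm) : nbhs p A <-> exists r : R, 0 < r /\ forall y, `|y - p| < r -> A y.
Proof.
split=> [/nbhs_ballP[r /= r0 rA]|[r [r0 rA]]].
  by exists r; split=> // y yp; apply: rA; rewrite -ball_normE /= distrC.
apply/nbhs_ballP; exists r => //= y; rewrite -ball_normE /= distrC; exact: rA.
Qed.

Lemma derivable_rdiff g x v : derivable g x v -> rdiff (fun s => g (x + s *: v)) 0 ('D_v g x).
Proof.
move=> hd e e0.
have key : (fun h : R => h^-1 *: ((g \o shift x) (h *: v) - g x)) @ 0^' --> 'D_v g x := hd.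
have /cvgrPdist_le/(_ e e0)/nbhs_ballP[r /= r0 hr] := key.
exists (r / 2); split=> [|s sr]; first by lra.
rewrite scale0r addr0 add0r.
have [->|s0] := eqVneq s 0; first by rewrite scale0r addr0 subrr mulr0 subrr normr0 mulr0.
have := hr s; rewrite -ball_normE /= sub0r normrN => /(_ ltac:(lra) s0).
rewrite distrC -ler_pdivrMr ?normr_gt0// -normfV -normrM.
suff -> : s^-1 *: (g (s *: v + x) - g x) - 'D_v g x = (g (x + s *: v) - g x - 'D_v g x * s) / s by [].
by rewrite (addrC x) /GRing.scale /=; field.
Qed.

Lemma rdiff_shift (k : R -> R) t b : rdiff (fun s => k (t + s)) 0 b <-> rdiff k t b.
Proof.
split=> h e e0; have [d [d0 hd]] := h e e0; exists d; split=> // s /hd.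
  by rewrite add0r addr0.
by rewrite add0r addr0.
Qed.

Lemma rdiff_scale (k : R -> R) (c b : R) : rdiff k 0 b -> rdiff (fun s => k (c * s)) 0 (c * b).
Proof.
move=> h e e0.
have [d [d0 hd]] := h (e / (1 + `|c|)) ltac:(by rewrite divr_gt0//; have := normr_ge0 c; lra).
have c1 : 0 < 1 + `|c| by have := normr_ge0 c; lra.
exists (d / (1 + `|c|)); split=> [|s]; first by rewrite divr_gt0.
rewrite ler_pdivlMr// => hs.
have cs : `|c * s| <= `|s| * (1 + `|c|).
  by rewrite normrM mulrC ler_wpM2l//; lra.
have := hd _ (le_trans cs hs); rewrite !add0r mulr0 => hh.
rewrite (_ : c * b * s = b * (c * s)); last by ring.
apply: le_trans hh _; apply: le_trans (ler_wpM2l _ cs) _.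
  by rewrite divr_ge0// ltW.
by rewrite (mulrC `|s|) mulrA divfK// gt_eqF.
Qed.

Lemma rdiff_lin (b t : R) : rdiff (fun s => b * s) t b.
Proof.
move=> e e0; exists 1; split=> // s _.
have -> : b * (t + s) - b * t - b * s = 0 by ring.
by rewrite normr0 mulr_ge0// ltW.
Qed.

Lemma rdiff_bound (k : R -> R) (B : R) :
  (forall s, 0 <= s <= 1 -> exists b, rdiff k s b /\ `|b| <= B) -> `|k 1 - k 0| <= B.
Proof.
move=> h.
have half (u : R) : u = 1 \/ u = -1 -> u * (k 1 - k 0) <= B.
  move=> hu.
  have : u * k 1 + (- B) * 1 <= u * k 0 + (- B) * 0.
    apply: (@rdiff_mvt R (fun s => u * k s + (- B) * s)) => // s hs.
    have [b [hb hB]] := h s hs.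
    have hub : rdiff (fun s => u * k s) s (u * b).
      move=> e e0; have [d [d0 hd]] := hb e e0; exists d; split=> // x /hd.
      rewrite (_ : u * k (s + x) - _ - _ = u * (k (s + x) - k s - b * x)); last by ring.
      by rewrite normrM; case: hu => ->; rewrite ?normrN normr1 mul1r.
    exists (u * b + (- B)); split; first exact: rdiffD hub (rdiff_lin _ _).
    by case: hu => ->; move: hB; rewrite ler_norml => /andP[]; lra.
  lra.
have := half 1 (or_introl erefl); have := half (-1) (or_intror erefl).
by rewrite ler_norml; lra.
Qed.

Definition lin (a h : Rm) : R := \sum_j a 0 j * h 0 j.

Lemma linD (a h v : Rm) : lin a (h + v) = lin a h + lin a v.
Proof. by rewrite /lin -big_split; apply: eq_bigr => j _; rewrite mxE mulrDr. Qed.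
Lemma linZ (a : Rm) (c : R) (h : Rm) : lin a (c *: h) = c * lin a h.
Proof. by rewrite /lin mulr_sumr; apply: eq_bigr => j _; rewrite mxE mulrCA. Qed.
Lemma lin0 (a : Rm) : lin a 0 = 0.
Proof. by rewrite -(scale0r 0) linZ mul0r. Qed.
Lemma lin_delta (a : Rm) j : lin a (delta_mx 0 j) = a 0 j.
Proof.
rewrite /lin (bigD1 j)//= mxE !eqxx mulr1 big1 ?addr0// => k kj.
by rewrite mxE (negbTE kj) andbF mulr0.
Qed.
Lemma lin_bound (a h : Rm) (E : R) : (forall j, `|a 0 j| <= E) -> `|lin a h| <= m%:R * E * `|h|.
Proof.
move=> hE; apply: le_trans (ler_norm_sum _ _ _) _.
apply: (@le_trans _ _ (\sum_(j < m) E * `|h|)).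
  by apply: ler_sum => j _; rewrite normrM ler_pM// coord_le_norm.
by rewrite sumr_const card_ord -mulrA mulr_natl.
Qed.

Definition rgrad f x : Rm := \row_j partial j f x.

Definition rhd f p (a : Rm) := forall eta : R, 0 < eta -> exists delta : R, 0 < delta /\
  forall h, `|h| <= delta -> `|f (p + h) - f p - lin a h| <= eta * `|h|.

(** The increment is split along the points hk k, which keep the first k
    coordinates of h; each step is a mean value estimate in one coordinate. *)
Lemma C1_rhd f p : (exists r : R, 0 < r /\ forall x i, `|x - p| < r -> derivable f x (delta_mx 0 i)) ->
  (forall i, {for p, continuous (partial i f)}) -> rhd f p (rgrad f p).
Proof.
move=> [r [r0 hr]] hc eta eta0.
pose eta' := eta / (1 + m%:R).
have m0 : 0 <= m%:R :> R by [].
have eta'0 : 0 < eta' by rewrite divr_gt0//; lra.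
have hci i : exists d : R, 0 < d /\ forall y, `|y - p| < d -> `|partial i f y - partial i f p| <= eta'.
  have /cvgrPdist_le/(_ eta' eta'0)/nbhs_norm[d [d0 hd]] := hc i.
  by exists d; split=> // y /hd; rewrite distrC.
have [di hdi] := choice hci.
pose d0 := \big[Num.min/r]_i di i.
have d00 : 0 < d0.
  by rewrite /d0; elim/big_ind : _ => // [x y x0 y0|i _]; [rewrite lt_min x0|have [] := hdi i].
have d0i i : d0 <= di i by rewrite /d0 (bigD1 i)//= ge_min lexx.
have d0r : d0 <= r.
  rewrite /d0; elim/big_rec : _ => // i x _ xr; by rewrite ge_min xr orbT.
exists (d0 / 2); split=> [|h hh]; first by lra.
pose hk (k : nat) : Rm := \row_j (if (j < k)%N then h 0 j else 0).
have nk k (t : R) (i : 'I_m) : 0 <= t <= 1 -> i = k :> nat -> `|hk k + (t * h 0 i) *: delta_mx 0 i| <= `|h|.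
  move=> /andP[t0 t1] ik; apply: norm_le_coord => // j; rewrite !mxE eqxx /=.
  have hj := coord_le_norm h j.
  have [->|ji] := eqVneq j i.
    rewrite ik ltnn add0r mulr1 normrM ger0_norm//; apply: le_trans (coord_le_norm h i).
    by rewrite ler_piMl.
  by rewrite mulr0 addr0; case: ifP => // _; rewrite normr0.
have step (i : 'I_m) : `|f (p + hk i.+1) - f (p + hk i) - partial i f p * h 0 i| <= eta' * `|h|.
  pose k t := f (p + hk i + t *: (h 0 i *: delta_mx 0 i)) + (- (partial i f p * h 0 i)) * t.
  have hkS : hk i.+1 = hk i + h 0 i *: delta_mx 0 i.
    apply/rowP => j; rewrite !mxE eqxx /= ltnS leq_eqVlt.
    have [->|ji] := eqVneq j i; first by rewrite eqxx ltnn add0r mulr1.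
    by rewrite (_ : (_ == _) = false) ?mulr0 ?addr0//; apply/negbTE.
  have E1 : k 1 = f (p + hk i.+1) - partial i f p * h 0 i.
    by rewrite /k scale1r mulr1 -addrA -hkS.
  have E0 : k 0 = f (p + hk i) by rewrite /k scale0r addr0 mulr0 addr0.
  have -> : f (p + hk i.+1) - f (p + hk i) - partial i f p * h 0 i = k 1 - k 0.
    by rewrite E1 E0; ring.
  apply: rdiff_bound => s hs; set x := p + hk i + s *: (h 0 i *: delta_mx 0 i).
  have xp : `|x - p| <= `|h|.
    rewrite /x -(addrA p) [_ - p]addrC addKr scalerA; exact: nk.
  have xd : `|x - p| < d0 by lra.
  have dx := hr x i (lt_le_trans xd d0r).
  have h1 := rdiff_scale (h 0 i) (derivable_rdiff dx).
  exists (h 0 i * partial i f x + (- (partial i f p * h 0 i))); split.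
    apply: rdiffD; last exact: rdiff_lin.
    apply/rdiff_shift; move: h1; apply: iffLR.
    suff -> : (fun s0 => f (x + (h 0 i * s0) *: delta_mx 0 i)) =
      (fun s0 => f (p + hk i + (s + s0) *: (h 0 i *: delta_mx 0 i))) by [].
    apply/funext => s0; congr f; rewrite /x scalerDl -!addrA; congr (_ + (_ + (_ + _))).
    by rewrite scalerA mulrC.
  rewrite (_ : _ + _ = h 0 i * (partial i f x - partial i f p)); last by ring.
  rewrite normrM mulrC ler_pM//; last exact: coord_le_norm.
  have [_ h2] := hdi i; apply: h2; exact: lt_le_trans xd (d0i i).
have all k : (k <= m)%N -> `|f (p + hk k) - f p - lin (rgrad f p) (hk k)| <= k%:R * (eta' * `|h|).
  elim: k => [|k IH] km.
    have -> : hk 0%N = 0 by apply/rowP => j; rewrite !mxE.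
    by rewrite addr0 subrr mul0r lin0 subrr normr0.
  pose i := Ordinal km.
  have hkS : hk k.+1 = hk k + h 0 i *: delta_mx 0 i.
    apply/rowP => j; rewrite !mxE eqxx /= ltnS leq_eqVlt.
    have [->|ji] := eqVneq j i; first by rewrite eqxx ltnn add0r mulr1.
    by rewrite (_ : (_ == _) = false) ?mulr0 ?addr0//; apply/negbTE.
  have := step i; have := IH (ltnW km); rewrite /= => h1 h2.
  rewrite hkS linD linZ lin_delta mxE -hkS -[k.+1%:R]natr1 mulrDl mul1r.
  rewrite (_ : _ - _ - _ = (f (p + hk k) - f p - lin (rgrad f p) (hk k)) +
     (f (p + hk k.+1) - f (p + hk k) - partial i f p * h 0 i)); last by ring.
  exact: le_trans (ler_normD _ _) (lerD h1 h2).
have hm : hk m = h by apply/rowP => j; rewrite !mxE ltn_ord.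
have := all m (leqnn _); rewrite hm => /le_trans; apply.
rewrite mulrA ler_wpM2r// /eta' mulrA ler_pdivrMr; last by lra.
by rewrite mulrC ler_wpM2l ?(ltW eta0)//; lra.
Qed.

Lemma rhd_line f (x0 v : Rm) (t : R) (a : Rm) : rhd f (x0 + t *: v) a -> rdiff (fun s => f (x0 + s *: v)) t (lin a v).
Proof.
move=> h e e0.
have v1 : 0 < 1 + `|v| by have := normr_ge0 v; lra.
have [d [d0 hd]] := h (e / (1 + `|v|)) ltac:(by rewrite divr_gt0).
exists (d / (1 + `|v|)); split=> [|s]; first by rewrite divr_gt0.
rewrite ler_pdivlMr// => hs.
have sv : `|s *: v| <= `|s| * (1 + `|v|) by rewrite normrZ ler_wpM2l//; lra.
have := hd _ (le_trans sv hs); rewrite linZ -(addrA x0) -scalerDl (mulrC s) => hh.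
apply: le_trans hh _; apply: le_trans (ler_wpM2l _ sv) _; first by rewrite divr_ge0// ltW.
by rewrite (mulrC `|s|) mulrA divfK// gt_eqF.
Qed.

End RealTaylor.

(** * Taylor expansion of order two *)

Section SecondOrder.
Variables (R : realType) (m : nat).
Local Notation Rm := 'rV[R]_m.
Implicit Types (f g : Rm -> R) (x y p h v : Rm) (D : set Rm).

Lemma smooth_partial D f i : smooth_on D f -> smooth_on D (partial i f).
Proof. by move=> hf k; have [_ /(_ i)[]] := hf k.+1. Qed.

Lemma smooth_rhd D f x : open D -> smooth_on D f -> D x -> rhd f x (rgrad f x).
Proof.
move=> oD hf Dx; apply: C1_rhd.
  have /nbhs_norm[r [r0 hr]] : nbhs x D by apply: open_nbhs_nbhs.
  exists r; split=> // y i /hr Dy.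
  by have [_ /(_ i)[h _]] := hf 1%N; exact: h.
by move=> i; have [h _] := smooth_partial i hf 0%N; exact: h.
Qed.

Variables (D : set Rm) (f : Rm -> R).
Hypothesis (oD : open D) (D0 : D 0) (hf : smooth_on D f) (hc : critical_point f 0).
Let A := hessian f 0.
Definition bil x v : R := (x *m A *m v^T) 0 0.

Lemma bilE x v : bil x v = \sum_j (x *m A) 0 j * v 0 j.
Proof. by rewrite /bil mxE; apply: eq_bigr => j _; rewrite [v^T _ _]mxE. Qed.

Lemma grad_expansion (eta : R) : 0 < eta -> exists delta : R, 0 < delta /\
  forall x, `|x| <= delta -> D x /\ forall j, `|partial j f x - (x *m A) 0 j| <= eta * `|x|.
Proof.
move=> eta0.
have /nbhs_norm[r [r0 hr]] : nbhs (0 : Rm) D by apply: open_nbhs_nbhs.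
have hj j : exists d : R, 0 < d /\ forall x, `|x| <= d -> `|partial j f x - (x *m A) 0 j| <= eta * `|x|.
  have [d [d0 hd]] := smooth_rhd oD (smooth_partial j hf) D0 eta0.
  exists d; split=> // x /hd; rewrite add0r hc subr0.
  suff -> : lin (rgrad (partial j f) 0) x = (x *m A) 0 j by [].
  by rewrite /lin mxE; apply: eq_bigr => i _; rewrite !mxE mulrC.
have [dj hdj] := choice hj.
pose d := \big[Num.min/r]_j dj j.
have d0 : 0 < d.
  by rewrite /d; elim/big_ind : _ => // [x y x0 y0|i _]; [rewrite lt_min x0|have [] := hdj i].
have ddj j : d <= dj j by rewrite /d (bigD1 j)//= ge_min lexx.
have dr : d <= r.
  by rewrite /d; elim/big_rec : _ => // i x _ xr; rewrite ge_min xr orbT.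
exists (d / 2); split=> [|x hx]; first by lra.
split; first by apply: hr; rewrite subr0; lra.
by move=> j; have [_ h] := hdj j; apply: h; have := ddj j; lra.
Qed.

(** The derivative of f along a line is the polarisation of its quadratic part, up
    to an error that is small relative to the product of the two lengths. *)
Lemma line_derivative (eta : R) : 0 < eta -> exists delta : R, 0 < delta /\
  forall (x0 v : Rm) (t : R), `|x0 + t *: v| <= delta ->
    exists b, rdiff (fun s => f (x0 + s *: v)) t b /\
      `|b - bil (x0 + t *: v) v| <= eta * `|x0 + t *: v| * `|v|.
Proof.
move=> eta0; have m0 : 0 <= m%:R :> R by [].
have [d [d0 hd]] := grad_expansion (divr_gt0 eta0 (ltr_wpDr m0 ltr01)).
exists d; split=> // x0 v t hx; have [Dx hg] := hd _ hx; set x := x0 + t *: v in hx Dx hg *.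
exists (lin (rgrad f x) v); split; first exact: rhd_line (smooth_rhd oD hf Dx).
have -> : lin (rgrad f x) v - bil x v = lin (rgrad f x - x *m A) v.
  rewrite bilE /lin -sumrB; apply: eq_bigr => j _.
  by rewrite [(rgrad f x - x *m A) 0 j]mxE [(- (x *m A)) 0 j]mxE mulrBl.
apply: (@le_trans _ _ (m%:R * (eta / (1 + m%:R) * `|x|) * `|v|)).
  apply: lin_bound => j; have := hg j.
  by rewrite [(rgrad f x - x *m A) 0 j]mxE [(- (x *m A)) 0 j]mxE [rgrad f x 0 j]mxE.
rewrite ler_wpM2r// mulrA ler_wpM2r// mulrCA ler_piMr ?(ltW eta0)//.
by rewrite ler_pdivrMr; lra.
Qed.

Lemma bilDr x v w : bil x (v + w) = bil x v + bil x w.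
Proof. by rewrite !bilE -big_split; apply: eq_bigr => j _; rewrite [(v + w) 0 j]mxE mulrDr. Qed.
Lemma bilDl x y v : bil (x + y) v = bil x v + bil y v.
Proof. by rewrite /bil mulmxDl mulmxDl mxE. Qed.
Lemma bilZl (c : R) x v : bil (c *: x) v = c * bil x v.
Proof. by rewrite /bil -scalemxAl -scalemxAl mxE. Qed.
Lemma taylor2E x : taylor2 f 0 x = 2^-1 * bil x x.
Proof. by []. Qed.

(** Integration of line_derivative along the segment from 0 to x. *)
Lemma taylor2_expansion (eta : R) : 0 < eta -> exists delta : R, 0 < delta /\
  forall x, `|x| <= delta -> `|f x - f 0 - taylor2 f 0 x| <= eta * `|x| ^+ 2.
Proof.
move=> eta0; have [d [d0 hd]] := line_derivative eta0; exists d; split=> // x hx.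
pose k t := f (0 + t *: x) + (- bil x x) * t ^+ 2 / 2.
have E1 : k 1 = f x - taylor2 f 0 x.
  by rewrite /k scale1r add0r taylor2E expr1n mulr1 mulNr (mulrC (bil x x)).
have E0 : k 0 = f 0 by rewrite /k scale0r add0r expr0n /= mulr0 mul0r addr0.
have -> : f x - f 0 - taylor2 f 0 x = k 1 - k 0 by rewrite E1 E0; ring.
apply: rdiff_bound => t /andP[t0 t1].
have nx : `|0 + t *: x| <= `|x| by rewrite add0r normrZ ger0_norm// ler_piMl.
have [b [hb hbb]] := hd 0 x t (le_trans nx hx).
exists (b + (- bil x x) * t ^+ 1); split; first exact: rdiffD hb (rdiff_power _ 1 t).
move: hbb; rewrite {1}add0r bilZl expr1 (_ : b - t * bil x x = b + - bil x x * t); last by ring.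
move=> /le_trans; apply; rewrite expr2 mulrA ler_wpM2r// ler_wpM2l// ltW//.
Qed.

(** The second difference of f over the parallelogram spanned by s e_k and s e_l is
    symmetric in k and l, and equals s^2 A k l up to o(s^2). *)
Lemma hessian_sym : A^T = A.
Proof.
apply/matrixP => i j; rewrite mxE.
have nd (k : 'I_m) : `|delta_mx 0 k : Rm| <= 1.
  by apply: norm_le_coord => // l; rewrite mxE eqxx /=; case: (l == k); rewrite ?normr1 ?normr0.
have key k l (eta s : R) : 0 < eta -> 0 < s ->
    (forall x, `|x| <= 2 * s -> D x /\ forall j, `|partial j f x - (x *m A) 0 j| <= eta * `|x|) ->
    `|f (s *: delta_mx 0 k + s *: delta_mx 0 l) - f (s *: delta_mx 0 k) - f (s *: delta_mx 0 l) + f 0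
      - s ^+ 2 * A k l| <= 3 * eta * s ^+ 2.
  move=> eta0 s0 hs.
  pose ek : Rm := delta_mx 0 k; pose el : Rm := delta_mx 0 l.
  pose K t := f (s *: ek + t *: (s *: el)) + (-1) * f (0 + t *: (s *: el)) + (- (s ^+ 2 * A k l)) * t.
  have E : f (s *: ek + s *: el) - f (s *: ek) - f (s *: el) + f 0 - s ^+ 2 * A k l = K 1 - K 0.
    by rewrite /K !scale1r !scale0r !add0r addr0; ring.
  rewrite E; apply: rdiff_bound => t /andP[t0 t1].
  have nel : `|t *: (s *: el)| <= s.
    have a1 : s * `|el| <= s by rewrite ler_piMr ?(ltW s0)//; exact: nd.
    have a0 : 0 <= s * `|el| by rewrite mulr_ge0// ltW.
    rewrite !normrZ (ger0_norm t0) (gtr0_norm s0).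
    by apply: le_trans a1; rewrite ler_piMl.
  have nek : `|s *: ek| <= s by rewrite normrZ gtr0_norm// ler_piMr ?(ltW s0)//; exact: nd.
  have n1 : `|s *: ek + t *: (s *: el)| <= 2 * s by rewrite (le_trans (ler_normD _ _))//; lra.
  have n2 : `|0 + t *: (s *: el)| <= 2 * s by rewrite add0r; lra.
  have [D1 g1] := hs _ n1; have [D2 g2] := hs _ n2.
  have h1 := rhd_line (smooth_rhd oD hf D1).
  have h2 := rhd_line (smooth_rhd oD hf D2).
  have m1 : rdiff (fun t => (-1) * f (0 + t *: (s *: el))) t ((-1) * lin (rgrad f (0 + t *: (s *: el))) (s *: el)).
    move=> e e0; have [d [d0 hd]] := h2 e e0; exists d; split=> // x /hd.
    by rewrite (_ : -1 * _ - _ - _ = - (f (0 + (t + x) *: (s *: el)) - f (0 + t *: (s *: el)) - lin (rgrad f (0 + t *: (s *: el))) (s *: el) * x)) ?normrN//; ring.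
  eexists; split; first exact: rdiffD (rdiffD h1 m1) (rdiff_lin _ _).
  rewrite !linZ !lin_delta ![rgrad f _ 0 l]mxE.
  have {}g1 := g1 l; have {}g2 := g2 l.
  set x1 := s *: ek + t *: (s *: el) in n1 g1 *; set x2 := 0 + t *: (s *: el) in n2 g2 *.
  have Ex : (x1 *m A) 0 l - (x2 *m A) 0 l = s * A k l.
    rewrite /x1 /x2 add0r mulmxDl mxE addrK -scalemxAl mxE -rowE mxE.
    by [].
  rewrite (_ : _ + _ = s * ((partial l f x1 - (x1 *m A) 0 l) - (partial l f x2 - (x2 *m A) 0 l))); last first.
    rewrite (_ : s ^+ 2 * A k l = s * (s * A k l)); last by ring.
    by rewrite -Ex; ring.
  rewrite normrM gtr0_norm// (_ : 3 * eta * s ^+ 2 = s * (eta * (2 * s) + eta * s)); last by ring.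
  rewrite ler_wpM2l ?(ltW s0)// (le_trans (ler_normB _ _))// lerD//.
    by apply: le_trans g1 _; rewrite ler_wpM2l// ltW.
  apply: le_trans g2 _; rewrite ler_wpM2l ?(ltW eta0)//; by rewrite /x2 add0r.
apply/eqP; rewrite -subr_eq0 -normr_eq0 eq_le normr_ge0 andbT; apply/ler_addgt0Pr => e e0.
have e6 : 0 < e / 6 by lra.
have [d [d0 hd]] := grad_expansion e6.
pose s := d / 2; have s0 : 0 < s by rewrite /s; lra.
have hs x : `|x| <= 2 * s -> D x /\ forall j, `|partial j f x - (x *m A) 0 j| <= e / 6 * `|x|.
  by move=> hx; apply: hd; rewrite /s in hx; lra.
have k1 := key i j _ _ e6 s0 hs; have k2 := key j i _ _ e6 s0 hs.
move: k1 k2; rewrite (addrC (s *: delta_mx 0 j)).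
set F := f (_ + _); set F1 := f (s *: delta_mx 0 i); set F2 := f (s *: delta_mx 0 j) => k1 k2.
have : `|s ^+ 2 * (A j i - A i j)| <= e * s ^+ 2.
  rewrite (_ : s ^+ 2 * _ = (F - F1 - F2 + f 0 - s ^+ 2 * A i j) - (F - F2 - F1 + f 0 - s ^+ 2 * A j i)); last by ring.
  by rewrite (le_trans (ler_normB _ _))//; lra.
rewrite normrM gtr0_norm ?exprn_gt0// mulrC ler_pM2r ?exprn_gt0// add0r//.
Qed.

Lemma bil_sym x v : bil x v = bil v x.
Proof.
rewrite /bil -{2}hessian_sym.
have -> : (v *m A^T *m x^T) = (x *m A *m v^T)^T by rewrite !trmx_mul trmxK mulmxA.
by rewrite [RHS]mxE.
Qed.

Lemma bil_polar x v : bil x v = taylor2 f 0 (x + v) - taylor2 f 0 x - taylor2 f 0 v.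
Proof. by rewrite !taylor2E bilDl !bilDr (bil_sym v x); field. Qed.

End SecondOrder.

(** * Diagonalisation of hermitian forms *)

Section HermitianForms.
Variables (R : realType) (n : nat).
Local Notation C := R[i].
Local Notation Cn := 'rV[C]_n.
Implicit Types (z w v : Cn) (H T : 'M[C]_n).

Lemma conj_mul_self (x : C) : Num.conj x * x = (cn x ^+ 2)%:C.
Proof. by rewrite mulrC -normCK normE rmorphXn. Qed.

Lemma hermitian_diagonal H : H \is hermsymmx ->
  exists (T : 'M[C]_n) (d : 'I_n -> R), T \in unitmx /\ forall w,
    (map_mx Num.conj (w *m T) *m H *m (w *m T)^T) 0 0 =
    (\sum_j d j * cn (w 0 j) ^+ 2)%:C.
Proof.
move=> hH; have hP := spectral_unitarymx H; set P := spectralmx H in hP.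
have hE : H = invmx P *m diag_mx (spectral_diag H) *m P.
  exact/orthomx_spectralP/hermitian_normalmx.
have uP : P^T \in unitmx by rewrite unitmx_tr unitarymx_unit.
exists (invmx P^T), (fun j => complex.Re (spectral_diag H 0 j)).
split=> [|w]; first by rewrite unitmx_inv.
set z := w *m _; have Ew : w = z *m P^T by rewrite /z mulmxKV.
move: z Ew => z Ew.
have -> : map_mx Num.conj z *m H *m z^T =
    map_mx Num.conj w *m diag_mx (spectral_diag H) *m w^T.
  rewrite {1}hE invmx_unitary // Ew map_mxM trmx_mul trmxK !mulmxA.
  by [].
rewrite mxE rmorph_sum /=; apply: eq_bigr => j _.
rewrite mul_mx_diag !mxE mulrAC conj_mul_self mulrC [RHS]rmorphM /=; congr (_ * _).
have /mxOverP/(_ 0 j)/RRe_real -> // := hermitian_spectral_diag_real hH.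
Qed.

(** Sylvester's law with unequal weights: the positive coordinates are scaled so
    as to get the small coefficient kappa. *)
Lemma hermitian_normal_form (q : Cn -> R) H (kappa : R) : 0 < kappa ->
  H \is hermsymmx ->
  (forall z, (q z)%:C = (map_mx Num.conj z *m H *m z^T) 0 0) ->
  (forall z, (forall v, q (z + v) = q z + q v) -> z = 0) ->
  exists (T : 'M[C]_n) (N : pred 'I_n), T \in unitmx /\ forall w,
    q (w *m T) = \sum_j (if N j then -1 else kappa) * cn (w 0 j) ^+ 2.
Proof.
move=> k0 hH hq hnd; have [T [d [uT hT]]] := hermitian_diagonal hH.
have {hT}qT w : q (w *m T) = \sum_j d j * cn (w 0 j) ^+ 2.
  by apply: (@complexI R); rewrite hq hT.
have d_neq0 j : d j != 0.
  (* Otherwise the j-th axis is in the radical of q. *)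
  apply/negP => /eqP dj; pose e : Cn := delta_mx 0 j.
  have e0 k : k != j -> e 0 k = 0 by move=> /negbTE kj; rewrite mxE kj andbF.
  have eT : e *m T = 0.
    apply: hnd => v; rewrite -[v](mulmxKV uT) -mulmxDl !qT -big_split.
    apply: eq_bigr => k _ /=; have [->|kj] := eqVneq k j; first by rewrite dj !mul0r addr0.
    by rewrite [(e + _) 0 k]mxE e0// cn0 add0r expr0n mulr0 add0r.
  have := congr1 (fun M : Cn => (M *m invmx T) 0 j) eT.
  rewrite /= mulmxK// mul0mx !mxE !eqxx /= => /eqP.
  by rewrite oner_eq0.
pose N : pred 'I_n := fun j => d j < 0.
pose s j := Num.sqrt ((if N j then 1 else kappa) / `|d j|).
have s_sqr j : s j ^+ 2 = (if N j then 1 else kappa) / `|d j|.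
  by rewrite sqr_sqrtr// divr_ge0//; case: (N j) => //; exact: ltW.
have s_neq0 j : s j != 0.
  by rewrite -sqrf_eq0 s_sqr mulf_neq0 ?invr_eq0 ?normr_eq0//; case: (N j); rewrite ?oner_eq0 ?gt_eqF.
pose E : 'M[C]_n := diag_mx (\row_j (s j)%:C).
have wE w j : (w *m E) 0 j = w 0 j * (s j)%:C by rewrite mul_mx_diag !mxE.
have uE : E \in unitmx.
  rewrite unitmxE det_diag unitfE; apply/prodf_neq0 => j _; rewrite mxE.
  by apply: contra (s_neq0 j) => /eqP/complexI/eqP.
exists (E *m T), N; split=> [|w]; first by rewrite unitmx_mul uE.
rewrite mulmxA qT; apply: eq_bigr => j _; rewrite wE cnM exprMn mulrCA mulrC; congr (_ * _).
rewrite cn_real real_normK ?num_real// s_sqr mulrCA /N.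
have [dj|dj] := ltP (d j) 0; first by rewrite ltr0_norm// invrN mulrN divff// mul1r.
by rewrite ger0_norm// divff// mulr1.
Qed.

End HermitianForms.

(** * Coordinates adapted to a hermitian critical point *)

Section RealCoordinates.
Variables (R : realType) (n : nat).
Local Notation C := R[i].
Local Notation Cn := 'rV[C]_n.
Local Notation of_real := (@of_real R n).
Implicit Types (z w v : Cn) (x y : 'rV[R]_(n + n)) (D : set Cn) (rho : Cn -> R).

Lemma to_real_coord (P : R -> Prop) z :
  (forall j, P (complex.Re (z 0 j)) /\ P (complex.Im (z 0 j))) -> forall k, P (to_real z 0 k).
Proof.
move=> hP k; rewrite -[k]fintype.splitK; case: (fintype.split k) => j /=.
  by rewrite /to_real row_mxEl mxE; have [] := hP j.
by rewrite /to_real row_mxEr mxE; have [] := hP j.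
Qed.

Lemma of_realD x y : of_real (x + y) = of_real x + of_real y.
Proof. by apply/rowP => j; rewrite !mxE; apply/eqP; rewrite eq_complex /= !eqxx. Qed.

Lemma of_realZ (t : R) x : of_real (t *: x) = t%:C *: of_real x.
Proof.
by apply/rowP => j; rewrite !mxE; apply/eqP; rewrite eq_complex /= !mul0r subr0 addr0 !eqxx.
Qed.

Lemma to_realD z v : to_real (z + v) = to_real z + to_real v.
Proof. by apply: (can_inj (@of_realK R n)); rewrite of_realD !to_realK. Qed.

Lemma to_realZ (t : R) z : to_real (t%:C *: z) = t *: to_real z.
Proof. by apply: (can_inj (@of_realK R n)); rewrite of_realZ !to_realK. Qed.

Lemma to_real0 : to_real (0 : Cn) = 0.
Proof. by rewrite -(scale0r (to_real 0)) -to_realZ scale0r. Qed.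

Lemma norm_to_real z : `|to_real z| <= nv z.
Proof.
apply: norm_le_coord; first exact: nv_ge0.
apply: (to_real_coord (P := fun a => `|a| <= nv z)) => j.
by split; apply: le_trans (cn_le_nv z j); [exact: cn_Re|exact: cn_Im].
Qed.

Lemma nv_of_real x : nv (of_real x) <= 2 * `|x|.
Proof.
apply: nv_le => [|j]; first by rewrite mulr_ge0.
rewrite mxE (le_trans (cn_le_ReIm _))//= (_ : 2 * `|x| = `|x| + `|x|); last by ring.
by rewrite lerD// coord_le_norm.
Qed.

Lemma open_of_real D : open D -> open (of_real @^-1` D).
Proof.
move=> /open_nv oD; rewrite openE => x /oD[r [r0 hr]]; apply/nbhs_norm.
exists (r / 2); split=> [|y xy]; first by rewrite divr_gt0.
apply: hr; rewrite -scaleN1r -[X in X *: _](rmorphN1 (real_complex R)) -of_realZ -of_realD.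
by rewrite (le_lt_trans (nv_of_real _))// scaleN1r; rewrite ltr_pdivlMr// mulrC in xy.
Qed.

Lemma smooth_continuous D rho z : smooth_onC D rho -> D z ->
  forall e : R, 0 < e -> exists d : R, 0 < d /\ forall w, nv (w - z) < d -> `|rho w - rho z| <= e.
Proof.
move=> hs Dz e e0; have [/(_ (to_real z)) hc _] := hs 0%N.
have {hc} : {for to_real z, continuous (rho \o of_real)} by apply: hc; rewrite /preimage /= to_realK.
move=> /cvgrPdist_le/(_ e e0)/nbhs_norm[d [d0 hd]]; exists d; split=> // w wz.
rewrite distrC; have := hd (to_real w); rewrite /= !to_realK; apply.
apply: le_lt_trans wz; rewrite -scaleN1r -to_realZ.
rewrite (_ : (-1)%:C *: z = - z); last by rewrite rmorphN1 scaleN1r.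
by rewrite -to_realD norm_to_real.
Qed.

(** Nondegeneracy of the real hessian means that the radical of the quadratic part
    is trivial. A complex linear change of coordinates T brings the quadratic
    part to diagonal form, and the real expansions of order two of rho and of its
    derivatives along real lines become estimates in terms of this form S; the
    bilinear form of S appears as S (w + v) - S w - S v. *)
Lemma adapted_coordinates D rho (kappa : R) : open D -> D 0 -> smooth_onC D rho ->
  nondegenerate_hermitian_critical_point rho 0 -> 0 < kappa ->
  exists (T : 'M[C]_n) (N : pred 'I_n) (S : Cn -> R),
    [/\ T \in unitmx, S = (fun w => \sum_j (if N j then -1 else kappa) * cn (w 0 j) ^+ 2) &
    forall eta : R, 0 < eta -> exists delta : R, 0 < delta /\
      forall w, nv w <= delta -> [/\ D (w *m T),
        `|rho (w *m T) - rho 0 - S w| <= eta * nv w ^+ 2 &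
        forall w0 v (t : R), w = w0 + t%:C *: v ->
          exists b, rdiff (fun s => rho ((w0 + s%:C *: v) *m T)) t b /\
            `|b - (S (w + v) - S w - S v)| <= eta * nv w * nv v]].
Proof.
move=> oD D0 hs [[hc hu] [H [hH hq]]] k0.
pose f := rho \o of_real; pose Dr : set 'rV[R]_(n + n) := of_real @^-1` D.
have oDr : open Dr := open_of_real oD.
have f0 : f 0 = rho 0 by rewrite /f /= -to_real0 to_realK.
have Dr0 : Dr 0 by rewrite /Dr /preimage /= -to_real0 to_realK.
rewrite to_real0 in hc hu.
have hsr : smooth_on Dr f by [].
have {}hc : critical_point f 0 by [].
have qE z : quadratic_part rho 0 z = taylor2 f 0 (to_real z) by rewrite /quadratic_part to_real0.
have nd z : (forall v, quadratic_part rho 0 (z + v) = quadratic_part rho 0 z + quadratic_part rho 0 v) -> z = 0.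
  move=> hz; suff x0 : to_real z = 0 by rewrite -(to_realK z) x0 -to_real0 to_realK.
  rewrite -[to_real z](mulmxK hu) (_ : _ *m hessian _ _ = 0) ?mul0mx//.
  apply/rowP => j; rewrite [RHS]mxE.
  have := bil_polar oDr Dr0 hsr hc (to_real z) (delta_mx 0 j).
  have := hz (of_real (delta_mx 0 j)); rewrite !qE to_realD of_realK => -> .
  rewrite (_ : _ - _ - _ = 0); last by ring.
  by rewrite /bil trmx_delta -colE mxE.
have [T [N [uT hT]]] := hermitian_normal_form k0 hH hq nd.
pose S w := \sum_j (if N j then -1 else kappa) * cn (w 0 j) ^+ 2.
exists T, N, S; split=> // eta eta0.
have [K [K0 hK]] := nv_mulmx T.
have ST w : taylor2 f 0 (to_real (w *m T)) = S w by rewrite -qE hT.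
have nT w : `|to_real (w *m T)| <= K * nv w := le_trans (norm_to_real _) (hK w).
have eta'0 : 0 < eta / K ^+ 2 by rewrite divr_gt0// exprn_gt0.
have [d1 [d10 hd1]] := taylor2_expansion oDr Dr0 hsr hc eta'0.
have [d2 [d20 hd2]] := line_derivative oDr Dr0 hsr hc eta'0.
have [r [r0 hr]] : exists r : R, 0 < r /\ forall w, nv (w - 0) < r -> D w by move/open_nv: oD; apply.
pose d := Num.min (Num.min d1 d2) (r / 2).
have d0 : 0 < d by rewrite /d !lt_min d10 d20 divr_gt0.
exists (d / K); split=> [|w hw]; first by rewrite divr_gt0.
have {}hw : K * nv w <= d by rewrite mulrC -ler_pdivlMr.
have hx := le_trans (nT w) hw.
have [hdd1 hdd2 hdr] : [/\ d <= d1, d <= d2 & d <= r / 2] by rewrite /d !ge_min !lexx !orbT.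
split.
- apply: hr; rewrite subr0 (le_lt_trans (hK w))// (le_lt_trans hw)// (le_lt_trans hdr)//.
  by rewrite ltr_pdivrMr// ltr_pMr// ltr1n.
- have := hd1 _ (le_trans hx hdd1); rewrite ST f0 /f /= to_realK => /le_trans; apply.
  apply: (@le_trans _ _ (eta / K ^+ 2 * (K * nv w) ^+ 2)).
    by rewrite ler_wpM2l ?(ltW eta'0)// lerXn2r ?nnegrE// mulr_ge0 ?nv_ge0// ltW.
  by rewrite exprMn mulrA divfK// gt_eqF// exprn_gt0.
move=> w0 v t wE.
have E (s : R) : to_real ((w0 + s%:C *: v) *m T) = to_real (w0 *m T) + s *: to_real (v *m T).
  by rewrite mulmxDl -scalemxAl to_realD to_realZ.
have := hd2 (to_real (w0 *m T)) (to_real (v *m T)) t; rewrite -E -wE => /(_ (le_trans hx hdd2)).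
rewrite (bil_polar oDr Dr0 hsr hc) -to_realD -mulmxDl !ST => -[b [hb hbb]]; exists b; split.
  move: hb; congr (rdiff _ _ _); apply/funext => s.
  by rewrite -E /f /= to_realK.
apply: le_trans hbb _.
apply: (@le_trans _ _ (eta / K ^+ 2 * (K * nv w) * (K * nv v))).
  rewrite -mulrA -[leRHS]mulrA ler_wpM2l ?(ltW eta'0)//; apply: ler_pM => //; exact: nT.
rewrite (_ : _ * _ = eta * nv w * nv v)//; field; exact: lt0r_neq0.
Qed.

End RealCoordinates.

(** * Sublevel sets of a nearly diagonal function *)

Section LevelSet.
Variables (R : realType) (n : nat) (N : pred 'I_n).
Local Notation C := R[i].
Local Notation Cn := 'rV[C]_n.
Implicit Types (z w v : Cn).

(** The coefficient of the positive squares. If all positive coordinates are at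
    most ten times a negative one, z_i, then kap times the sum of their squares
    is at most 100 n kap |z_i|^2 <= |z_i|^2 / 2. *)
Definition kap : R := (200 * n.+1%:R)^-1.
Definition nform w : R := \sum_j (if N j then -1 else kap) * cn (w 0 j) ^+ 2.
Definition sqN w : R := \sum_(j | N j) cn (w 0 j) ^+ 2.
Definition sqP w : R := \sum_(j | ~~ N j) cn (w 0 j) ^+ 2.

Lemma kap_gt0 : 0 < kap.
Proof. by rewrite invr_gt0 mulr_gt0. Qed.

Lemma kap_n : 200 * (n%:R * kap) <= 1.
Proof.
rewrite /kap mulrA ler_pdivrMr ?mulr_gt0// mul1r ler_pM2l//.
by rewrite ler_nat.
Qed.

Lemma kap_le : 200 * kap <= 1.
Proof.
rewrite /kap ler_pdivrMr ?mulr_gt0// mul1r ler_pMr//.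
by rewrite ler1n.
Qed.

Lemma nformE w : nform w = kap * sqP w - sqN w.
Proof.
rewrite /nform (bigID N) /= addrC /sqP /sqN mulr_sumr -sumrN; congr (_ + _); apply: eq_bigr => j.
  by move=> /negbTE ->.
by move=> ->; rewrite mulN1r.
Qed.

Lemma sqN_ge w i : N i -> cn (w 0 i) ^+ 2 <= sqN w.
Proof. by move=> Ni; rewrite /sqN (bigD1 i)//= lerDl sumr_ge0// => j _; exact: sqr_ge0. Qed.

Lemma sqP_ge w i : ~~ N i -> cn (w 0 i) ^+ 2 <= sqP w.
Proof. by move=> Ni; rewrite /sqP (bigD1 i)//= lerDl sumr_ge0// => j _; exact: sqr_ge0. Qed.

Lemma sqP_ge0 w : 0 <= sqP w.
Proof. by rewrite sumr_ge0// => j _; exact: sqr_ge0. Qed.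

Lemma sqP_le w B : (forall j, ~~ N j -> cn (w 0 j) ^+ 2 <= B) -> 0 <= B -> sqP w <= n%:R * B.
Proof.
move=> hB B0; apply: (@le_trans _ _ (\sum_(j < n) B)); last by rewrite sumr_const card_ord mulr_natl.
by rewrite /sqP big_mkcond; apply: ler_sum => j _; case: ifPn => // /hB.
Qed.

Lemma nv_sqr_le w B : 0 <= B -> (forall j, cn (w 0 j) ^+ 2 <= B) -> nv w ^+ 2 <= B.
Proof.
move=> B0 hB; rewrite -[leRHS]sqr_sqrtr// lerXn2r ?nnegrE ?nv_ge0 ?sqrtr_ge0//.
apply: nv_le => [|j]; first exact: sqrtr_ge0.
by rewrite -[leLHS]ger0_norm ?cn_ge0// -sqrtr_sqr ler_wsqrtr.
Qed.

(** Only the positive coordinates contribute, and there w is t times v. *)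
Lemma nform_polar w v (t : R) : (forall j, N j -> v 0 j = 0) ->
  (forall j, ~~ N j -> w 0 j = t%:C * v 0 j) ->
  nform (w + v) - nform w - nform v = 2 * kap * t * sqP v.
Proof.
move=> vN wP; rewrite !nformE.
have -> : sqN (w + v) = sqN w.
  by apply: eq_bigr => j Nj; rewrite mxE vN// addr0.
have -> : sqN v = 0.
  by rewrite /sqN big1// => j Nj; rewrite vN// cn0 expr0n.
have -> : sqP w = t ^+ 2 * sqP v.
  rewrite /sqP mulr_sumr; apply: eq_bigr => j Nj.
  by rewrite wP// cnM cn_real exprMn real_normK ?num_real.
have -> : sqP (w + v) = (1 + t) ^+ 2 * sqP v.
  rewrite /sqP mulr_sumr; apply: eq_bigr => j Nj; rewrite mxE wP//.
  rewrite (_ : t%:C * v 0 j + v 0 j = (1 + t)%:C * v 0 j); last by rewrite rmorphD rmorph1; ring.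
  by rewrite cnM cn_real exprMn real_normK ?num_real.
ring.
Qed.

Variables (g : Cn -> R) (c e : R).
Hypothesis g_expansion : forall w, nv w < e -> `|g w - c - nform w| <= kap / 2 * nv w ^+ 2.
Hypothesis g_derivative : forall w0 v (t : R), nv (w0 + t%:C *: v) < e ->
  exists b, rdiff (fun s => g (w0 + s%:C *: v)) t b /\
    `|b - (nform (w0 + t%:C *: v + v) - nform (w0 + t%:C *: v) - nform v)| <=
      kap / 2 * nv (w0 + t%:C *: v) * nv v.

(** Here sqN z is at least twice kap * sqP z, and nv z ^+ 2 <= 100 * sqN z. *)
Lemma sublevel_cone z i : nv z < e -> N i -> z 0 i != 0 ->
  (forall j, ~~ N j -> cn (z 0 j) < 10 * cn (z 0 i)) -> g z < c.
Proof.
move=> ze Ni zi hj; have := g_expansion ze; rewrite nformE ler_norml => /andP[_].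
have X0 : 0 < cn (z 0 i) ^+ 2 by rewrite exprn_gt0// cn_gt0.
have X1 := sqN_ge z Ni; set X := sqN z in X1 *; set a := cn (z 0 i) ^+ 2 in X0 X1.
have hjj j : ~~ N j -> cn (z 0 j) ^+ 2 <= 100 * a.
  move=> /hj h; rewrite (_ : 100 * a = (10 * cn (z 0 i)) ^+ 2); last by rewrite /a; ring.
  by rewrite lerXn2r ?nnegrE ?cn_ge0 ?mulr_ge0 ?cn_ge0// ltW.
have a100 : 0 <= 100 * a by rewrite mulr_ge0// ltW.
have hP := sqP_le hjj a100.
have hnv : nv z ^+ 2 <= 100 * X.
  apply: nv_sqr_le => [|j]; first by rewrite mulr_ge0// ltW// (lt_le_trans X0).
  have [Nj|/hjj h] := boolP (N j); last by lra.
  by have := sqN_ge z Nj; rewrite -/X; lra.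
have h1 : kap * sqP z <= a / 2.
  apply: (le_trans (ler_wpM2l (ltW kap_gt0) hP)).
  have := ler_wpM2r (ltW X0) kap_n; rewrite mul1r; lra.
have h2 : kap / 2 * nv z ^+ 2 <= X / 4.
  apply: (@le_trans _ _ (kap / 2 * (100 * X))).
    by rewrite ler_wpM2l// divr_ge0// ltW// kap_gt0.
  have := ler_wpM2r (ltW (lt_le_trans X0 X1)) kap_le; rewrite mul1r; lra.
lra.
Qed.

(** On the common zero set of the negative coordinates the form is kap * sqP, which
    dominates the remainder. *)
Lemma sublevel_nonzero z : nv z < e -> g z < c -> exists i, N i /\ z 0 i != 0.
Proof.
move=> ze gz; apply: contrapT => hN.
have zN j : N j -> z 0 j = 0.
  by move=> Nj; apply/eqP; apply: contrapT => /negP zj; apply: hN; exists j.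
have := g_expansion ze; rewrite nformE ler_norml => /andP[+ _].
have -> : sqN z = 0 by rewrite /sqN big1// => j /zN ->; rewrite cn0 expr0n.
have hnv : nv z ^+ 2 <= sqP z.
  apply: nv_sqr_le => [|j]; first exact: sqP_ge0.
  have [/zN ->|] := boolP (N j); last exact: sqP_ge.
  by rewrite cn0 expr0n sqP_ge0.
have := ler_wpM2l (ltW kap_gt0) hnv; have := mulr_ge0 (ltW kap_gt0) (sqP_ge0 z).
lra.
Qed.

Lemma rdiffN (k : R -> R) t b : rdiff k t b -> rdiff (fun s => - k s) t (- b).
Proof.
move=> h eta /h[d [d0 hd]]; exists d; split=> // s /hd.
by rewrite (_ : - k _ - - k _ - - b * s = - (k (t + s) - k t - b * s)) ?normrN//; ring.
Qed.

(** Suppose that g is at least c at the contraction of z by t. This point is then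
    outside the cone of sublevel_cone, so the negative coordinates of z are at most
    the largest positive one of sc t z, and a fortiori of sc s z for s >= t.
    In that region g increases with s, so g z >= c as well. *)
Lemma sublevel_star z (t : R) : nv z < e -> g z < c -> 0 <= t <= 1 -> g (sc N t z) < c.
Proof.
move=> ze gz t01; rewrite ltNge; apply/negP => ct.
have /andP[t0 t1] := t01.
pose y := z - sc N 0 z.
have yN j : N j -> y 0 j = 0 by move=> Nj; rewrite !mxE Nj subrr.
have yP j : ~~ N j -> y 0 j = z 0 j by move=> /negbTE Nj; rewrite !mxE Nj mul0r subr0.
have small i : N i -> cn (z 0 i) <= t * nv y.
  move=> Ni; have [->|zi] := eqVneq (z 0 i) 0; first by rewrite cn0 mulr_ge0 ?nv_ge0.
  apply: contrapT => /negP; rewrite -ltNge => hi; move: ct; rewrite leNgt => /negP; apply.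
  apply: (sublevel_cone (i := i)) => //; first exact: le_lt_trans (nv_sc N z t01) ze.
    by rewrite scE Ni.
  move=> j Nj; rewrite !scE Ni (negbTE Nj) -yP// cnM cn_real ger0_norm//.
  have := ler_wpM2l t0 (cn_le_nv y j); have := cn_ge0 (z 0 i); lra.
have nsc s : t <= s <= 1 -> nv (sc N s z) <= s * nv y.
  move=> /andP[ts s1]; have s0 := le_trans t0 ts.
  apply: nv_le => [|j]; first by rewrite mulr_ge0 ?nv_ge0.
  rewrite scE; have [Nj|Nj] := boolP (N j).
    by apply: le_trans (small _ Nj) _; rewrite ler_wpM2r ?nv_ge0.
  by rewrite -yP// cnM cn_real ger0_norm// ler_wpM2l// cn_le_nv.
have scS s : sc N t z + s%:C *: y = sc N (t + s) z.
  by rewrite (sc_segment N t) (sc_segment N (t + s)) -addrA -scalerDl -rmorphD.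
have : - g (sc N t z + (1 - t)%:C *: y) <= - g (sc N t z + (0 : R)%:C *: y).
  apply: (@rdiff_mvt R (fun s => - g (sc N t z + s%:C *: y))); first by rewrite subr_ge0.
  move=> s /andP[s0 s1]; have ts : t <= t + s <= 1 by lra.
  have ts0 : 0 <= t + s <= 1 by lra.
  have hw : nv (sc N t z + s%:C *: y) < e.
    by rewrite scS; apply: le_lt_trans (nv_sc N z ts0) ze.
  have [b [hb]] := g_derivative hw.
  rewrite (nform_polar (t := t + s)) => [|//|j Nj]; last first.
    by rewrite scS scE (negbTE Nj) yP.
  rewrite scS ler_norml => /andP[h1 _].
  exists (- b); split; first exact: rdiffN.
  have h2 : nv (sc N (t + s) z) * nv y <= (t + s) * sqP y.
    apply: (@le_trans _ _ ((t + s) * nv y * nv y)).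
      by rewrite ler_wpM2r ?nv_ge0// nsc.
    rewrite -mulrA ler_wpM2l//; first by lra.
    rewrite -expr2; apply: nv_sqr_le => [|j]; first exact: sqP_ge0.
    have [/yN ->|] := boolP (N j); last exact: sqP_ge.
    by rewrite cn0 expr0n sqP_ge0.
  have h3 := ler_wpM2l (ltW kap_gt0) h2.
  have h4 : 0 <= kap * ((t + s) * sqP y).
    by rewrite !mulr_ge0 ?sqP_ge0 ?(ltW kap_gt0)//; lra.
  lra.
rewrite scS (_ : t + (1 - t) = 1); last by ring.
by rewrite sc1 rmorph0 scale0r addr0; lra.
Qed.

End LevelSet.

(** * Complex linear changes of coordinates *)

Section LinearChange.
Variables (R : realType) (n : nat).
Local Notation C := R[i].
Local Notation Cn := 'rV[C]_n.
Implicit Types (z w v : Cn) (A T : 'M[C]_n) (U V K : set Cn) (f : Cn -> C).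

Lemma mulmx_continuous A : continuous (fun z : Cn => z *m A).
Proof.
move=> z B /nbhs_nv[r [r0 hr]]; have [k [k0 hk]] := nv_mulmx A.
apply/nbhs_nv; exists (r / k); split=> [|w]; first by rewrite divr_gt0.
rewrite ltr_pdivlMr// mulrC => wz; apply: hr.
by rewrite -mulmxBl (le_lt_trans (hk _)).
Qed.

Lemma open_mulmx V A : open V -> open [set z | V (z *m A)].
Proof. by move=> oV; apply: open_comp => // z _; exact: mulmx_continuous. Qed.

Lemma holo_mulmx U V f A : (forall z, V z -> U (z *m A)) ->
  holomorphic_on U f -> holomorphic_on V (fun z => f (z *m A)).
Proof.
move=> hV /(@holo_affine _ _ _ V _ 0 A); rewrite (_ : (fun _ => _) = (fun z => f (z *m A))).
  by apply=> z /hV; rewrite add0r.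
by apply/funext => z; rewrite add0r.
Qed.

(** The image of the hull of K lies in the hull of the image of K, which is compact. *)
Lemma Stein_mulmx V A : A \in unitmx -> Stein V -> Stein [set z | V (z *m A)].
Proof.
move=> uA [oV cV _ _]; apply: Stein_crit; first exact: open_mulmx.
move=> K cK KV; pose KA : set Cn := (fun z => z *m A) @` K.
have cKA : compact KA.
  by apply: continuous_compact => //; apply: continuous_subspaceT; exact: mulmx_continuous.
have KAV : KA `<=` V by move=> _ [z Kz <-]; exact: KV.
have hullV : holomorphic_hull V KA `<=` V by move=> z [].
have [s [s0 hs]] := compact_thick (cV KA KAV cKA) oV hullV.
have [k [k0 hk]] := nv_mulmx A.
exists (s / k); split=> [|p /hullP[Vp hp] w]; first by rewrite divr_gt0.
rewrite /pd /= ltr_pdivlMr// mulrC => wp; apply: (hs (p *m A)); last first.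
  by rewrite /pd /= -mulmxBl (le_lt_trans (hk _)).
apply/hullP; split=> // f hf M hM.
apply: (hp (fun z => f (z *m A))) => [|z Kz]; first exact: holo_mulmx hf.
by apply: hM; exists z.
Qed.

End LinearChange.

(** * The sublevel set near the critical point *)

Section LevelSetExtension.
Variables (R : realType) (n : nat).
Local Notation C := R[i].
Local Notation Cn := 'rV[C]_n.
Variables (D : set Cn) (rho : Cn -> R).
Hypotheses (oD : open D) (smooth_rho : smooth_onC D rho).
Let Omega : set Cn := [set z | D z /\ rho z < rho 0].

Lemma sublevel_open : open Omega.
Proof.
apply/open_nv => z [Dz hz].
have [r [r0 hr]] : exists r : R, 0 < r /\ forall w, nv (w - z) < r -> D w.
  by have /open_nv := oD; apply.
have e0 : 0 < (rho 0 - rho z) / 2 by rewrite divr_gt0// subr_gt0.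
have [d [d0 hd]] := smooth_continuous smooth_rho Dz e0.
exists (Num.min r d); split=> [|w]; first by rewrite lt_min r0.
rewrite lt_min => /andP[/hr Dw /hd]; rewrite ler_norml => /andP[_ h].
by split=> //; lra.
Qed.

Variables (T : 'M[C]_n) (N : pred 'I_n) (e0 : R).
Hypotheses (uT : T \in unitmx) (e0_gt0 : 0 < e0).
Hypothesis (rho_D : forall w, nv w < e0 -> D (w *m T)).
Hypothesis rho_expansion : forall w, nv w < e0 ->
  `|rho (w *m T) - rho 0 - nform N w| <= kap R n / 2 * nv w ^+ 2.
Hypothesis rho_derivative : forall (w0 v : Cn) (t : R), nv (w0 + t%:C *: v) < e0 ->
  exists b, rdiff (fun s => rho ((w0 + s%:C *: v) *m T)) t b /\
    `|b - (nform N (w0 + t%:C *: v + v) - nform N (w0 + t%:C *: v) - nform N v)| <=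
      kap R n / 2 * nv (w0 + t%:C *: v) * nv v.

(** Without negative coordinates sublevel_nonzero leaves no point of the sublevel set. *)
Lemma negative_direction : ~ local_minimum rho 0 -> exists i, N i.
Proof.
apply: contra_notP => hN; have [k [k0 hk]] := nv_mulmx (invmx T).
apply/nbhs_nv; exists (e0 / k); split=> [|z]; first by rewrite divr_gt0.
rewrite subr0 ltr_pdivlMr// mulrC => /(le_lt_trans (hk z)) hz.
rewrite leNgt; apply/negP => rz; apply: hN.
have := sublevel_nonzero (g := fun w => rho (w *m T)) rho_expansion hz.
by rewrite mulmxKV// => /(_ rz)[i [Ni _]]; exists i.
Qed.

(** The points on the i-th axis close to 0 belong to the cone of sublevel_cone. *)
Lemma sublevel_boundary i : N i -> boundary Omega 0.
Proof.
move=> Ni; split; last by move=> /interior_subset[_]; rewrite ltxx.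
move=> B /nbhs_nv[r [r0 hr]]; have [k [k0 hk]] := nv_mulmx T.
pose s := Num.min (e0 / 2) (r / k / 2).
have s0 : 0 < s by rewrite /s lt_min !divr_gt0.
have [se sr] : s < e0 /\ s < r / k.
  by split; rewrite /s gt_min; apply/orP; [left|right]; rewrite gtr_pMr ?divr_gt0 ?invf_lt1 ?ltr1n.
pose w : Cn := s%:C *: delta_mx 0 i.
have wE j : w 0 j = if j == i then s%:C else 0.
  by rewrite !mxE eqxx /=; case: (j == i); rewrite ?mulr1 ?mulr0.
have nw : nv w <= s.
  apply: nv_le => [|j]; first exact: ltW.
  by rewrite wE; case: (j == i); rewrite ?cn0 ?cn_real ?gtr0_norm// ltW.
have we := le_lt_trans nw se.
exists (w *m T); split; last first.
  apply: hr; rewrite subr0 (le_lt_trans (hk w))// mulrC -ltr_pdivlMr//.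
  exact: le_lt_trans nw sr.
split; first exact: rho_D.
apply: (sublevel_cone (g := fun w => rho (w *m T)) rho_expansion we Ni).
  by rewrite wE eqxx -cn_gt0 cn_real gtr0_norm.
move=> j Nj; rewrite !wE eqxx (_ : (j == i) = false) ?cn0; last first.
  by apply/negbTE; apply: contra Nj => /eqP ->.
by rewrite mulr_gt0// cn_real gtr0_norm.
Qed.

Lemma sublevel_extension (e : R) : 0 < e -> e <= e0 -> (exists i, N i) ->
  exists V : set Cn, [/\ Stein V,
    Omega `&` [set z | pd 0 e (z *m invmx T)] `<=` V,
    V `<=` [set z | pd 0 e (z *m invmx T)] &
    forall f, holomorphic_on (Omega `&` [set z | pd 0 e (z *m invmx T)]) f ->
      exists g, holomorphic_on V g /\
        forall z, (Omega `&` [set z | pd 0 e (z *m invmx T)]) z -> g z = f z].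
Proof.
move=> e_gt0 ee0 hN; have pdE (w : Cn) : pd 0 e w -> nv w < e0.
  by rewrite /pd /= subr0 => we; exact: lt_le_trans we ee0.
pose O : set Cn := pd 0 e `&` [set w | Omega (w *m T)].
have [||||||V [SV OV Ve hV]] := @core_extension R n N e O e_gt0.
- by apply: openI; [exact: pd_open|apply: open_mulmx; exact: sublevel_open].
- by move=> w [].
- by [].
- move=> z ze [i [Ni zi hj]]; have ze0 := pdE _ ze; split=> //; split; first exact: rho_D.
  exact: (sublevel_cone (g := fun w => rho (w *m T)) rho_expansion ze0 Ni zi hj).
- move=> z [/pdE ze [_ hz]].
  exact: (sublevel_nonzero (g := fun w => rho (w *m T)) rho_expansion ze hz).
- move=> z t [ze [_ hz]] t01.
  have ste : pd 0 e (sc N t z).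
    by move: ze; rewrite /pd /= !subr0; apply: le_lt_trans; exact: nv_sc.
  split=> //; split; first by apply: rho_D; exact: pdE.
  exact: (sublevel_star (g := fun w => rho (w *m T)) rho_expansion rho_derivative (pdE _ ze) hz t01).
exists [set z | V (z *m invmx T)]; split.
- by apply: Stein_mulmx; rewrite ?unitmx_inv.
- by move=> z [Oz ze]; apply: OV; split=> //=; rewrite mulmxKV.
- by move=> z /Ve.
move=> f hf; have [g [hg gf]] : exists g, holomorphic_on V g /\ forall w, O w -> g w = f (w *m T).
  apply: hV; apply: holo_mulmx hf => w [we Ow]; split=> //=.
  by rewrite mulmxK.
exists (fun z => g (z *m invmx T)); split; first exact: holo_mulmx hg.
by move=> z [Oz ze]; rewrite gf ?mulmxKV//; split=> //=; rewrite mulmxKV.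
Qed.

End LevelSetExtension.

Unset Implicit Arguments.
Set Printing Implicit Defensive.
Local Close Scope complex_scope.

Theorem mainTheorem3 (R : realType) (n : nat) (D : set 'rV[R[i]]_n)
    (rho : 'rV[R[i]]_n -> R)
    (D_open : open D) (D_0 : D 0)
    (rho_smooth : smooth_onC D rho)
    (rho_crit : nondegenerate_hermitian_critical_point rho 0)
    (rho_not_min : ~ local_minimum rho 0) :
  locally_schlicht [set z | D z /\ rho z < rho 0] 0.
Proof.
have [T [N [S [uT SE hT]]]] :=
  adapted_coordinates D_open D_0 rho_smooth rho_crit (kap_gt0 R n).
have eta0 : 0 < kap R n / 2 by rewrite divr_gt0// kap_gt0.
have [e0 [e0_gt0 he0]] := hT _ eta0; rewrite {}SE {S hT} in he0.
have rho_D w : nv w < e0 -> D (w *m T) by move=> /ltW/he0[].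
have rho_exp w : nv w < e0 -> `|rho (w *m T) - rho 0 - nform N w| <= kap R n / 2 * nv w ^+ 2.
  by move=> /ltW/he0[].
have rho_der (w0 v : 'rV[R[i]]_n) (t : R) : nv (w0 + (t%:C)%C *: v) < e0 ->
  exists b, rdiff (fun s => rho ((w0 + (s%:C)%C *: v) *m T)) t b /\
    `|b - (nform N (w0 + (t%:C)%C *: v + v) - nform N (w0 + (t%:C)%C *: v) - nform N v)| <=
      kap R n / 2 * nv (w0 + (t%:C)%C *: v) * nv v.
  by move=> /ltW/he0[_ _]; apply.
have hN := negative_direction uT e0_gt0 rho_exp rho_not_min.
split.
- exact: sublevel_open.
- by have [i Ni] := hN; exact: sublevel_boundary rho_D rho_exp _ Ni.
move=> W /nbhs_nv[r [r0 hr]]; have [k [k0 hk]] := nv_mulmx T.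
pose e := Num.min e0 (r / k).
have e_gt0 : 0 < e by rewrite /e lt_min e0_gt0 divr_gt0.
have [ee0 er] : e <= e0 /\ e <= r / k by rewrite /e !ge_min !lexx orbT.
exists [set z | pd 0 e (z *m invmx T)]; split.
- by apply: open_mulmx; exact: pd_open.
- by rewrite /= mul0mx; exact: pd_center.
- move=> z /=; rewrite /pd /= subr0 => ze; apply: hr; rewrite subr0 -[z](mulmxKV uT).
  by rewrite (le_lt_trans (hk _))// mulrC -ltr_pdivlMr// (lt_le_trans ze).
- split; last by apply: Stein_mulmx; rewrite ?unitmx_inv//; exact: pd_Stein.
  rewrite (_ : [set _ | _] = (fun w => w *m T) @` pd 0 e).
    apply: connected_continuous_connected; first exact: pd_connected.
    by apply: continuous_subspaceT; exact: mulmx_continuous.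
  apply/seteqP; split=> [z ze|_ [w we <-]]; last by rewrite /= mulmxK.
  by exists (z *m invmx T) => //; rewrite mulmxKV.
exact: (sublevel_extension D_open rho_smooth uT rho_D rho_exp rho_der e_gt0 ee0 hN).
Qed.
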